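(* Let $n\ge 2$ and let $\phi : M^n \rightarrow \mathbb{C}^n$ be a Lagrangian homothetic soliton for the inverse mean curvature flow, with constant velocity $a\neq 0$. If $\phi$ is invariant under the action of the special orthogonal group given by $$SO(n)\times \mathbb{C}^{n}\longrightarrow \mathbb{C}^n,\qquad (A,(z_1,\dots,z_n)) \mapsto (z_1,\dots,z_n)A,$$ then $\phi$ is, up to dilations, the immersion $\mathbb{R} \times \mathbb{S}^{n-1} \rightarrow \mathbb{C}^n$ given by $$(\theta,x) \mapsto |\alpha(\theta)|^{1/n}\, e^{i\arg \alpha (\theta) /n} (x_1,\dots,x_n),$$ where $\alpha (\theta)= \left( -\vartheta'(\theta)\cos\theta - \vartheta(\theta) \sin \theta ,\ -\vartheta'(\theta)\sin\theta + \vartheta(\theta) \cos \theta \right)\in\mathbb{R}^2\equiv\mathbb{C}$, with $$\vartheta(\theta)= \begin{cases} c_1 \cos (\sqrt{1-na}\,\theta)+ c_2 \sin (\sqrt{1-na}\, \theta) & \text{if } a<1/n, \\ c_1+c_2 \, \theta & \text{if } a=1/n, \\ c_1 \cosh (\sqrt{na-1}\, \theta) + c_2 \sinh (\sqrt{na-1}\, \theta) & \text{if } a>1/n, \end{cases}$$ for some $c_1,c_2 \in \mathbb{R}$.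
   Context: Let $\phi : M^n \to \mathbb{R}^m$ be an isometric immersion of a (connected) $n$-dimensional Riemannian manifold, with second fundamental form $\sigma$ and mean curvature vector $H=\mathrm{trace}\,\sigma$ (not divided by $n$), assumed nowhere vanishing. $\phi$ is a homothetic soliton for the inverse mean curvature flow with constant velocity $a\neq 0$ ($a$ a real constant) if $-\frac{H}{|H|^2}=a\,\phi^\bot$, where $\phi^\bot$ is the projection of the position vector $\phi$ onto the normal bundle. This condition is invariant under dilations $\phi\mapsto\rho\phi$, $\rho>0$. An immersion $\phi:M^n\to\mathbb{C}^n$ is Lagrangian if $\phi^*\omega=0$, where $\omega(\cdot,\cdot)=\langle J\cdot,\cdot\rangle$ and $J$ is the complex structure of $\mathbb{C}^n$. Here $\arg\alpha$ denotes a continuous choice of argument along $\alpha$, and $x=(x_1,\dots,x_n)\in\mathbb{S}^{n-1}\subset\mathbb{R}^n$. *)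

(* Defs.v *)
From HB Require Import structures.
From mathcomp Require Import all_boot all_order all_algebra.
From mathcomp Require Import all_classical all_reals all_analysis.

Set Implicit Arguments.
Unset Strict Implicit.
Unset Printing Implicit Defensive.

Import Order.TTheory GRing.Theory Num.Theory.
Import numFieldNormedType.Exports.

Local Open Scope classical_set_scope.
Local Open Scope ring_scope.

Section Smooth.
Context {R : realType} {V W : normedModType R}.

(* In finite dimension this is the usual class C^k on the open set U. *)
Fixpoint Ck_on (k : nat) (U : set V) (f : V -> W) : Prop :=
  match k with
  | 0%N => forall x, U x -> {for x, continuous f}
  | k'.+1 => (forall x, U x -> differentiable f x) /\
             (forall v, Ck_on k' U (fun x => 'D_v f x))
  end.

Definition smooth_on (U : set V) (f : V -> W) : Prop := forall k, Ck_on k U f.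

End Smooth.

Section Manifold.

(* cmap and cinv are total functions; only their values on cdom, resp. cimg,
   are meaningful. *)
Record chart (R : realType) (n : nat) (M : topologicalType) := Chart {
  cdom : set M;
  cimg : set 'rV[R]_n;
  cmap : M -> 'rV[R]_n;
  cinv : 'rV[R]_n -> M;
  cdom_open : open cdom;
  cimg_open : open cimg;
  cmap_img : forall p, cdom p -> cimg (cmap p);
  cinv_dom : forall x, cimg x -> cdom (cinv x);
  cmapK : forall p, cdom p -> cinv (cmap p) = p;
  cinvK : forall x, cimg x -> cmap (cinv x) = x;
  cmap_continuous : forall p, cdom p -> {for p, continuous cmap};
  cinv_continuous : forall x, cimg x -> {for x, continuous cinv}
}.

Definition transition (R : realType) n (M : topologicalType)
  (e e' : chart R n M) : 'rV[R]_n -> 'rV[R]_n := cmap e' \o cinv e.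

Definition overlap (R : realType) n (M : topologicalType)
  (e e' : chart R n M) : set 'rV[R]_n := cimg e `&` cinv e @^-1` cdom e'.

Record manifold (R : realType) (n : nat) := Manifold {
  carrier :> topologicalType;
  atlas : set (chart R n carrier);
  carrier_hausdorff : hausdorff_space carrier;
  carrier_second_countable : @second_countable carrier;
  atlas_cover : forall p, exists2 e, atlas e & cdom e p;
  atlas_smooth : forall e e', atlas e -> atlas e' ->
    smooth_on (overlap e e') (transition e e')
}.

Definition smooth_map (R : realType) n (M : manifold R n)
  (W : normedModType R) (U : set M) (f : M -> W) : Prop :=
  forall e, atlas e -> smooth_on (cimg e `&` cinv e @^-1` U) (f \o cinv e).

(* gram e x is the matrix (g_ij(x)) in the chart e.  Tangent vectors are rows,
   so 'd f x v = v *m 'J f x and g(v, w) = v *m gram e x *m w^T. *)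
Record riemannian_metric (R : realType) (n : nat) (M : manifold R n) :=
  RiemannianMetric {
  gram : chart R n M -> 'rV[R]_n -> 'M[R]_n;
  gram_smooth : forall e, atlas e -> smooth_on (cimg e) (gram e);
  gram_sym : forall e x, atlas e -> cimg e x -> (gram e x)^T = gram e x;
  gram_pos : forall e x, atlas e -> cimg e x ->
    forall v : 'rV[R]_n, v != 0 -> 0 < (v *m gram e x *m v^T) 0 0;
  gram_change : forall e e' x, atlas e -> atlas e' -> overlap e e' x ->
    gram e x = 'J (transition e e') x *m gram e' (transition e e' x)
               *m ('J (transition e e') x)^T
}.

End Manifold.

Section Immersion.
Context {R : realType} {n m : nat} {M : manifold R n}.
Implicit Types (g : riemannian_metric M) (phi : M -> 'rV[R]_m).

Definition dot k (u v : 'rV[R]_k) : R := \sum_i u 0 i * v 0 i.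

Definition smooth_immersion phi : Prop :=
  smooth_map [set: M] phi /\
  forall e x, atlas e -> cimg e x -> row_free ('J (phi \o cinv e) x).

Definition isometric_immersion g phi : Prop :=
  smooth_immersion phi /\
  forall e x, atlas e -> cimg e x -> forall v w,
    dot (v *m 'J (phi \o cinv e) x) (w *m 'J (phi \o cinv e) x)
    = (v *m gram g e x *m w^T) 0 0.

(* Component of z orthogonal to the row space of D (for row-free D, the
   orthogonal projection onto that row space is D^T (D D^T)^-1 D). *)
Definition normal_part (D : 'M[R]_(n, m)) (z : 'rV[R]_m) : 'rV[R]_m :=
  z - z *m D^T *m invmx (D *m D^T) *m D.

Definition partial (f : 'rV[R]_n -> 'rV[R]_m) (i : 'I_n) (x : 'rV[R]_n) :
  'rV[R]_m := 'D_(delta_mx 0 i) f x.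

(* sigma(d_i, d_j) in the chart e: by the Gauss formula it is the normal part
   of the second partial derivative of phi in R^m. *)
Definition second_form phi (e : chart R n M) (x : 'rV[R]_n) (i j : 'I_n) :
  'rV[R]_m :=
  normal_part ('J (phi \o cinv e) x) (partial (partial (phi \o cinv e) j) i x).

(* Trace of sigma with respect to g, not divided by n. *)
Definition mean_curvature g phi (e : chart R n M) (x : 'rV[R]_n) : 'rV[R]_m :=
  \sum_i \sum_j (invmx (gram g e x)) i j *: second_form phi e x i j.

Definition imcf_homothetic_soliton g (a : R) phi : Prop :=
  forall e x, atlas e -> cimg e x ->
    let H := mean_curvature g phi e x in
    H != 0 /\
    - ((dot H H)^-1 *: H)
    = a *: normal_part ('J (phi \o cinv e) x) (phi (cinv e x)).

End Immersion.

(* C^n is 'rV[R]_(n + n): u + i v is row_mx u v. *)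
Section ComplexSpace.
Context {R : realType} {n : nat}.

Definition Jmul (z : 'rV[R]_(n + n)) : 'rV[R]_(n + n) :=
  row_mx (- rsubmx z) (lsubmx z).

Definition omega (z w : 'rV[R]_(n + n)) : R := dot (Jmul z) w.

Definition lagrangian (M : manifold R n) (phi : M -> 'rV[R]_(n + n)) : Prop :=
  forall e x, atlas e -> cimg e x -> forall v w : 'rV[R]_n,
    omega (v *m 'J (phi \o cinv e) x) (w *m 'J (phi \o cinv e) x) = 0.

Definition SO (A : 'M[R]_n) : Prop := A *m A^T = 1%:M /\ \det A = 1.

Definition SO_act (A : 'M[R]_n) (z : 'rV[R]_(n + n)) : 'rV[R]_(n + n) :=
  row_mx (lsubmx z *m A) (rsubmx z *m A).

(* Invariance of the immersed submanifold phi(M).  It holds in particular when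
   SO(n) acts on M and phi is equivariant. *)
Definition SO_invariant (M : Type) (phi : M -> 'rV[R]_(n + n)) : Prop :=
  forall A, SO A -> SO_act A @` range phi = range phi.

End ComplexSpace.

Section Model.
Context {R : realType}.

Definition cosh (x : R) : R := (expR x + expR (- x)) / 2.
Definition sinh (x : R) : R := (expR x - expR (- x)) / 2.

Definition vartheta (n : nat) (a c1 c2 : R) (t : R) : R :=
  if a < n%:R^-1 then
    c1 * cos (Num.sqrt (1 - n%:R * a) * t)
    + c2 * sin (Num.sqrt (1 - n%:R * a) * t)
  else if a == n%:R^-1 then c1 + c2 * t
  else c1 * cosh (Num.sqrt (n%:R * a - 1) * t)
       + c2 * sinh (Num.sqrt (n%:R * a - 1) * t).

Definition alpha (n : nat) (a c1 c2 : R) (t : R) : R * R :=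
  let h := vartheta n a c1 c2 in
  (- derive1 h t * cos t - h t * sin t, - derive1 h t * sin t + h t * cos t).

Definition cmod (z : R * R) : R := Num.sqrt (z.1 ^+ 2 + z.2 ^+ 2).

Definition continuous_arg (al : R -> R * R) (arg : R -> R) : Prop :=
  continuous arg /\
  forall t, al t = (cmod (al t) * cos (arg t), cmod (al t) * sin (arg t)).

Definition sphere (n : nat) : set 'rV[R]_n := [set x | dot x x = 1].

(* |alpha|^(1/n) exp(i arg(alpha) / n) x *)
Definition model (n : nat) (al : R -> R * R) (arg : R -> R)
  (t : R) (x : 'rV[R]_n) : 'rV[R]_(n + n) :=
  let r := cmod (al t) `^ n%:R^-1 in
  row_mx ((r * cos (arg t / n%:R)) *: x) ((r * sin (arg t / n%:R)) *: x).

(* phi is an immersed piece of f : R x S^(n-1) -> C^n: its image is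
   f (I x S^(n-1)) for an open interval I, and near every point of M it is f
   composed with a smooth map (theta, xi) into I x S^(n-1).  When phi is an
   immersion of an n-dimensional M, such a (theta, xi) has injective
   differential, hence is a local diffeomorphism.  A global (theta, xi) need
   not exist: M may be a quotient of I x S^(n-1), e.g. when alpha runs
   periodically around a circle. *)
Definition parametrized_by (n : nat) (M : manifold R n)
  (phi : M -> 'rV[R]_(n + n)) (f : R -> 'rV[R]_n -> 'rV[R]_(n + n)) : Prop :=
  exists I : set R,
    [/\ open I, is_interval I,
        range phi = [set z | exists t x, [/\ I t, sphere x & z = f t x]] &
        forall p : M, exists (U : set M) (theta : M -> R) (xi : M -> 'rV[R]_n),
          [/\ open U, U p, smooth_map U theta, smooth_map U xi &
              forall q, U q ->
                [/\ I (theta q), sphere (xi q) & phi q = f (theta q) (xi q)]]].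

End Model.

(* Main.v *)
(* Write phi = u + i v.  The velocity A phi of each rotation generator A is
   tangent to M: otherwise (t, x) |-> phi(x) exp(t A) would immerse an
   (n+1)-dimensional disc into the image of phi, a countable union of
   n-dimensional sheets, against Baire's theorem.  Since M is Lagrangian, H is
   orthogonal to J A phi (its pairing is a trace of i A), and the soliton
   equation turns this into <phi, J A phi> = 0, that is, u and v are parallel.
   Hence phi = r e^(i psi) xi locally, with xi in the sphere, and the Lagrangian
   condition makes (r, psi) of rank one.  If theta is the tangent angle of the
   curve (r e^(i psi))^n, then <H, J d_k phi> = d_k theta, so that the soliton
   equation becomes h'' = -(1 - n a) h for the support function h of that curve
   as a function of theta.  This linear equation has two first integrals c1, c2,
   and the parameters t that a point of M can be assigned by a model with fixed
   c1, c2 propagate along M by connectedness. *)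

(* [SO_invariant] speaks of the image alone: rotations need not lift to [M] and [phi] need not be
   injective, so tangency cannot come from differentiating an action on [M]. Nor are t and x
   functions on [M]: a point merely admits a set of pairs (t, x), and the proof works with this
   relation. With om = theta - n psi the soliton equation becomes dr = a r sin om cos om dtheta and
   dpsi = a (sin om)^2 dtheta. Both are unchanged when psi and theta move by multiples of pi, which
   is exactly the ambiguity of the polar form. For h = - r^n sin om they give dh = - r^n cos om
   dtheta, the terms in a cancelling, whence (r e^(i psi))^n = (-h' + i h) e^(i theta): this is the
   formula for [alpha]. Since theta is a function of n variables and not a coordinate, the linear
   equation is never solved along a curve; its first integrals are shown to have zero differential
   on balls. *)
From HB Require Import structures.
Require Import Defs.
From mathcomp Require Import all_boot all_order all_algebra.
From mathcomp Require Import all_classical all_reals all_analysis.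
From mathcomp Require Import ring lra.
Import Order.TTheory GRing.Theory Num.Theory.
Import numFieldNormedType.Exports.
Local Open Scope classical_set_scope.
Local Open Scope ring_scope.
Set Implicit Arguments.
Unset Strict Implicit.
Unset Printing Implicit Defensive.

(** * Calculus of C^k functions *)

Section LineDerivative.
Context {R : realType} {V : normedModType R}.

(** Gives directional derivatives access to the one-variable chain rule, mean value theorem and
    extremum test. *)
Lemma is_derive_line (W : normedModType R) (f : V -> W) (x v : V) (t : R) (df : W) :
  is_derive (t *: v + x) v f df <->
  is_derive t 1 (fun s => f (s *: v + x)) df.
Proof.
have E : (fun h : R => h^-1 *: ((f \o shift (t *: v + x)) (h *: v)
             - f (t *: v + x)))
       = (fun h : R => h^-1 *: (((fun s => f (s *: v + x)) \o shift t) (h *: 1)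
             - f (t *: v + x))).
  apply/funext => h /=; congr (_ *: (f _ - _)).
  by rewrite addrA -scalerDl [h *: 1]mulr1.
by split=> -[dv <-]; apply: DeriveDef; rewrite ?/derivable ?/derive;
  rewrite ?E // -?E.
Qed.

Lemma is_derive_chain (g : V -> R) (h : R -> R) (x v : V) (dg dh : R) :
  is_derive x v g dg -> is_derive (g x) 1 h dh ->
  is_derive x v (h \o g) (dh * dg).
Proof.
move=> gd hd.
have E : x = 0 *: v + x by rewrite scale0r add0r.
rewrite E; apply/is_derive_line.
apply: (@is_derive1_comp _ h (fun s : R => g (s *: v + x))).
  by rewrite -E.
by apply/is_derive_line; rewrite -E.
Qed.

End LineDerivative.

Section RowValued.
Context {R : realType} {V : normedModType R}.

Lemma differentiable_mxP (m n : nat) (f : V -> 'M[R]_(m, n)) (x : V) :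
  differentiable f x <->
  (forall i j, differentiable (fun y => f y i j) x).
Proof.
split=> [df i j|df].
  exact: (differentiable_comp df (differentiable_coord _ i j)).
have -> : f = \sum_i \sum_j (fun y => f y i j *: delta_mx i j).
  apply/funext => y; rewrite fct_sumE [LHS]matrix_sum_delta.
  by apply: eq_bigr => i _; rewrite fct_sumE.
apply: differentiable_sum => i; apply: differentiable_sum => j.
by apply: differentiableZl.
Qed.

Lemma derive_coord (m n : nat) (f : V -> 'M[R]_(m, n)) (x v : V) i j :
  derivable f x v -> 'D_v (fun y => f y i j) x = ('D_v f x) i j.
Proof. by move=> df; rewrite derive_mx// mxE. Qed.

Lemma is_derive_coord (m n : nat) (f : V -> 'M[R]_(m, n)) (x v : V) df i j :
  is_derive x v f df -> is_derive x v (fun y => f y i j) (df i j).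
Proof.
move=> [fd <-]; apply: DeriveDef; last exact: derive_coord.
by move/derivable_mxP: fd.
Qed.

Lemma is_derive_mx (m n : nat) (f : V -> 'M[R]_(m, n)) (x v : V)
    (df : 'M[R]_(m, n)) :
  (forall i j, is_derive x v (fun y => f y i j) (df i j)) ->
  is_derive x v f df.
Proof.
move=> h; have fd : derivable f x v by apply/derivable_mxP => i j; case: (h i j).
apply: DeriveDef => //; apply/matrixP => i j.
by rewrite -derive_coord//; case: (h i j).
Qed.

Lemma continuous_mx (m n : nat) (f : V -> 'M[R]_(m, n)) (x : V) :
  (forall i j, {for x, continuous (fun y => f y i j)}) ->
  {for x, continuous f}.
Proof.
move=> h; apply/cvgrPdist_le => /= e e0; near=> y.
rewrite /Num.Def.normr/= mx_normrE (bigmax_le _ (ltW e0))//= => i _.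
rewrite !mxE/=; move: i; near: y; apply: filter_forall => /= i.
exact: ((cvgrPdist_le _ _).1 (h i.1 i.2)).
Unshelve. all: by end_near. Qed.

End RowValued.

Section CkCalculus.
Context {R : realType} {V : normedModType R}.
Implicit Types (U : set V) (W : normedModType R) (k : nat).

Lemma Ck_onW W k U (f : V -> W) : Ck_on k.+1 U f -> Ck_on k U f.
Proof.
elim: k f => [|k IH] f [df Df].
  by move=> x /df /differentiable_continuous.
by split=> // v; apply: IH; apply: Df.
Qed.

Lemma Ck_on_sub W k U U' (f : V -> W) :
  U' `<=` U -> Ck_on k U f -> Ck_on k U' f.
Proof.
move=> UU; elim: k f => [|k IH] f /=; first by move=> h x /UU /h.
by move=> [df Df]; split=> [x /UU /df //|v]; apply: IH.
Qed.

(** The difference [g - f] vanishes near [x], hence is o(.) there with zero differential, and [g] is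
    [f] plus this difference. *)
Lemma near_eq_differentiable W (f g : V -> W) (x : V) :
  (\near x, f x = g x) -> differentiable f x -> differentiable g x.
Proof.
move=> fg df; have -> : g = f + (g - f) by rewrite addrC subrK.
apply: differentiableD => //; set z := g - f.
have z0 : z x = 0 by rewrite /z !fctE (nbhs_singleton fg) subrr.
have zo : z \o shift x = cst (z x) + (\0 : {linear V -> W}) +o_ 0 id.
  apply/eqaddoP => e e0.
  have : \forall y \near 0, f (y + x) = g (y + x).
    by rewrite (near_shift x 0); near do rewrite /= sub0r subrK.
  apply: filterS => y yz /=.
  by rewrite z0 /z !fctE yz subrr addr0 subr0 normr0 mulr_ge0// ltW.
have dz : 'd z x = 0 :> (V -> W).
  by apply: diff_unique zo; apply: cst_continuous.
by apply/diff_locallyP; rewrite dz; split=> //; apply: cst_continuous.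
Unshelve. all: by end_near. Qed.

Lemma Ck_on_eq W k U (f g : V -> W) : open U ->
  (forall x, U x -> f x = g x) -> Ck_on k U f -> Ck_on k U g.
Proof.
move=> oU; elim: k f g => [|k IH] f g fg.
  move=> h x Ux; have nfg : \near x, f x = g x.
    by apply: filterS (open_nbhs_nbhs (conj oU Ux)) => y /fg.
  apply: cvg_trans; first by apply: near_eq_cvg; exact: nfg.
  by rewrite -(fg x Ux); apply: h.
have nfg x : U x -> \near x, f x = g x.
  by move=> Ux; apply: filterS (open_nbhs_nbhs (conj oU Ux)) => y /fg.
move=> [df Df]; split=> [x Ux|v].
  exact: near_eq_differentiable (nfg x Ux) (df x Ux).
by apply: IH (Df v) => x Ux; apply: near_eq_derive; exact: nfg.
Qed.

(** [Ck_on] speaks of the total function ['D_v f]; here a closed formula valid on [U] only may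
    replace it. This is the induction step behind the closure properties that follow. *)
Lemma Ck_onS W k U (f : V -> W) (df : V -> V -> W) : open U ->
  (forall x, U x -> differentiable f x) ->
  (forall v x, U x -> is_derive x v f (df v x)) ->
  (forall v, Ck_on k U (df v)) -> Ck_on k.+1 U f.
Proof.
move=> oU fd dfE dfC; split=> // v.
by apply: Ck_on_eq (dfC v) => // x Ux; case: (dfE v x Ux).
Qed.

Lemma Ck_on_derive W k U (f : V -> W) x v :
  U x -> Ck_on k.+1 U f -> is_derive x v f ('D_v f x).
Proof. by move=> Ux [df _]; apply/derivableP/diff_derivable/df. Qed.

Lemma Ck_on_cst W k U (c : W) : open U -> Ck_on k U (fun _ => c).
Proof.
move=> oU; elim: k c => [|k IH] c; first by move=> x _; apply: cst_continuous.
apply: (@Ck_onS _ _ _ _ (fun _ _ => 0)) => //.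
Qed.

Lemma Ck_on_id k U : open U -> Ck_on k U (id : V -> V).
Proof.
move=> oU; case: k => [|k]; first by move=> x _; apply: cvg_id.
apply: (@Ck_onS _ _ _ _ (fun v _ => v)) => // v.
exact: Ck_on_cst.
Qed.

Lemma Ck_onD W k U (f g : V -> W) : open U ->
  Ck_on k U f -> Ck_on k U g -> Ck_on k U (fun x => f x + g x).
Proof.
move=> oU; elim: k f g => [|k IH] f g.
  by move=> cf cg x Ux; apply: continuousD; [exact: cf|exact: cg].
move=> cf cg; apply: (@Ck_onS _ _ _ _ (fun v x => 'D_v f x + 'D_v g x)).
- exact: oU.
- by move=> x Ux; apply: (@differentiableD _ _ _ f g); [exact: cf.1|exact: cg.1].
- move=> v x Ux; apply: (@is_deriveD _ _ _ f g).
  + exact: (Ck_on_derive v Ux cf).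
  + exact: (Ck_on_derive v Ux cg).
- by move=> v; apply: IH; [exact: cf.2|exact: cg.2].
Qed.

Lemma Ck_onN W k U (f : V -> W) : open U ->
  Ck_on k U f -> Ck_on k U (fun x => - f x).
Proof.
move=> oU; elim: k f => [|k IH] f.
  by move=> cf x Ux; apply: continuousN; exact: cf.
move=> cf; apply: (@Ck_onS _ _ _ _ (fun v x => - 'D_v f x)).
- exact: oU.
- by move=> x Ux; apply: (@differentiableN _ _ _ f); exact: cf.1.
- by move=> v x Ux; apply: (@is_deriveN _ _ _ f); apply: (Ck_on_derive v Ux cf).
- by move=> v; apply: IH; exact: cf.2.
Qed.

Lemma Ck_onM k U (f g : V -> R) : open U ->
  Ck_on k U f -> Ck_on k U g -> Ck_on k U (fun x => f x * g x).
Proof.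
move=> oU; elim: k f g => [|k IH] f g.
  by move=> cf cg x Ux; apply: continuousM; [exact: cf|exact: cg].
move=> cf cg.
apply: (@Ck_onS _ _ _ _ (fun v x => f x * 'D_v g x + g x * 'D_v f x)).
- exact: oU.
- by move=> x Ux; apply: (@differentiableM _ _ f g); [exact: cf.1|exact: cg.1].
- move=> v x Ux; apply: (@is_deriveM _ _ f g).
  + exact: (Ck_on_derive v Ux cf).
  + exact: (Ck_on_derive v Ux cg).
- move=> v; apply: Ck_onD => //; apply: IH.
  + exact: Ck_onW.
  + exact: cg.2.
  + exact: Ck_onW.
  + exact: cf.2.
Qed.

Lemma Ck_onB W k U (f g : V -> W) : open U ->
  Ck_on k U f -> Ck_on k U g -> Ck_on k U (fun x => f x - g x).
Proof. by move=> oU cf cg; apply: Ck_onD => //; apply: Ck_onN. Qed.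

Lemma Ck_on_sum (I : Type) (s : seq I) W k U (f : I -> V -> W) : open U ->
  (forall i, Ck_on k U (f i)) -> Ck_on k U (fun x => \sum_(i <- s) f i x).
Proof.
move=> oU cf; elim: s => [|i s IH].
  by under eq_fun do rewrite big_nil; apply: Ck_on_cst.
by under eq_fun do rewrite big_cons; apply: Ck_onD.
Qed.

(** A bootstrap: [dh \o f] need only be C^k, so functions whose derivative is expressed through
    themselves (inverse, square root, cosine with sine) are handled by induction on [k]. *)
Lemma Ck_on_chain k U (f : V -> R) (h dh : R -> R) : open U ->
  Ck_on k.+1 U f -> (forall x, U x -> is_derive (f x) 1 h (dh (f x))) ->
  Ck_on k U (dh \o f) -> Ck_on k.+1 U (h \o f).
Proof.
move=> oU cf hd ch.
apply: (@Ck_onS _ _ _ _ (fun v x => (dh \o f) x * 'D_v f x)).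
- exact: oU.
- move=> x Ux; apply: differentiable_comp; first exact: cf.1.
  by apply/derivable1_diffP; case: (hd x Ux).
- move=> v x Ux; apply: is_derive_chain; last exact: hd.
  exact: (Ck_on_derive v Ux cf).
- by move=> v; apply: Ck_onM => //; exact: cf.2.
Qed.

Lemma is_derive_inv (x : R) : x != 0 -> is_derive x 1 GRing.inv (- x ^- 2).
Proof.
move=> x0; apply: DeriveDef; first exact: (@derivableV _ _ id).
by rewrite (@deriveV _ _ id)// derive_id [LHS]mulr1.
Qed.

Lemma Ck_onV k U (f : V -> R) : open U ->
  (forall x, U x -> f x != 0) -> Ck_on k U f -> Ck_on k U (fun x => (f x)^-1).
Proof.
move=> oU f0; elim: k f f0 => [|k IH] f f0 cf.
  by move=> x Ux; apply: continuousV; [exact: f0|exact: cf].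
apply: (@Ck_on_chain _ _ f GRing.inv (fun y => - y ^- 2)) => //.
  by move=> x Ux; apply: is_derive_inv; exact: f0.
apply: Ck_onN => //; apply: (@Ck_on_eq _ _ _ (fun x => (f x)^-1 * (f x)^-1)) => //.
  by move=> x _ /=; rewrite expr2 invfM.
by apply: Ck_onM => //; apply: IH => //; apply: Ck_onW.
Qed.

Lemma Ck_on_sqrt k U (f : V -> R) : open U ->
  (forall x, U x -> 0 < f x) -> Ck_on k U f ->
  Ck_on k U (fun x => Num.sqrt (f x)).
Proof.
move=> oU f0; elim: k f f0 => [|k IH] f f0 cf.
  move=> x Ux; apply: continuous_comp; first exact: cf.
  exact: sqrt_continuous.
apply: (@Ck_on_chain _ _ f Num.sqrt (fun y => (2 * Num.sqrt y)^-1)) => //.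
  by move=> x Ux; apply: is_derive1_sqrt; exact: f0.
apply: Ck_onV => //.
  by move=> x /f0 fx; rewrite mulf_neq0// gt_eqF// sqrtr_gt0.
apply: Ck_onM => //; first exact: Ck_on_cst.
by apply: IH => //; apply: Ck_onW.
Qed.

Lemma Ck_on_atan k U (f : V -> R) : open U ->
  Ck_on k U f -> Ck_on k U (fun x => atan (f x)).
Proof.
move=> oU; case: k => [|k] cf.
  move=> x Ux; apply: continuous_comp; first exact: cf.
  exact: continuous_atan.
apply: (@Ck_on_chain _ _ f atan (fun y => (1 + y ^+ 2)^-1)) => //.
apply: (@Ck_onV _ _ (fun x => 1 + f x ^+ 2)) => //.
  by move=> x _; rewrite gt_eqF// ltr_wpDr// sqr_ge0.
apply: (@Ck_onD R k U (fun=> 1) (fun x => f x ^+ 2)) => //.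
  exact: Ck_on_cst.
by apply: (@Ck_onM _ _ f f) => //; apply: Ck_onW.
Qed.

Lemma Ck_on_cos_sin k U (f : V -> R) : open U -> Ck_on k U f ->
  Ck_on k U (fun x => cos (f x)) /\ Ck_on k U (fun x => sin (f x)).
Proof.
move=> oU; elim: k => [|k IH] cf.
  split=> x Ux; apply: continuous_comp (cf _ Ux) _.
    exact: continuous_cos.
  exact: continuous_sin.
have [IHc IHs] := IH (Ck_onW cf); split.
- apply: (@Ck_on_chain _ _ f cos (fun y => - sin y)) => //.
  exact: Ck_onN.
- apply: (@Ck_on_chain _ _ f sin cos) => //.
Qed.

Lemma Ck_on_coord m n k U (f : V -> 'M[R]_(m, n)) i j : open U ->
  Ck_on k U f -> Ck_on k U (fun x => f x i j).
Proof.
move=> oU; elim: k f => [|k IH] f cf.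
  move=> x Ux.
  apply: (@continuous_comp _ _ _ f (fun N : 'M[R]_(m, n) => N i j)).
    exact: cf.
  exact: coord_continuous.
apply: (@Ck_onS _ _ _ _ (fun v x => ('D_v f x) i j)).
- exact: oU.
- by move=> x Ux; have /differentiable_mxP := cf.1 _ Ux; apply.
- by move=> v x Ux; apply: is_derive_coord; apply: (Ck_on_derive v Ux cf).
- by move=> v; apply: IH; exact: cf.2.
Qed.

Lemma Ck_on_mx m n k U (f : V -> 'M[R]_(m, n)) : open U ->
  (forall i j, Ck_on k U (fun x => f x i j)) -> Ck_on k U f.
Proof.
move=> oU; elim: k f => [|k IH] f cf.
  by move=> x Ux; apply: continuous_mx => i j; apply: cf.
apply: (@Ck_onS _ _ _ _ (fun v x => \matrix_(i, j) 'D_v (fun y => f y i j) x)).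
- exact: oU.
- by move=> x Ux; apply/differentiable_mxP => i j; apply: (cf i j).1.
- move=> v x Ux; apply: is_derive_mx => i j; rewrite mxE.
  exact: (Ck_on_derive v Ux (cf i j)).
- move=> v; apply: IH => i j; under eq_fun do rewrite mxE.
  exact: (cf i j).2.
Qed.

End CkCalculus.

Section CkComposition.
Context {R : realType} {V : normedModType R}.

(** The induction generalizes over [g] with [f] fixed: derivatives of [g \o f] are combinations of
    partials of [g], composed with the same [f]. *)
Lemma Ck_on_comp m k (U : set V) (U' : set 'rV[R]_m)
    (f : V -> 'rV[R]_m) (g : 'rV[R]_m -> R) : open U -> open U' ->
  (forall x, U x -> U' (f x)) ->
  Ck_on k U f -> Ck_on k U' g -> Ck_on k U (g \o f).
Proof.
move=> oU oU' UU; elim: k g => [|k IH] g cf cg.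
  by move=> x Ux; apply: continuous_comp; [exact: cf|exact/cg/UU].
apply: (@Ck_onS _ _ _ _ _ _ (fun v x => \sum_j ('D_v f x) 0 j *
   ('D_(delta_mx 0 j) g \o f) x)).
- exact: oU.
- move=> x Ux; apply: differentiable_comp; first exact: cf.1.
  exact: cg.1 (UU _ Ux).
- move=> v x Ux; have df := cf.1 _ Ux; have dg := cg.1 _ (UU _ Ux).
  have dgf : differentiable (g \o f) x by apply: differentiable_comp.
  apply: DeriveDef; first exact: diff_derivable.
  have -> : 'D_v (g \o f) x = 'd g (f x) ('D_v f x).
    by rewrite (deriveE _ dgf) diff_comp//= (deriveE _ df).
  rewrite {1}(row_sum_delta ('D_v f x)) linear_sum; apply: eq_bigr => j _.
  by rewrite linearZ /= -deriveE.
- move=> v; apply: Ck_on_sum => // j; apply: Ck_onM => //.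
    by apply: Ck_on_coord => //; exact: cf.2.
  apply: IH; first exact: Ck_onW.
  exact: cg.2.
Qed.

End CkComposition.

(** * Mean value arguments *)

Section MeanValue.
Context {R : realType} {V : normedModType R}.

Lemma ball_segment (c x v : V) (e t : R) : ball c e x -> ball c e (v + x) ->
  0 <= t <= 1 -> ball c e (t *: v + x).
Proof.
rewrite -ball_normE /= => cx cy /andP[t0 t1].
have -> : c - (t *: v + x) = (1 - t) *: (c - x) + t *: (c - (v + x)).
  rewrite (_ : c - (v + x) = (c - x) - v); last by rewrite opprD addrA addrAC.
  rewrite (scalerBr t) addrA -scalerDl subrK scale1r.
  by rewrite opprD addrA addrAC.
have [->|tn0] := eqVneq t 0; first by rewrite subr0 scale1r scale0r addr0.
apply: (le_lt_trans (ler_normD _ _)); rewrite !normrZ !ger0_norm ?subr_ge0//.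
have tp : 0 < t by rewrite lt_neqAle eq_sym tn0.
have : (1 - t) * `|c - x| <= (1 - t) * e.
  by apply: ler_wpM2l; [rewrite subr_ge0|exact: ltW].
have : t * `|c - (v + x)| < t * e by rewrite ltr_pM2l.
lra.
Qed.

Lemma derive_scale (f : V -> R) (x v : V) (h : R) : differentiable f x ->
  'D_(h *: v) f x = h * 'D_v f x.
Proof. by move=> df; rewrite !deriveE// linearZ. Qed.

Lemma MVT_line (f : V -> R) (x v : V) :
  (forall t : R, 0 <= t <= 1 -> differentiable f (t *: v + x)) ->
  exists2 t : R, 0 < t < 1 & f (v + x) - f x = 'D_v f (t *: v + x).
Proof.
move=> df; pose g (t : R) := f (t *: v + x); pose dg (t : R) := 'D_v f (t *: v + x).
have gd (t : R) : 0 <= t <= 1 -> is_derive t 1 g (dg t).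
  move=> /df dft; apply: (is_derive_line f x v t _).1.
  by apply: derivableP; exact: diff_derivable.
have gi (t : R) : t \in `]0, 1[ -> is_derive t 1 g (dg t).
  by rewrite in_itv /= => /andP[t0 t1]; apply: gd; rewrite !ltW.
have gc : {within `[0, 1], continuous g}.
  apply: derivable_within_continuous => t; rewrite in_itv /= => /gd.
  by case.
have [t] := MVT ltr01 gi gc.
rewrite in_itv /= /g scale1r scale0r add0r subr0 mulr1 => t01 E.
by exists t.
Qed.

Lemma IVT_ball (f : V -> R) (c : V) (e : R) (x y : V) (z : R) :
  (forall x, ball c e x -> {for x, continuous f}) ->
  ball c e x -> ball c e y -> f x <= z <= f y -> exists2 w, ball c e w & f w = z.
Proof.
move=> cf cx cy fz; have yE : y = (y - x) + x by rewrite subrK.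
have seg (t : R) : 0 <= t <= 1 -> ball c e (t *: (y - x) + x).
  by apply: ball_segment => //; rewrite -yE.
pose g (t : R) := f (t *: (y - x) + x).
have g0 : g 0 = f x by rewrite /g scale0r add0r.
have g1 : g 1 = f y by rewrite /g scale1r -yE.
have gc : {within `[0, 1], continuous g}.
  apply: continuous_in_subspaceT => t; rewrite inE /= in_itv /= => t01.
  apply: (@continuous_comp R V R (fun t : R => t *: (y - x) + x) f).
    apply: continuousD; last exact: cst_continuous.
    exact: scalel_continuous.
  by apply: cf; exact: seg.
have [|t] := @IVT _ g 0 1 z ler01 gc.
  rewrite g0 g1; have /andP[h1 h2] := fz.
  by rewrite ge_min h1/= le_max h2 orbT.
by rewrite in_itv /= => /seg t01 gt; exists (t *: (y - x) + x).
Qed.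

End MeanValue.

Section Schwarz.
Context {R : realType} {V : normedModType R}.

(** The mean value theorem is applied twice: to y |-> f (h w + y) - f y along [v], then to ['D_v f]
    along [w]. *)
Lemma second_difference (U : set V) (f : V -> R) (x v w : V) (e h : R) :
  Ck_on 2 U f -> ball x e `<=` U -> 0 < h -> h * (`|v| + `|w|) < e ->
  exists2 y, ball x e y & (f (h *: w + (h *: v + x)) - f (h *: v + x))
     - (f (h *: w + x) - f x) = h ^+ 2 * 'D_w ('D_v f) y.
Proof.
move=> cf BU h0 he.
have inB (s t : R) : 0 <= s <= 1 -> 0 <= t <= 1 ->
    ball x e (s *: (h *: w) + (t *: (h *: v) + x)).
  move=> /andP[s0 s1] /andP[t0 t1]; rewrite -ball_normE /=.
  rewrite !opprD !addrA addrAC (addrAC x) subrr add0r.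
  apply: le_lt_trans he; apply: (le_trans (ler_normB _ _)).
  rewrite normrN !normrZ (ger0_norm s0) (ger0_norm t0) (gtr0_norm h0).
  have : s * (h * `|w|) <= h * `|w|.
    by rewrite ler_piMl// mulr_ge0// ltW.
  have : t * (h * `|v|) <= h * `|v|.
    by rewrite ler_piMl// mulr_ge0// ltW.
  lra.
have in0 (t : R) : 0 <= t <= 1 -> ball x e (t *: (h *: v) + x).
  by move=> t01; have := inB 0 t; rewrite scale0r add0r lexx ler01; apply.
have in1 (t : R) : 0 <= t <= 1 -> ball x e (h *: w + (t *: (h *: v) + x)).
  by move=> t01; have := inB 1 t; rewrite scale1r lexx ler01; apply.
have df y : ball x e y -> differentiable f y by move=> /BU; apply: cf.1.
have dfv y : ball x e y -> differentiable ('D_v f) y.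
  by move=> /BU; apply: (cf.2 v).1.
pose p y := f (h *: w + y) - f y.
have dsh y : differentiable (fun y => h *: w + y) y.
  by apply: differentiableD.
have pd (t : R) : 0 <= t <= 1 -> differentiable p (t *: (h *: v) + x).
  move=> t01; apply: differentiableB; last by apply: df; exact: in0.
  apply: (differentiable_comp (dsh _)); apply: df; exact: in1.
have [t t01 pE] := MVT_line pd.
have {}t01 : 0 <= t <= 1 by case/andP: t01 => *; rewrite !ltW.
set z := t *: (h *: v) + x in pE.
have pz : 'D_(h *: v) p z = h * ('D_v f (h *: w + z) - 'D_v f z).
  have zB := in0 _ t01; have zB1 := in1 _ t01.
  rewrite derive_scale; last exact: pd.
  congr (_ * _); rewrite deriveB; first congr (_ - _).
  - rewrite deriveE; last exact: differentiable_comp (dsh _) (df _ zB1).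
    rewrite diff_comp//; last exact: df.
    rewrite /= deriveE; last exact: df.
    congr ('d f _ _); rewrite -deriveE//.
    by rewrite deriveD// derive_cst derive_id add0r.
  - apply: diff_derivable; exact: differentiable_comp (dsh _) (df _ zB1).
  - by apply: diff_derivable; apply: df.
have [|s s01 qE] := @MVT_line _ _ ('D_v f) z (h *: w).
  by move=> s s01; apply: dfv; exact: inB.
have {}s01 : 0 <= s <= 1 by case/andP: s01 => *; rewrite !ltW.
exists (s *: (h *: w) + z); first exact: inB.
rewrite -[LHS]/(p (h *: v + x) - p x) pE pz qE derive_scale.
  by rewrite mulrA expr2.
by apply: dfv; exact: inB.
Qed.

Lemma dist_le_of_close (a b p q eps : R) :
  `|a - p| < eps / 2 -> `|b - q| < eps / 2 -> p = q -> `|a - b| <= eps.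
Proof.
move=> H1 H2 E; move: H1 H2; rewrite E !ltr_norml ler_norml => /andP[? ?] /andP[? ?].
by apply/andP; split; lra.
Qed.

(** The second difference is symmetric in [v] and [w], so the two mixed derivatives agree at some
    points [y] and [z] arbitrarily close to [x]; continuity brings both back to [x]. *)
Lemma derive_swap (U : set V) (f : V -> R) (x v w : V) : open U -> U x ->
  Ck_on 2 U f -> 'D_w ('D_v f) x = 'D_v ('D_w f) x.
Proof.
move=> oU Ux cf; apply/eqP; rewrite -subr_eq0 -normr_le0.
apply/ler_addgt0Pr => /= eps eps0; rewrite add0r.
have cont a b : {for x, continuous ('D_a ('D_b f))}.
  exact: (cf.2 b).2.
have [e /= e0 He] : exists2 e : R, 0 < e & forall y, ball x e y ->
   [/\ U y, `|'D_w ('D_v f) x - 'D_w ('D_v f) y| < eps / 2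
    & `|'D_v ('D_w f) x - 'D_v ('D_w f) y| < eps / 2].
  have e20 : 0 < eps / 2 by rewrite divr_gt0.
  have A a b : exists2 e : R, 0 < e & forall y, ball x e y ->
      `|'D_a ('D_b f) x - 'D_a ('D_b f) y| < eps / 2.
    have [e e0 He] := (nbhs_ballP _ _).1
      ((cvgrPdist_lt _ _).1 (cont a b) _ e20).
    by exists e => // y /He.
  have [e1 e10 H1] := A w v; have [e2 e2p H2] := A v w.
  have /nbhs_ballP[e3 e30 H3] : nbhs x U by exact: open_nbhs_nbhs.
  exists (Num.min e1 (Num.min e2 e3)).
    by rewrite !lt_min e10 e2p e30.
  move=> y yB; split.
  - by apply: H3; apply: le_ball yB; rewrite !ge_min lexx !orbT.
  - by apply: H1; apply: le_ball yB; rewrite !ge_min lexx.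
  - by apply: H2; apply: le_ball yB; rewrite !ge_min lexx orbT.
have BU : ball x e `<=` U by move=> y /He[].
pose N := `|v| + `|w| + 1.
have N0 : 0 < N by rewrite ltr_wpDl// addr_ge0.
(* Chosen so that h N = e / 2; the summand 1 in [N] keeps the denominator positive when [v] and [w]
   vanish. *)
pose h := e / (2 * N).
have h0 : 0 < h by rewrite divr_gt0// mulr_gt0.
have hN : h * (`|v| + `|w|) < e.
  have : h * N = e / 2 by rewrite /h; field; rewrite gt_eqF.
  rewrite /N mulrDr mulr1; lra.
have hN' : h * (`|w| + `|v|) < e by rewrite addrC.
have [y yB yE] := second_difference cf BU h0 hN.
have [z zB zE] := second_difference cf BU h0 hN'.
have h2 : h ^+ 2 != 0 by rewrite expf_neq0// gt_eqF.
have yz : 'D_w ('D_v f) y = 'D_v ('D_w f) z.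
  apply: (mulfI h2); apply: etrans (esym yE) (etrans _ zE).
  rewrite (addrCA (h *: w)); set A := f (_ + (_ + _)); set B := f _; set C := f _.
  by ring.
have [_ H1 _] := He _ yB; have [_ _ H2] := He _ zB.
exact: dist_le_of_close H1 H2 yz.
Qed.

End Schwarz.

(** * Quantitative local injectivity of an immersion *)

Section LowerLipschitz.
Context {R : realType}.

Lemma coord_le_norm n (v : 'rV[R]_n) i : `|v 0 i| <= `|v|.
Proof.
rewrite [leRHS]/Num.Def.normr/= mx_normrE.
exact: (le_bigmax _ (fun ij : 'I_1 * 'I_n => `|v ij.1 ij.2|) (0, i)).
Qed.

Lemma norm_le_coord n (v : 'rV[R]_n) (r : R) : 0 <= r ->
  (forall i, `|v 0 i| <= r) -> `|v| <= r.
Proof.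
move=> r0 H; rewrite /Num.Def.normr/= mx_normrE (bigmax_le _ r0)//= => -[i j] _.
by rewrite ord1.
Qed.

Lemma mulmxr_bounded n p (K : 'M[R]_(n, p)) : exists2 C, 0 < C &
  forall v : 'rV[R]_n, `|v *m K| <= C * `|v|.
Proof.
pose C := 1 + \sum_j \sum_i `|K i j|.
have C0 : 0 < C by rewrite ltr_pwDl// sumr_ge0// => j _; apply: sumr_ge0.
exists C => // v; apply: norm_le_coord; first by rewrite mulr_ge0// ltW.
move=> j; rewrite mxE; apply: (le_trans (ler_norm_sum _ _ _)).
apply: (@le_trans _ _ ((\sum_i `|K i j|) * `|v|)).
  rewrite mulr_suml; apply: ler_sum => i _.
  by rewrite normrM mulrC ler_wpM2l// coord_le_norm.
rewrite ler_wpM2r// /C (bigD1 j)//= addrCA lerDl addr_ge0// sumr_ge0// => k _.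
exact: sumr_ge0.
Qed.

(** With [K] a right inverse of the Jacobian at [x], the map y |-> F y K - y has zero derivative at
    [x], so it is 1/2-Lipschitz on a small ball. Thus |y - z| / 2 is at most |(F y - F z) K|. *)
Lemma row_free_lower_lipschitz n m (U : set 'rV[R]_n)
    (F : 'rV[R]_n -> 'rV[R]_m) (x : 'rV[R]_n) :
  open U -> U x -> Ck_on 1 U F -> row_free ('J F x) ->
  exists e C : R, [/\ 0 < e, ball x e `<=` U &
    forall y z, ball x e y -> ball x e z -> `|y - z| <= C * `|F y - F z|].
Proof.
move=> oU Ux cF /row_freeP[K JK].
pose H j y := (F y *m K - y) 0 j.
have dH j y v : U y -> is_derive y v (H j) (('D_v F y *m K - v) 0 j).
  move=> Uy; have dF := diff_derivable (v := v) (cF.1 _ Uy).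
  have -> : H j = (fun y => \sum_k F y 0 k * K k j - y 0 j).
    by apply/funext => z; rewrite /H !mxE.
  rewrite !mxE.
  apply: (@is_deriveB _ _ _ (fun y => \sum_k F y 0 k * K k j)
     (fun y : 'rV[R]_n => y 0 j)); last exact: is_derive_coord.
  have -> : (fun y => \sum_k F y 0 k * K k j)
      = \sum_k (K k j *: (fun y => F y 0 k)).
    apply/funext => z; rewrite fct_sumE; apply: eq_bigr => k _.
    by rewrite mulrC.
  apply: is_derive_eq.
    apply: is_derive_sum => k; apply: is_deriveZ.
    exact/is_derive_coord/derivableP.
  by apply: eq_bigr => k _; rewrite mulrC.
have H0 j v : ('D_v F x *m K - v) 0 j = 0.
  by rewrite deriveEjacobian -?mulmxA ?JK ?mulmx1 ?subrr ?mxE//; exact: cF.1.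
have cH j : Ck_on 1 U (H j).
  have -> : H j = (fun y => \sum_k F y 0 k * K k j - y 0 j).
    by apply/funext => z; rewrite /H !mxE.
  apply: (@Ck_onB _ _ R) => //.
    apply: (@Ck_on_sum _ _ _ _ R) => // k.
    by apply: Ck_onM => //; [exact: Ck_on_coord|exact: (@Ck_on_cst _ _ R)].
  by apply: (@Ck_on_coord _ _ _ _ _ _ id) => //; exact: Ck_on_id.
(* The [n] partial derivatives, each below [d], must add up to at most 1/2; using n + 1 keeps the
   inverse meaningful for n = 0. *)
pose d : R := (2 * n.+1%:R)^-1.
have d0 : 0 < d by rewrite invr_gt0 mulr_gt0.
have [e /= e0 He] : exists2 e : R, 0 < e & forall y, ball x e y ->
    U y /\ forall ij : 'I_n * 'I_n, `|'D_(delta_mx 0 ij.1) (H ij.2) y| < d.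
  have : \forall y \near x, U y /\ forall ij : 'I_n * 'I_n,
      `|'D_(delta_mx 0 ij.1) (H ij.2) y| < d.
    near=> y; split; near: y; first exact: open_nbhs_nbhs.
    apply: filter_forall => -[i j] /=.
    have c := ((cH j).2 (delta_mx 0 i)) x Ux.
    have /cvgrPdist_lt /(_ _ d0) := c.
    apply: filterS => y; case: (dH j x (delta_mx 0 i) Ux) => _ ->.
    by rewrite H0 sub0r normrN.
  by move=> /nbhs_ballP[e e0 He]; exists e => // y /He.
have [C C0 HC] := mulmxr_bounded K.
exists e, (2 * C); split => // [y /He[]//|y z yB zB].
have half j : `|H j y - H j z| <= `|y - z| / 2.
  have seg (t : R) : 0 <= t <= 1 -> ball x e (t *: (y - z) + z).
    by apply: ball_segment => //; rewrite subrK.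
  have dHt (t : R) : 0 <= t <= 1 -> differentiable (H j) (t *: (y - z) + z).
    by move=> /seg /He[Ut _]; apply: (cH j).1.
  have [t t01] := MVT_line dHt; rewrite subrK => ->.
  have {}t01 : 0 <= t <= 1 by case/andP: t01 => *; rewrite !ltW.
  have [_ Dt] := He _ (seg _ t01).
  have dw := dHt _ t01; move: dw Dt.
  move: (t *: (y - z) + z) => w dw Dt.
  rewrite deriveE//.
  rewrite {1}(row_sum_delta (y - z)) linear_sum.
  apply: (le_trans (ler_norm_sum _ _ _)).
  apply: (@le_trans _ _ (\sum_(i < n) `|y - z| * d)).
    apply: ler_sum => i _; rewrite linearZ normrM.
    apply: ler_pM => //; first exact: coord_le_norm.
    by rewrite -deriveE//; exact: ltW (Dt (i, j)).
  rewrite sumr_const card_ord -[leLHS]mulr_natr -mulrA ler_wpM2l//.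
  rewrite /d -natr1; have : (0 : R) <= n%:R by [].
  set N := n%:R => N0; rewrite invfM -mulrA ler_piMr ?invr_ge0//.
  by rewrite ler_pdivrMl; lra.
have key : `|(F y - F z) *m K - (y - z)| <= `|y - z| / 2.
  apply: norm_le_coord => [|j]; first by rewrite divr_ge0.
  have := half j; rewrite /H -[X in `|X| <= _ -> _]/(_ - _).
  have -> : (F y *m K - y) 0 j - (F z *m K - z) 0 j
     = ((F y - F z) *m K - (y - z)) 0 j.
    by rewrite mulmxBl !mxE; ring.
  by [].
have A : `|y - z| <= `|(F y - F z) *m K| + `|y - z| / 2.
  rewrite -[X in `|X| <= _](subKr ((F y - F z) *m K)).
  by apply: (le_trans (ler_normB _ _)); rewrite lerD2l.
have := HC (F y - F z); lra.
Unshelve. all: by end_near. Qed.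

End LowerLipschitz.

(** * Linear algebra of Lagrangian subspaces *)

Section Dot.
Context {R : realType}.
Implicit Types (k n : nat).

Lemma dotE k (u v : 'rV[R]_k) : dot u v = (u *m v^T) 0 0.
Proof. by rewrite mxE; apply: eq_bigr => i _; rewrite mxE. Qed.

Lemma dotC k (u v : 'rV[R]_k) : dot u v = dot v u.
Proof. by apply: eq_bigr => i _; rewrite mulrC. Qed.

Lemma dotDl k (u v w : 'rV[R]_k) : dot (u + v) w = dot u w + dot v w.
Proof. by rewrite !dotE mulmxDl mxE. Qed.

Lemma dotZl k a (u w : 'rV[R]_k) : dot (a *: u) w = a * dot u w.
Proof. by rewrite !dotE -scalemxAl mxE. Qed.

Lemma dotNl k (u w : 'rV[R]_k) : dot (- u) w = - dot u w.
Proof. by rewrite !dotE mulNmx mxE. Qed.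

Lemma dotDr k (u v w : 'rV[R]_k) : dot w (u + v) = dot w u + dot w v.
Proof. by rewrite !(dotC w) dotDl. Qed.

Lemma dotZr k a (u w : 'rV[R]_k) : dot w (a *: u) = a * dot w u.
Proof. by rewrite !(dotC w) dotZl. Qed.

Lemma dotNr k (u w : 'rV[R]_k) : dot w (- u) = - dot w u.
Proof. by rewrite !(dotC w) dotNl. Qed.

Lemma dot0l k (w : 'rV[R]_k) : dot 0 w = 0.
Proof. by rewrite dotE mul0mx mxE. Qed.

Lemma dot_suml k (I : Type) (s : seq I) (f : I -> 'rV[R]_k) w :
  dot (\sum_(i <- s) f i) w = \sum_(i <- s) dot (f i) w.
Proof. by rewrite dotE mulmx_suml summxE; apply: eq_bigr => i _; rewrite dotE. Qed.

Lemma dot_row_mx k (u v u' v' : 'rV[R]_k) :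
  dot (row_mx u v) (row_mx u' v') = dot u u' + dot v v'.
Proof. by rewrite !dotE tr_row_mx mul_row_col mxE. Qed.

Lemma dot_ge0 k (u : 'rV[R]_k) : 0 <= dot u u.
Proof. by apply: sumr_ge0 => i _; rewrite -expr2 sqr_ge0. Qed.

Lemma dot_eq0 k (u : 'rV[R]_k) : (dot u u == 0) = (u == 0).
Proof.
apply/eqP/eqP => [/eqP|->]; last exact: dot0l.
rewrite psumr_eq0 => [/allP u0|i _]; last by rewrite -expr2 sqr_ge0.
apply/rowP => i; rewrite mxE.
by have := u0 i (mem_index_enum _); rewrite -expr2 sqrf_eq0 => /eqP.
Qed.

End Dot.

Section ComplexStructure.
Context {R : realType} {n : nat}.
Implicit Types (z w : 'rV[R]_(n + n)) (A : 'M[R]_n).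

Definition Jmx : 'M[R]_(n + n) := block_mx 0 1%:M (- 1%:M) 0.

Definition diag_act A : 'M[R]_(n + n) := block_mx A 0 0 A.

Lemma JmulE z : Jmul z = z *m Jmx.
Proof.
rewrite -[in RHS](hsubmxK z) mul_row_block !mulmx0 mulmxN !mulmx1.
by rewrite add0r addr0.
Qed.

Lemma SO_actE A z : SO_act A z = z *m diag_act A.
Proof.
by rewrite -[in RHS](hsubmxK z) mul_row_block !mulmx0 add0r addr0.
Qed.

Lemma trJmx : Jmx^T = - Jmx.
Proof.
by rewrite /Jmx tr_block_mx opp_block_mx !trmx0 linearN /= trmx1 opprK oppr0.
Qed.

Lemma JmxJ : Jmx *m Jmx = - 1%:M.
Proof.
rewrite /Jmx mulmx_block !mul0mx !mulmx0 !mulmx1 !mul1mx !add0r !addr0.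
by rewrite (scalar_mx_block n n 1) opp_block_mx !oppr0.
Qed.

Lemma JmxtJ : Jmx *m Jmx^T = 1%:M.
Proof. by rewrite trJmx mulmxN JmxJ opprK. Qed.

Lemma diag_actJ A : diag_act A *m Jmx = Jmx *m diag_act A.
Proof.
rewrite /Jmx /diag_act !mulmx_block !mul0mx !mulmx0 mulmxN mulNmx.
by rewrite !mulmx1 !mul1mx !add0r !addr0.
Qed.

Lemma omegaE z w : omega z w = (z *m Jmx *m w^T) 0 0.
Proof. by rewrite /omega JmulE dotE. Qed.

Lemma omega_row_mx (u v u' v' : 'rV[R]_n) :
  omega (row_mx u v) (row_mx u' v') = dot u v' - dot v u'.
Proof.
by rewrite /omega /Jmul row_mxKl row_mxKr dot_row_mx dotNl addrC.
Qed.

Lemma omegaC z w : omega z w = - omega w z.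
Proof.
rewrite -(hsubmxK z) -(hsubmxK w) !omega_row_mx opprB.
by rewrite dotC addrC (dotC (lsubmx w)) addrC dotC; congr (_ - _); rewrite dotC.
Qed.

Lemma mulmx_trJ_omega p (D : 'M[R]_(p, n + n)) z k :
  (z *m (D *m Jmx)^T) 0 k = omega (row k D) z.
Proof.
have -> : z *m (D *m Jmx)^T = (D *m Jmx *m z^T)^T.
  by rewrite [RHS]trmx_mul trmxK.
by rewrite mxE omegaE -!row_mul [RHS]mxE.
Qed.

End ComplexStructure.

Section LagrangianSubspace.
Context {R : realType} {n : nat}.
Implicit Types z : 'rV[R]_(n + n).
Variable D : 'M[R]_(n, n + n).
Hypothesis freeD : row_free D.
Hypothesis lagD : D *m Jmx *m D^T = 0.

Let G := D *m D^T.
Let E := D *m Jmx.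

Lemma gram_unit : G \in unitmx.
Proof.
rewrite -row_free_unit -kermx_eq0; apply/eqP/row_matrixP => i.
rewrite row0; set v := row i _.
have vG : v *m G = 0 by rewrite /v -row_mul mulmx_ker row0.
have : v *m D = 0.
  apply/eqP; rewrite -dot_eq0 dotE trmx_mul mulmxA -(mulmxA v) vG mul0mx.
  by rewrite mxE.
by move/eqP; rewrite mulmx_free_eq0// => /eqP.
Qed.

Lemma gram_sym_inv : (invmx G)^T = invmx G.
Proof. by rewrite trmx_inv /G trmx_mul trmxK. Qed.

Lemma gramJ : E *m E^T = G.
Proof. by rewrite /E trmx_mul mulmxA -(mulmxA D) JmxtJ mulmx1. Qed.

Lemma lag_orth : D *m E^T = 0.
Proof. by rewrite trmx_mul trJmx mulNmx mulmxN mulmxA lagD oppr0. Qed.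

(** The rows of [D] and of [D J] are mutually orthogonal and have the same Gram matrix, so together
    they are a basis of the 2n-dimensional space. The two summands are the projections onto the
    tangent space and onto its image under J, which is therefore the normal space. *)
Lemma lag_resolution :
  D^T *m invmx G *m D + E^T *m invmx G *m E = 1%:M.
Proof.
pose B := col_mx D E; pose C := block_mx (invmx G) 0 0 (invmx G).
have ED : E *m D^T = 0 by [].
have BC : B *m (B^T *m C) = 1%:M.
  rewrite mulmxA tr_col_mx mul_col_row lag_orth ED gramJ -/G.
  rewrite mulmx_block !mul0mx !mulmx0 !addr0 add0r mulmxV ?gram_unit//.
  by rewrite -scalar_mx_block.
(* [B] is square, so its right inverse is also a left inverse; the product in this order is the sum
   of the two projections. *)
have := mulmx1C BC; rewrite tr_col_mx mul_row_block !mulmx0 addr0 add0r.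
by rewrite mul_row_col.
Qed.

Lemma normal_partE z : normal_part D z = z *m E^T *m invmx G *m E.
Proof.
rewrite /normal_part -/G -[X in X - _]mulmx1 -lag_resolution mulmxDr !mulmxA.
by rewrite addrAC subrr add0r.
Qed.

Lemma normal_part_dot z : normal_part D z *m E^T = z *m E^T.
Proof. by rewrite normal_partE -mulmxA gramJ mulmxKV// gram_unit. Qed.

Lemma tangentP z : z *m E^T = 0 -> z = z *m D^T *m invmx G *m D.
Proof.
move=> zE; rewrite -[LHS]mulmx1 -lag_resolution mulmxDr !mulmxA zE.
by rewrite !mul0mx addr0.
Qed.

Lemma mulmx_tangentJ z : z *m E^T = 0 ->
  z *m Jmx = z *m D^T *m invmx G *m E.
Proof. by move/tangentP => {1}->; rewrite /E !mulmxA. Qed.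

Lemma mean_curvature_dot (S : 'I_n -> 'I_n -> 'rV[R]_(n + n)) k :
  ((\sum_i \sum_j invmx G i j *: normal_part D (S i j)) *m E^T) 0 k
  = \sum_i \sum_j invmx G i j * (S i j *m E^T) 0 k.
Proof.
rewrite mulmx_suml summxE; apply: eq_bigr => i _.
rewrite mulmx_suml summxE; apply: eq_bigr => j _.
by rewrite -scalemxAl normal_part_dot mxE.
Qed.

Lemma mean_curvature_normE (S : 'I_n -> 'I_n -> 'rV[R]_(n + n)) :
  let H := \sum_i \sum_j invmx G i j *: normal_part D (S i j) in
  dot H H = (H *m E^T *m invmx G *m (H *m E^T)^T) 0 0.
Proof.
move=> H; have HE : H = H *m E^T *m invmx G *m E.
  have -> : H *m E^T *m invmx G *m E = H *m (E^T *m invmx G *m E).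
    by rewrite !mulmxA.
  rewrite mulmx_suml; apply: eq_bigr => i _.
  rewrite mulmx_suml; apply: eq_bigr => j _.
  rewrite -scalemxAl; congr (_ *: _).
  by rewrite !mulmxA normal_part_dot -mulmxA -normal_partE.
by rewrite dotE {1}HE (trmx_mul H) (trmxK E) -(mulmxA _ E).
Qed.

(* The trace of the symmetric operator A J over the Lagrangian subspace is half
   its trace over the whole space, because J commutes with it. *)
Lemma lag_trace (A : 'M[R]_n) :
  \tr (invmx G *m (D *m diag_act A *m Jmx^T *m D^T)) = 0.
Proof.
pose S := diag_act A *m Jmx^T.
have trS : \tr S = 0.
  rewrite /S trJmx mulmxN /diag_act /Jmx mulmx_block raddfN /= mxtrace_block.
  by rewrite !mulmx0 !mul0mx !addr0 mxtrace0 addr0 oppr0.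
have JS : Jmx *m S *m Jmx^T = S.
  by rewrite /S !mulmxA -diag_actJ -(mulmxA (diag_act A)) JmxtJ mulmx1.
have key : \tr (D^T *m invmx G *m D *m S) = \tr (E^T *m invmx G *m E *m S).
  pose P := D^T *m invmx G *m D.
  have -> : E^T *m invmx G *m E *m S = Jmx^T *m (P *m Jmx *m S).
    by rewrite /E /P trmx_mul !mulmxA.
  rewrite (mxtrace_mulC Jmx^T).
  have -> : P *m Jmx *m S *m Jmx^T = P *m (Jmx *m S *m Jmx^T).
    by rewrite !mulmxA.
  by rewrite JS.
have : \tr (D^T *m invmx G *m D *m S) + \tr (E^T *m invmx G *m E *m S) = 0.
  by rewrite -raddfD -mulmxDl lag_resolution mul1mx.
rewrite -key => t2.
have -> : invmx G *m (D *m diag_act A *m Jmx^T *m D^T)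
   = (invmx G *m D *m S) *m D^T by rewrite /S !mulmxA.
rewrite mxtrace_mulC; have -> : D^T *m (invmx G *m D *m S)
   = D^T *m invmx G *m D *m S by rewrite !mulmxA.
lra.
Qed.

(** In use, the second hypothesis comes from differentiating the tangency relation, the first one;
    it turns <H, J A F> into the trace killed by [lag_trace]. As A F is tangent, J A F is normal, so
    pairing the soliton equation with it leaves a <F, J A F> = 0. *)
Lemma soliton_moment_zero (a : R) (F : 'rV[R]_(n + n)) (A : 'M[R]_n)
    (S : 'I_n -> 'I_n -> 'rV[R]_(n + n)) :
  let H := \sum_i \sum_j invmx G i j *: normal_part D (S i j) in
  F *m diag_act A *m E^T = 0 ->
  (forall i k, (F *m diag_act A *m Jmx *m (S i k)^T) 0 0
      = (D *m diag_act A *m E^T) i k) ->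
  a != 0 -> H != 0 ->
  - ((dot H H)^-1 *: H) = a *: normal_part D F ->
  dot F (F *m diag_act A *m Jmx) = 0.
Proof.
move=> H FE FS a0 H0 sol.
pose Y := F *m diag_act A *m Jmx.
pose w := F *m diag_act A *m D^T *m invmx G.
have YE : Y = w *m E by rewrite /Y mulmx_tangentJ.
have dotY z : dot z Y = (z *m E^T *m w^T) 0 0.
  by rewrite dotE YE trmx_mul mulmxA.
have HY : dot H Y = 0.
  have -> : dot H Y = \sum_i \sum_k invmx G i k * dot (normal_part D (S i k)) Y.
    rewrite dot_suml; apply: eq_bigr => i _; rewrite dot_suml.
    by apply: eq_bigr => k _; rewrite dotZl.
  rewrite exchange_big -[RHS](lag_trace A); apply: eq_bigr => k _.
  rewrite mxE; apply: eq_bigr => i _.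
  rewrite dotY normal_part_dot -dotY dotC dotE FS.
  have -> : invmx G i k = invmx G k i by rewrite -[in LHS]gram_sym_inv mxE.
  by congr (_ * _); rewrite /E trmx_mul !mulmxA.
have := congr1 (fun z => dot z Y) sol => /=.
rewrite dotNl !dotZl HY mulr0 oppr0 dotY normal_part_dot -dotY => /esym/eqP.
by rewrite mulf_eq0 (negPf a0) => /eqP.
Qed.

End LagrangianSubspace.

(** * Linear algebra at a point [(p + i q) xi], for a curve with unit tangent [c + i s] *)

Section PolarFrame.
Context {R : realType} {n : nat}.
Variables (D : 'M[R]_(n, n + n)) (X : 'M[R]_n) (xi m eta : 'rV[R]_n).
Variables (c s p q : R).
Hypothesis freeD : row_free D.
Hypothesis lagD : D *m Jmx *m D^T = 0.
Hypothesis xi1 : dot xi xi = 1.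
Hypothesis Xxi : forall i, dot (row i X) xi = 0.
Hypothesis cs1 : c ^+ 2 + s ^+ 2 = 1.
Hypothesis DE : forall k, row k D =
  row_mx ((m 0 k * c) *: xi + p *: row k X) ((m 0 k * s) *: xi + q *: row k X).

Let G := D *m D^T.
Let E := D *m Jmx.
Let sigma := s * p - c * q.

Lemma mulmx_frame (v : 'rV[R]_n) : v *m D =
  row_mx ((dot m v * c) *: xi + p *: (v *m X))
         ((dot m v * s) *: xi + q *: (v *m X)).
Proof.
rewrite mulmx_sum_row (eq_bigr _ (fun k _ => congr1 _ (DE k))).
rewrite [v *m X]mulmx_sum_row.
have -> : dot m v = \sum_k v 0 k * m 0 k by apply: eq_bigr => k _; rewrite mulrC.
under eq_bigr do rewrite scale_row_mx.
rewrite -[RHS](hsubmxK) -[LHS](hsubmxK) row_mxKl row_mxKr !linear_sum /=.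
by congr row_mx; rewrite !mulr_suml scaler_suml ?scaler_sumr -big_split /=;
  apply: eq_bigr => k _; rewrite ?row_mxKl ?row_mxKr scalerDr !scalerA;
  congr (_ *: _ + _ *: _); ring.
Qed.

(** This is the direction that moves along the curve while [xi] stays fixed. It exists because the
    rows of [X] are orthogonal to the unit vector [xi], so [X] is singular; on its kernel [m] cannot
    vanish, as [D] is injective. *)
Lemma radial_vector : exists2 v : 'rV[R]_n, v *m X = 0 & dot m v = 1.
Proof.
have X0 : \det X = 0.
  apply/eqP; apply: contraTT isT => dX.
  have uX : X \in unitmx by rewrite unitmxE unitfE.
  have : X *m xi^T = 0.
    by apply/colP => i; rewrite !mxE -[RHS](Xxi i) /dot; apply: eq_bigr => j _;
      rewrite !mxE.
  move/(congr1 (mulmx (invmx X))); rewrite mulmx0 mulKmx// => /(congr1 trmx).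
  rewrite trmxK trmx0 => xi0; move: xi1; rewrite xi0 dot0l => /eqP.
  by rewrite eq_sym oner_eq0.
have /det0P[v v0 vX] : \det X == 0 by rewrite X0.
have mv : dot m v != 0.
  apply: contraNneq v0 => mv; rewrite -(mulmx_free_eq0 _ freeD).
  by rewrite mulmx_frame mv vX !mul0r !scale0r !scaler0 !addr0 row_mx0.
exists ((dot m v)^-1 *: v); first by rewrite -scalemxAl vX scaler0.
by rewrite dotZr mulVf.
Qed.

Lemma gram_frame j k :
  G j k = m 0 j * m 0 k + (p ^+ 2 + q ^+ 2) * (X *m X^T) j k.
Proof.
have -> : G j k = dot (row j D) (row k D).
  by rewrite dotE tr_row -row_mul !mxE; apply: eq_bigr => l _; rewrite !mxE.
have -> : (X *m X^T) j k = dot (row j X) (row k X).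
  by rewrite dotE tr_row -row_mul !mxE; apply: eq_bigr => l _; rewrite !mxE.
rewrite !DE dot_row_mx !(dotDl, dotDr, dotZl, dotZr) xi1 (dotC xi) !Xxi.
have -> : m 0 j * m 0 k = m 0 j * m 0 k * (c ^+ 2 + s ^+ 2) by rewrite cs1 mulr1.
ring.
Qed.

Variable Xi2 : 'I_n -> 'I_n -> 'rV[R]_n.
Variable mu : 'I_n -> 'I_n -> R.
Variable S : 'I_n -> 'I_n -> 'rV[R]_(n + n).
Hypothesis Xi2xi : forall i j, dot (Xi2 i j) xi = - dot (row i X) (row j X).
Hypothesis SE : forall i j, S i j = row_mx
  ((mu i j * c - eta 0 i * m 0 j * s) *: xi + (c * m 0 j) *: row i X
     + (c * m 0 i) *: row j X + p *: Xi2 i j)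
  ((mu i j * s + eta 0 i * m 0 j * c) *: xi + (s * m 0 j) *: row i X
     + (s * m 0 i) *: row j X + q *: Xi2 i j).
Hypothesis Ssym : forall i j, S i j = S j i.

(* The pairing <sigma(d_i, d_j), J d_k F>. *)
Lemma cubic_form i j k : (S i j *m E^T) 0 k =
  eta 0 i * m 0 j * m 0 k + sigma * (m 0 j * dot (row i X) (row k X)
    + m 0 i * dot (row j X) (row k X) + m 0 k * dot (row i X) (row j X)).
Proof.
rewrite mulmx_trJ_omega omegaC.
rewrite SE DE omega_row_mx !(dotDl, dotDr, dotZl, dotZr) !Xi2xi xi1 !(dotC xi) !Xxi.
have -> : eta 0 i * m 0 j * m 0 k = eta 0 i * m 0 j * m 0 k * (c ^+ 2 + s ^+ 2).
  by rewrite cs1 mulr1.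
rewrite /sigma; ring.
Qed.

(* Symmetry of the second derivatives forces eta = lambda m, so H pairs with
   J d_k F to a multiple lambda' m_k, and then |H| = |lambda'|. *)
Lemma soliton_polar (a : R) :
  let H := \sum_i \sum_j invmx G i j *: normal_part D (S i j) in
  0 < p ^+ 2 + q ^+ 2 -> H != 0 ->
  - ((dot H H)^-1 *: H) = a *: normal_part D (row_mx (p *: xi) (q *: xi)) ->
  forall k, m 0 k = a * sigma *
    (eta 0 k + sigma / (p ^+ 2 + q ^+ 2) * (n%:R - 1) * m 0 k).
Proof.
set r2 := p ^+ 2 + q ^+ 2 => H r20 H0 sol.
have [v vX mv] := radial_vector.
have uG : G \in unitmx by exact: gram_unit.
have GE : G = m^T *m m + r2 *: (X *m X^T).
  apply/matrixP => j k; rewrite gram_frame !mxE big_ord1 !mxE.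
  by [].
(* Since [X] kills [v], the vector [v] is dual to [m] under the metric: contracting the inverse Gram
   matrix with [m] becomes evaluation at [v]. *)
have vG : v *m G = m.
  rewrite GE mulmxDr -scalemxAr mulmxA mulmxA vX mul0mx scaler0 addr0.
  have -> : v *m m^T = 1%:M.
    by apply/rowP => i; rewrite ord1 -[LHS]dotE dotC mv mxE.
  by rewrite mul1mx.
have mG : m *m invmx G = v by rewrite -vG mulmxK.
have Gm : invmx G *m m^T = v^T.
  by rewrite -[LHS]trmxK trmx_mul trmxK (gram_sym_inv D) mG.
have mGm : (m *m invmx G *m m^T) 0 0 = 1 by rewrite mG -dotE dotC.
have etaE i : eta 0 i = dot eta v * m 0 i.
  have sym j k : (eta 0 i * m 0 j - eta 0 j * m 0 i) * m 0 k = 0.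
    have := cubic_form i j k; rewrite Ssym cubic_form (dotC (row j X) (row i X)).
    lra.
  have sym' j : eta 0 i * m 0 j = eta 0 j * m 0 i.
    apply/eqP; rewrite -subr_eq0 -[X in X == 0]mulr1 -mv /dot mulr_sumr big1//.
    by move=> k _; rewrite mulrA sym mul0r.
  rewrite -[LHS]mulr1 -mv /dot mulr_sumr mulr_suml; apply: eq_bigr => j _.
  by rewrite mulrA sym'; ring.
set lam := dot eta v in etaE.
(* The trace of the identity minus that of the rank-one radial part: here the dimension n - 1 of the
   sphere enters. *)
have trG : r2 * \tr (invmx G *m (X *m X^T)) = n%:R - 1.
  have -> : r2 * \tr (invmx G *m (X *m X^T)) = \tr (invmx G *m (G - m^T *m m)).
    have -> : G - m^T *m m = r2 *: (X *m X^T) by rewrite GE addrAC subrr add0r.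
    by rewrite -scalemxAr mxtraceZ.
  rewrite mulmxBr mulVmx// raddfB /= mxtrace1; congr (_ - _).
  by rewrite mulmxA mxtrace_mulC mulmxA /mxtrace big_ord1.
pose T := H *m E^T.
pose lam' := lam + sigma / r2 * (n%:R - 1).
have sumG (f : 'I_n -> R) :
    \sum_i \sum_j invmx G i j * (m 0 j * f i) = \sum_i v 0 i * f i.
  apply: eq_bigr => i _.
  have -> : v 0 i = \sum_j invmx G i j * m 0 j.
    transitivity ((invmx G *m m^T) i 0); first by rewrite Gm mxE.
    by rewrite mxE; apply: eq_bigr => j _; rewrite mxE.
  by rewrite mulr_suml; apply: eq_bigr => j _; rewrite mulrA.
have Gsym i j : invmx G i j = invmx G j i.
  by rewrite -[in LHS](gram_sym_inv D) mxE.
have hv k : \sum_i v 0 i * dot (row i X) (row k X) = 0.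
  have : v *m X *m X^T = 0 by rewrite vX mul0mx.
  move/rowP/(_ k); rewrite -mulmxA !mxE => E0; rewrite -[RHS]E0.
  apply: eq_bigr => i _; congr (_ * _); rewrite !mxE; apply: eq_bigr => l _.
  by rewrite !mxE.
have TE : T = lam' *: m.
  apply/rowP => k; rewrite mean_curvature_dot// [RHS]mxE.
  under eq_bigr do under eq_bigr do rewrite cubic_form etaE.
  transitivity (lam * m 0 k * (\sum_i \sum_j invmx G i j * (m 0 j * m 0 i))
     + sigma * ((\sum_i \sum_j invmx G i j * (m 0 j * dot (row i X) (row k X)))
     + (\sum_i \sum_j invmx G i j * (m 0 i * dot (row j X) (row k X)))
     + m 0 k * (\sum_i \sum_j invmx G i j * dot (row i X) (row j X)))).
    rewrite !mulrDr !mulr_sumr -!big_split /=; apply: eq_bigr => i _.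
    rewrite !mulr_sumr -!big_split /=; apply: eq_bigr => j _; ring.
  rewrite (sumG (fun i => m 0 i)) (sumG (fun i => dot (row i X) (row k X))).
  rewrite [X in _ * (_ + X + _)]exchange_big /=.
  under [X in _ * (_ + X + _)]eq_bigr do under eq_bigr do rewrite Gsym.
  rewrite (sumG (fun i => dot (row i X) (row k X))) !hv addr0 add0r.
  have -> : \sum_i v 0 i * m 0 i = 1 by rewrite -mv dotC.
  have -> : \sum_i \sum_j invmx G i j * dot (row i X) (row j X)
      = (n%:R - 1) / r2.
    rewrite -trG mulrAC mulfV ?mul1r ?gt_eqF//.
    apply: eq_bigr => i _; rewrite mxE; apply: eq_bigr => j _; congr (_ * _).
    by rewrite dotC !mxE; apply: eq_bigr => l _; rewrite !mxE.
  by rewrite /lam'; ring.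
have HH : dot H H = lam' ^+ 2.
  rewrite mean_curvature_normE// -/G -/H -/T TE linearZ /= -!scalemxAl -scalemxAr.
  rewrite mxE mxE mGm; ring.
have l0 : lam' != 0 by rewrite -sqrf_eq0 -HH dot_eq0.
have FE k : (row_mx (p *: xi) (q *: xi) *m E^T) 0 k = - sigma * m 0 k.
  rewrite mulmx_trJ_omega omegaC.
  rewrite DE omega_row_mx !(dotDl, dotDr, dotZl, dotZr) xi1 !(dotC xi) !Xxi.
  rewrite /sigma; ring.
have key k : lam'^-1 * m 0 k = a * sigma * m 0 k.
  have := congr1 (fun z => z *m E^T) sol.
  rewrite mulNmx -!scalemxAl normal_part_dot// -/T => /rowP/(_ k).
  rewrite [RHS]mxE FE HH TE [LHS]mxE scalerA mxE => h.
  have -> : a * sigma * m 0 k = - (a * (- sigma * m 0 k)) by ring.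
  rewrite -h; field.
  exact: l0.
have al : a * sigma * lam' = 1.
  have : \sum_k lam'^-1 * m 0 k * v 0 k = \sum_k a * sigma * m 0 k * v 0 k.
    by apply: eq_bigr => k _; rewrite key.
  under eq_bigr do rewrite -mulrA; under [RHS]eq_bigr do rewrite -mulrA.
  by rewrite -!mulr_sumr -/(dot m v) mv !mulr1 => <-; rewrite mulVf.
move=> k; rewrite etaE; transitivity (a * sigma * lam' * m 0 k).
  by rewrite al mul1r.
by rewrite /lam'; ring.
Qed.

End PolarFrame.

(** Makes row vectors a complete normed module, as Baire's theorem requires. *)
HB.instance Definition _ (R : realType) (n : nat) := Complete.on 'rV[R]_n.

(** * Tangency of the rotation fields *)

Section BaireSheets.
Context {R : realType}.

(** Otherwise the complements of the closures would be dense open sets, with a common point in [W]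
    that no [E i] covers. The point returned is in [E i] itself, so that it can be lifted to a
    sheet. *)
Lemma Baire_cover (V : completeNormedModType R) (W : set V)
    (E : nat -> set V) : open W -> W !=set0 ->
  (forall w, W w -> exists i, E i w) ->
  exists i w, E i w /\ nbhs w (closure (E i)).
Proof.
move=> oW W0 cov; apply: contrapT => H.
pose F i := ~` closure (E i).
have FB i : open (F i) /\ dense (F i).
  split; first by apply: closed_openC; exact: closed_closure.
  move=> O [x Ox] oO; apply: contrapT => /set0P/negP; rewrite negbK => /eqP O0.
  have OE : O `<=` closure (E i).
    move=> y Oy; apply: contrapT => nE.
    by have : (O `&` F i) y by []; rewrite O0.
  have [w [Ew Ow]] := OE x Ox O (open_nbhs_nbhs (conj oO Ox)).
  apply: H; exists i, w; split=> //.
  by apply: filterS OE _; exact: open_nbhs_nbhs.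
have [w [Ww Fw]] := Baire FB W0 oW.
have [i Ei] := cov w Ww.
by apply: (Fw i Logic.I); apply: subset_closure.
Qed.

(** Each bound is a closed condition for continuous [A], so it extends from [E] to its closure,
    which is a neighbourhood of [w]; hence A y - A w = o(y - w). *)
Lemma derive0_of_dense (V : normedModType R) (E : set V) (A : V -> R) (w : V) :
  nbhs w (closure E) -> (\forall y \near w, {for y, continuous A}) ->
  (forall e, 0 < e -> \forall y \near w, E y -> `|A y - A w| <= e * `|y - w|) ->
  forall v, is_derive w v A 0.
Proof.
move=> clE cA AE v.
have bound e : 0 < e -> \forall y \near w, `|A y - A w| <= e * `|y - w|.
  move=> e0.
  have /nbhs_ballP[d /= d0 Hd] : \forall y \near w, closure E y /\
      ({for y, continuous A} /\ (E y -> `|A y - A w| <= e * `|y - w|)).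
    exact: filterI clE (filterI cA (AE _ e0)).
  apply/nbhs_ballP; exists d => //= y yB; rewrite leNgt; apply/negP => yA.
  have [clEy [cAy _]] := Hd y yB.
  pose g z := `|A z - A w| - e * `|z - w|.
  have cg : {for y, continuous g}.
    apply: (@continuousB R R V (fun z => `|A z - A w|) (fun z => e * `|z - w|)).
      apply: (@continuous_comp _ _ _ (fun z => A z - A w) (fun z => `|z|)).
        by apply: (@continuousB R R V A (fun=> A w)) => //; exact: cst_continuous.
      exact: norm_continuous.
    apply: (@continuousM R V (fun=> e) (fun z => `|z - w|)).
      exact: cst_continuous.
    apply: (@continuous_comp _ _ _ (fun z => z - w) (fun z => `|z|)).
      apply: (@continuousB R V V id (fun=> w)); last exact: cst_continuous.
      exact: cvg_id.
    exact: norm_continuous.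
  have gy : 0 < g y by rewrite subr_gt0.
  have gn : \forall z \near y, 0 < g z.
    by move/cvgr_gt : cg => /(_ _ gy).
  have bn : nbhs y (ball w d).
    by apply: open_nbhs_nbhs; split=> //; exact: ball_open.
  have [z [Ez [gz zB]]] := clEy _ (filterI gn bn).
  have [_ [_ /(_ Ez)]] := Hd z zB.
  by move: gz; rewrite /= subr_gt0 ltNge => /negP.
have zo : A \o shift w = cst (A w) + (\0 : {linear V -> R}) +o_ 0 id.
  apply/eqaddoP => e e0.
  have : \forall y \near 0, `|A (y + w) - A w| <= e * `|(y + w) - w|.
    by rewrite (near_shift w 0); near do rewrite /= sub0r subrK; exact: bound.
  by apply: filterS => y; rewrite addrK /= addr0.
have dz : 'd A w = 0 :> (V -> R).
  by apply: diff_unique zo; apply: cst_continuous.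
have dA : differentiable A w.
  by apply/diff_locallyP; rewrite dz; split=> //; apply: cst_continuous.
by apply: DeriveDef; [exact: diff_derivable|rewrite deriveE// dz].
Unshelve. all: by end_near. Qed.

End BaireSheets.

Section LocalBounds.
Context {R : realType} {V W : normedModType R}.

Lemma differentiable_remainder (f : V -> W) (x : V) (e : R) :
  differentiable f x -> 0 < e ->
  \forall y \near x, `|f y - f x - 'd f x (y - x)| <= e * `|y - x|.
Proof.
move=> df e0; have /eqaddoP := diff_locally df => /(_ e e0) H.
rewrite (near_shift 0 x) subr0; apply: filterS H => y Hy /=.
by rewrite addrK -addrA -opprD.
Qed.

Lemma differentiable_lipschitz (f : V -> W) (x : V) : differentiable f x ->
  exists2 K : R, 0 < K & \forall y \near x, `|f y - f x| <= K * `|y - x|.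
Proof.
move=> df; have [k k0 Hk] := linear_lipschitz (diff_continuous df).
exists (k + 1); first by rewrite addr_gt0.
have := differentiable_remainder df (@ltr01 R).
apply: filterS => y H.
have -> : f y - f x = (f y - f x - 'd f x (y - x)) + 'd f x (y - x).
  by rewrite subrK.
apply: (le_trans (ler_normD _ _)); rewrite mulrDl addrC.
by apply: lerD => //; exact: Hk.
Qed.

End LocalBounds.

Section Sheets.
Context {R : realType} {n : nat} (M : manifold R n) (phi : M -> 'rV[R]_(n + n)).
Hypothesis imm : smooth_immersion phi.
Hypothesis lag : lagrangian phi.

Lemma chart_smooth e k : atlas e -> Ck_on k (cimg e) (phi \o cinv e).
Proof. by move=> ae; apply: Ck_on_sub (imm.1 e ae k) => x ex; split. Qed.

Lemma chart_differentiable e x : atlas e -> cimg e x ->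
  differentiable (phi \o cinv e) x.
Proof. by move=> ae; apply: (chart_smooth 1 ae).1. Qed.

Lemma chart_lag e x : atlas e -> cimg e x ->
  'J (phi \o cinv e) x *m Jmx *m ('J (phi \o cinv e) x)^T = 0.
Proof.
move=> ae ex; apply/matrixP => i j.
have := lag ae ex (delta_mx 0 i) (delta_mx 0 j).
rewrite omegaE trmx_mul trmx_delta !mulmxA -colE mxE -!mulmxA -rowE mxE.
by rewrite !mulmxA => ->; rewrite [RHS]mxE.
Qed.

(** Chart coordinates on a small sheet are controlled by the images alone; this replaces a local
    inverse of [phi]. *)
Lemma local_sheet (p : M) : exists (e : chart R n M) (C : R) (N : set M),
  [/\ atlas e, nbhs p N, N `<=` cdom e & forall q r, N q -> N r ->
    `|cmap e q - cmap e r| <= C * `|phi q - phi r|].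
Proof.
have [e ae ep] := atlas_cover p.
have ex : cimg e (cmap e p) by exact: cmap_img.
have [d [C [d0 BU HC]]] := row_free_lower_lipschitz (cimg_open (c := e)) ex
  (chart_smooth 1 ae) (imm.2 e _ ae ex).
exists e, C, (cdom e `&` cmap e @^-1` ball (cmap e p) d); split=> //.
- apply: filterI; first by apply: open_nbhs_nbhs; split=> //; exact: cdom_open.
  by apply: (cmap_continuous ep); exact: nbhsx_ballx.
- move=> q r [eq qB] [er rB].
  by have := HC _ _ qB rB; rewrite /= !cmapK.
Qed.

(** Countably many basic open sets of [M] suffice as sheets, so by Baire one of them has a preimage
    under [Phi] that is dense near one of its points [w]. On it, the pairing l of [Phi z] with a
    tangent vector at [w] equals the pairing of [phi] in the chart at a point within O(|z - w|) of
    [y]; the latter has zero differential at [y], as the tangent space is Lagrangian. So l o Phi has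
    derivative zero at [w]. *)
Lemma sheet_derivative (V : completeNormedModType R) (W : set V)
    (Phi : V -> 'rV[R]_(n + n)) :
  open W -> W !=set0 -> Ck_on 1 W Phi ->
  (forall w, W w -> range phi (Phi w)) ->
  exists w e y, [/\ W w, atlas e, cimg e y &
    forall v u, omega ('D_v Phi w) (u *m 'J (phi \o cinv e) y) = 0].
Proof.
move=> oW W0 cPhi rPhi.
have [B /countable_injP[f fI] [Bo Bb]] := @carrier_second_countable _ _ M.
pose good b (e : chart R n M) (C : R) := [/\ B b, atlas e, b `<=` cdom e &
  forall q r, b q -> b r -> `|cmap e q - cmap e r| <= C * `|phi q - phi r|].
pose E i w := W w /\ exists b e C p, [/\ good b e C, f b = i, b p & phi p = Phi w].
have cov w : W w -> exists i, E i w.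
  move=> Ww; have [p _ pw] := rPhi w Ww.
  have [e [C [N [ae pN Ne NC]]]] := local_sheet p.
  have [b [Bb' bp] bN] := Bb p N pN.
  exists (f b); split=> //; exists b, e, C, p; split=> //; split=> //.
    by move=> q /bN /Ne.
  by move=> q r /bN Nq /bN Nr; exact: NC.
have [i [w [[Ww [b [e [C [p [bg fb bp pw]]]]]] clE]]] := Baire_cover oW W0 cov.
have [Bb' ae be HC] := bg.
have dp : cdom e p by exact: be.
have ey : cimg e (cmap e p) by exact: cmap_img.
exists w, e, (cmap e p); split=> // v u.
set F := phi \o cinv e; set y := cmap e p in ey *.
pose l z := omega z (u *m 'J F y).
have lE z : l z = \sum_k z 0 k * (Jmx *m (u *m 'J F y)^T) k 0.
  by rewrite /l omegaE -mulmxA mxE.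
pose A w := l (Phi w).
have dF : differentiable F y by exact: chart_differentiable.
have lderiv (V' : normedModType R) (h : V' -> 'rV[R]_(n + n)) x v' dh :
    is_derive x v' h dh -> is_derive x v' (l \o h) (l dh).
  move=> hd; have -> : l \o h = \sum_k ((Jmx *m (u *m 'J F y)^T) k 0 *:
     (fun x => h x 0 k)).
    by apply/funext => z; rewrite /= lE fct_sumE; apply: eq_bigr => k _;
      rewrite mulrC.
  apply: is_derive_eq.
    apply: is_derive_sum => k; apply: is_deriveZ.
    exact: is_derive_coord.
  by rewrite lE; apply: eq_bigr => k _; rewrite mulrC.
have ldiff (V' : normedModType R) (h : V' -> 'rV[R]_(n + n)) x :
    differentiable h x -> differentiable (l \o h) x.
  move=> hd; have -> : l \o h = \sum_k ((Jmx *m (u *m 'J F y)^T) k 0 *: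
     (fun x => h x 0 k)).
    by apply/funext => z; rewrite /= lE fct_sumE; apply: eq_bigr => k _;
      rewrite mulrC.
  apply: differentiable_sum => k; apply: differentiableZ.
  by have /differentiable_mxP := hd; apply.
have dPhi : differentiable Phi w by exact: cPhi.1.
have nW : nbhs w W by exact: open_nbhs_nbhs.
have cA : \forall z \near w, {for z, continuous A}.
  apply: filterS nW => z Wz; apply: differentiable_continuous.
  by apply: ldiff; exact: cPhi.1.
suff AE eps : 0 < eps ->
    \forall z \near w, E i z -> `|A z - A w| <= eps * `|z - w|.
  have [_ D0] := derive0_of_dense clE cA AE v.
  have [_ E1] := lderiv _ Phi w v _ (derivableP (diff_derivable dPhi)).
  rewrite -[LHS]/(l ('D_v Phi w)) -E1.
  exact: D0.
move=> eps0; have [K K0 HK] := differentiable_lipschitz dPhi.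
(* Lipschitz constant of [z] to the chart coordinate of its lift; [C] may have any sign, hence |C| +
   1. *)
pose L := (`|C| + 1) * K.
have L0 : 0 < L by rewrite mulr_gt0// ltr_wpDl.
have dB : differentiable (l \o F) y by exact: ldiff.
have dB0 h : 'd (l \o F) y h = 0.
  have [_] := lderiv _ F y h _ (derivableP (diff_derivable dF)).
  rewrite deriveE// => ->; rewrite deriveEjacobian//.
  exact: lag.
have eL0 : 0 < eps / L by rewrite divr_gt0.
have /nbhs_ballP[d /= d0 Hd] := differentiable_remainder dB eL0.
have dL0 : 0 < d / L by rewrite divr_gt0.
apply: filterS (filterI HK (nbhsx_ballx w _ dL0)) => z [HKz zB].
move=> [Wz [b' [e' [C' [p' [[Bb1 _ _ _] fb' bp' pz]]]]]].
(* The numbering of basic sets is injective, so [z] lifts to the same sheet as [w]. *)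
have bb : b' = b by apply: fI; rewrite ?inE// fb' fb.
rewrite bb in bp' => {bb b' fb' Bb1}.
have Fp q : b q -> F (cmap e q) = phi q.
  by move=> /be eq; rewrite /F /= cmapK.
have AE q : b q -> l (phi q) = (l \o F) (cmap e q).
  by move=> bq; rewrite /= -Fp.
have yL : `|cmap e p' - y| <= L * `|z - w|.
  apply: (le_trans (HC _ _ bp' bp)); rewrite pz pw.
  apply: (@le_trans _ _ ((`|C| + 1) * `|Phi z - Phi w|)).
    rewrite ler_wpM2r// (le_trans (ler_norm _))// lerDl//.
  by rewrite -mulrA ler_wpM2l// addr_ge0.
have yB : ball y d (cmap e p').
  rewrite -ball_normE /= distrC; apply: (le_lt_trans yL).
  move: zB; rewrite -ball_normE /= distrC => zw.
  by rewrite mulrC -ltr_pdivlMr.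
rewrite /A -pz -pw !AE//; have := Hd _ yB; rewrite dB0 subr0 => /le_trans; apply.
rewrite mulrAC ler_pdivrMr// -mulrA (mulrC _ L).
by apply: ler_wpM2l; [exact: ltW|exact: yL].
Qed.

End Sheets.

Section Rotation.
Context {R : realType} {n : nat}.
Variable A : 'M[R]_n.
Hypothesis skewA : A^T = - A.
Hypothesis cubeA : A *m A *m A = - A.

(** Rodrigues' formula for exp(t A): the exponential series collapses because A^3 = - A. *)
Definition rot (t : R) : 'M[R]_n :=
  1%:M + sin t *: A + (1 - cos t) *: (A *m A).

Lemma rotD (a b : R) : rot (a + b) = rot a *m rot b.
Proof.
have A4 : A *m A *m (A *m A) = - (A *m A) by rewrite mulmxA cubeA mulNmx.
have A3 : A *m (A *m A) = - A by rewrite mulmxA cubeA.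
rewrite /rot !mulmxDl !mulmxDr !mul1mx !mulmx1 -!scalemxAl -!scalemxAr.
rewrite A4 A3 cubeA sinD cosD.
by apply/matrixP => i j; rewrite !mxE; ring.
Qed.

Lemma tr_rot (t : R) : (rot t)^T = rot (- t).
Proof.
rewrite /rot sinN cosN !linearD /= !linearZ /= trmx1 trmx_mul skewA.
by rewrite mulNmx mulmxN opprK scalerN scaleNr.
Qed.

Lemma rot0 : rot 0 = 1%:M.
Proof. by rewrite /rot sin0 cos0 subrr !scale0r !addr0. Qed.

Lemma SO_rot (t : R) : SO (rot t).
Proof.
have orth s : rot s *m (rot s)^T = 1%:M by rewrite tr_rot -rotD subrr rot0.
(* Halving the angle turns the determinant into a square, det (Q Q^T) = 1, which rules out -1. *)
split=> //; rewrite (splitr t) rotD det_mulmx.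
by rewrite -[X in _ * X]det_tr -det_mulmx orth det1.
Qed.

End Rotation.

Section SkewBasis.
Context {R : realType} {n : nat}.

Definition skew_mx (i j : 'I_n) : 'M[R]_n := delta_mx i j - delta_mx j i.

Lemma tr_skew_mx i j : (skew_mx i j)^T = - skew_mx i j.
Proof. by rewrite /skew_mx linearB /= !trmx_delta opprB. Qed.

Lemma cube_skew_mx i j : i != j ->
  skew_mx i j *m skew_mx i j *m skew_mx i j = - skew_mx i j.
Proof.
move=> ij; have ji : (j == i) = false by rewrite eq_sym (negPf ij).
have -> : skew_mx i j *m skew_mx i j = - delta_mx i i - delta_mx j j.
  rewrite /skew_mx mulmxBl !mulmxBr !mul_delta_mx_cond !eqxx (negPf ij) ji.
  by rewrite !mulr1n !mulr0n sub0r subr0.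
rewrite mulmxBl mulNmx /skew_mx !mulmxBr !mul_delta_mx_cond !eqxx (negPf ij) ji.
by rewrite !mulr1n !mulr0n sub0r subr0 opprK opprB addrC.
Qed.

End SkewBasis.

Section ActionOnPairs.
Context {R : realType} {n : nat}.
Implicit Types A B : 'M[R]_n.

Lemma diag_actD A B : diag_act (A + B) = diag_act A + diag_act B.
Proof. by rewrite /diag_act add_block_mx !addr0. Qed.

Lemma diag_actZ (a : R) A : diag_act (a *: A) = a *: diag_act A.
Proof. by rewrite /diag_act scale_block_mx !scaler0. Qed.

Lemma diag_act1 : diag_act 1%:M = 1%:M :> 'M[R]_(n + n).
Proof. by rewrite /diag_act -scalar_mx_block. Qed.

Lemma diag_actM A B : diag_act (A *m B) = diag_act A *m diag_act B.
Proof.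
by rewrite /diag_act mulmx_block !mulmx0 !mul0mx !addr0 !add0r.
Qed.

Lemma tr_diag_act A : (diag_act A)^T = diag_act A^T.
Proof. by rewrite /diag_act tr_block_mx !trmx0. Qed.

End ActionOnPairs.

Section CkExamples.
Context {R : realType}.

Lemma Ck_on_rsubmx m n k (U : set 'rV[R]_(m + n)) : open U ->
  Ck_on k U (rsubmx : 'rV[R]_(m + n) -> 'rV[R]_n).
Proof.
move=> oU; apply: (Ck_on_mx oU) => a b.
have -> : (fun w : 'rV[R]_(m + n) => rsubmx w a b) = (fun w => w a (rshift m b)).
  by apply/funext => w; rewrite mxE.
exact: (Ck_on_coord a (rshift m b) oU (Ck_on_id k oU)).
Qed.

Lemma Ck_on_trig (V : normedModType R) k (U : set V) (f : V -> R) (a b c : R) :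
  open U -> Ck_on k U f ->
  Ck_on k U (fun x => a + sin (f x) * b + (1 - cos (f x)) * c).
Proof.
move=> oU cf; have [cc cs] := Ck_on_cos_sin oU cf.
have cst (r : R) : Ck_on k U (fun=> r) by exact: (@Ck_on_cst _ _ R).
exact: (Ck_onD oU (Ck_onD oU (cst a) (Ck_onM oU cs (cst b)))
  (Ck_onM oU (Ck_onB oU (cst 1) cc) (cst c))).
Qed.

End CkExamples.

Section Tangency.
Context {R : realType} {n : nat} (M : manifold R n) (phi : M -> 'rV[R]_(n + n)).
Hypothesis imm : smooth_immersion phi.
Hypothesis lag : lagrangian phi.
Hypothesis inv : SO_invariant phi.

Lemma is_derive_mulmxr (V : normedModType R) m p (f : V -> 'rV[R]_m) x v df
    (K : 'M[R]_(m, p)) :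
  is_derive x v f df -> is_derive x v (fun y => f y *m K) (df *m K).
Proof.
move=> fd; apply: is_derive_mx => i j; rewrite mxE.
have -> : (fun y => (f y *m K) i j) = \sum_k (K k j *: (fun y => f y i k)).
  apply/funext => z; rewrite mxE fct_sumE; apply: eq_bigr => k _.
  by rewrite mulrC.
apply: is_derive_eq.
  apply: is_derive_sum => k; apply: is_deriveZ.
  exact: is_derive_coord.
by apply: eq_bigr => k _; rewrite mulrC.
Qed.

Lemma is_derive_mulmxl m p q (f : R -> 'M[R]_(m, p)) (x v : R) df
    (K : 'M[R]_(q, m)) :
  is_derive x v f df -> is_derive x v (fun y => K *m f y) (K *m df).
Proof.
move=> fd; apply: is_derive_mx => i j; rewrite mxE.
have -> : (fun y => (K *m f y) i j) = \sum_k (K i k *: (fun y => f y k j)).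
  by apply/funext => z; rewrite mxE fct_sumE.
apply: is_derive_eq; last by [].
by apply: is_derive_sum => k; apply: is_deriveZ; exact: is_derive_coord.
Qed.

Lemma is_derive_trig_shift (a b c t : R) :
  is_derive (0 : R) (1 : R) (fun s : R => a + sin (s + t) * b + (1 - cos (s + t)) * c)
    (cos t * b + sin t * c).
Proof.
have ds : is_derive (0 : R) (1 : R) (fun s : R => sin (s + t)) (cos t).
  have := is_derive1_comp (is_derive_sin (shift t 0)) (is_derive_shift 0 1 t).
  by rewrite /shift /= add0r mulr1.
have dc : is_derive (0 : R) (1 : R) (fun s : R => cos (s + t)) (- sin t).
  have := is_derive1_comp (is_derive_cos (shift t 0)) (is_derive_shift 0 1 t).
  by rewrite /shift /= add0r mulr1.
pose f := fun s : R => sin (s + t); pose g := fun s : R => cos (s + t).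
have hf : is_derive (0 : R) (1 : R) (b *: f) (b *: cos t) by apply: is_deriveZ.
have hg : is_derive (0 : R) (1 : R) (c *: g) (c *: (- sin t)).
  by apply: is_deriveZ.
have hc := is_derive_cst (a + c : R) (0 : R) (1 : R).
have := is_deriveB (is_deriveD hc hf) hg.
have -> : cst (a + c) + b *: f - c *: g
    = (fun s => a + sin (s + t) * b + (1 - cos (s + t)) * c).
  by apply/funext => s; rewrite !fctE -[b *: _]/(b * _) -[c *: _]/(c * _);
    rewrite /f /g; ring.
have -> : 0 + b *: cos t - c *: (- sin t) = cos t * b + sin t * c; last by [].
by rewrite -[b *: _]/(b * _) -[c *: _]/(c * _); ring.
Qed.

Let time (w : 'rV[R]_(1 + n)) : R := w 0 (lshift n 0).

(* If omega (A F) (d_k F) were nonzero on a ball, (t, x) |-> F x *m rot t would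
   have, at some point, all its partial derivatives in one Lagrangian tangent
   space of M, where omega vanishes. *)
Lemma killing_tangent e x (i j : 'I_n) : atlas e -> cimg e x -> i != j ->
  phi (cinv e x) *m diag_act (skew_mx i j)
    *m ('J (phi \o cinv e) x *m Jmx)^T = 0.
Proof.
move=> ae ex ij; set A := skew_mx i j.
have skA := @tr_skew_mx R n i j; have cuA := @cube_skew_mx R n i j ij.
set F := phi \o cinv e.
pose h k y := omega ('D_(delta_mx 0 k) F y) (F y *m diag_act A).
have hE k y : cimg e y -> h k y = (F y *m diag_act A *m ('J F y *m Jmx)^T) 0 k.
  move=> ey; rewrite mulmx_trJ_omega /h deriveEjacobian ?rowE//.
  exact: chart_differentiable.
have cF k := chart_smooth imm k ae.
have oU := cimg_open (c := e).
have hc k : {for x, continuous (h k)}.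
  suff : Ck_on 0 (cimg e) (h k) by exact.
  have -> : h k = (fun y => \sum_r (\sum_s ('D_(delta_mx 0 k) F y) 0 s * Jmx s r)
      * (\sum_s F y 0 s * diag_act A s r)).
    apply/funext => y; rewrite /h omegaE mxE; apply: eq_bigr => r _.
    by rewrite !mxE.
  apply: (@Ck_on_sum _ _ _ _ R) => // r; apply: Ck_onM => //;
    apply: (@Ck_on_sum _ _ _ _ R) => // s; apply: Ck_onM => //;
    try exact: (@Ck_on_cst _ _ R).
    apply: Ck_on_coord => //; exact: ((cF 1%N).2 _).
  by apply: Ck_on_coord => //; exact: (cF 0%N).
apply/rowP => k; rewrite [RHS]mxE -hE//; apply/eqP; apply: contrapT => /negP hk0.
have [d /= d0 Hd] : exists2 d : R, 0 < d &
    forall y, ball x d y -> cimg e y /\ h k y != 0.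
  have n1 : nbhs x (cimg e) by exact: open_nbhs_nbhs.
  have n2 : \forall y \near x, h k y != 0.
    have := hc k; move/(cvgr_neq0 _) => /(_ hk0); exact.
  have n3 : nbhs x (cimg e `&` [set y | h k y != 0]) by exact: filterI n1 n2.
  by have /nbhs_ballP[d /= d0 Hd] := n3; exists d => // y /Hd.
pose A2 := diag_act A.
pose W := (rsubmx : 'rV[R]_(1 + n) -> 'rV[R]_n) @^-1` ball x d.
pose Phi (w : 'rV[R]_(1 + n)) := F (rsubmx w) *m diag_act (rot A (time w)).
have oW : open W.
  apply: open_comp; last exact: ball_open.
  by move=> w _; apply: continuous_rsubmx.
have W0 : W !=set0.
  by exists (row_mx 0 x); rewrite /W /= row_mxKr; exact: ballxx.
have actE t : diag_act (rot A t)
    = 1%:M + sin t *: A2 + (1 - cos t) *: (A2 *m A2).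
  by rewrite /rot !diag_actD !diag_actZ diag_act1 diag_actM.
have cPhi : Ck_on 1 W Phi.
  apply: Ck_on_mx => // r l.
  have -> : (fun w => Phi w r l) = (fun w => \sum_q F (rsubmx w) 0 q *
     ((1%:M : 'M[R]_(n + n)) q l + sin (time w) * A2 q l
        + (1 - cos (time w)) * (A2 *m A2) q l)).
    apply/funext => w; rewrite /Phi actE mxE; apply: eq_bigr => q _.
    by rewrite !ord1 mxE [X in X + _]mxE ![in RHS]mxE; congr (_ * (_ + _ + _));
      rewrite mxE// !mxE.
  apply: (Ck_on_sum _ oW) => q; apply: (Ck_onM oW).
    have WU w' : W w' -> cimg e (rsubmx w') by move=> /Hd[].
    exact: (@Ck_on_comp _ _ _ _ _ _ rsubmx (fun y => F y 0 q) oW oU WU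
      (Ck_on_rsubmx _ oW) (Ck_on_coord 0 q oU (cF 1%N))).
  exact: (Ck_on_trig _ _ _ oW (Ck_on_coord 0 (lshift n 0) oW (Ck_on_id _ oW))).
have rPhi w : W w -> range phi (Phi w).
  move=> _; rewrite -(inv (SO_rot skA cuA (time w))).
  exists (F (rsubmx w)); first by exists (cinv e (rsubmx w)).
  by rewrite SO_actE.
have [w [e' [y [Ww ae' ey' ort]]]] := sheet_derivative imm lag oW W0 cPhi rPhi.
set D' := 'J (phi \o cinv e') y in ort.
have lag' : D' *m Jmx *m D'^T = 0 by exact: chart_lag.
have free' : row_free D' by exact: imm.2.
(* Being orthogonal for [omega] to a Lagrangian space means lying in it, so any two derivatives of
   [Phi] at [w] pair to zero. *)
have tang v : 'D_v Phi w = 'D_v Phi w *m D'^T *m invmx (D' *m D'^T) *m D'.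
  apply: tangentP => //; apply/rowP => l; rewrite mulmx_trJ_omega mxE rowE.
  by rewrite omegaC ort oppr0.
have isot v v' : omega ('D_v Phi w) ('D_v' Phi w) = 0.
  rewrite (tang v') ort; exact: erefl.
set z := rsubmx w; set t := time w.
have [ez hz] := Hd _ Ww.
have dPhi v : is_derive w v Phi ('D_v Phi w).
  by apply/derivableP/diff_derivable; exact: cPhi.1.
have line v df : is_derive (0 : R) (1 : R) (fun s : R => Phi (s *: v + w)) df ->
    'D_v Phi w = df.
  move=> H; have := (is_derive_line Phi w v 0 df).2 H.
  by rewrite scale0r add0r => -[].
have Dx v : 'D_(row_mx 0 v) Phi w = 'D_v F z *m diag_act (rot A t).
  have dF : is_derive z v F ('D_v F z).
    by apply/derivableP/diff_derivable; exact: chart_differentiable.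
  apply: line.
  have -> : (fun s => Phi (s *: row_mx 0 v + w))
      = (fun s => F (s *: v + z) *m diag_act (rot A t)).
    apply/funext => s; rewrite /Phi /time linearD linearZ /= row_mxKr.
    by rewrite !mxE (unsplitK (inl _)) mxE mulr0 add0r.
  apply: is_derive_mulmxr; have := (is_derive_line F z v 0 ('D_v F z)).1.
  by rewrite scale0r add0r; apply.
have Dt : 'D_(row_mx (const_mx 1) 0) Phi w
    = F z *m A2 *m diag_act (rot A t).
  apply: line.
  have -> : (fun s => Phi (s *: row_mx (const_mx 1) 0 + w))
      = (fun s => F z *m diag_act (rot A (s + t))).
    apply/funext => s; rewrite /Phi /time linearD linearZ /= row_mxKr.
    by rewrite scaler0 add0r !mxE (unsplitK (inl _)) mxE mulr1.
  rewrite -mulmxA; apply: is_derive_mulmxl.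
  have A3 : A2 *m (A2 *m A2) = - A2.
    by rewrite mulmxA /A2 -!diag_actM cuA -scaleN1r diag_actZ scaleN1r.
  apply: is_derive_mx => a b.
  have -> : (fun s => diag_act (rot A (s + t)) a b) = (fun s =>
      (1%:M : 'M[R]_(n + n)) a b + sin (s + t) * A2 a b
        + (1 - cos (s + t)) * (A2 *m A2) a b).
    by apply/funext => s; rewrite actE !mxE.
  (* The derivative of exp(t A) is A exp(t A), written with A^3 = - A. *)
  have <- : cos t * A2 a b + sin t * (A2 *m A2) a b
      = (A2 *m diag_act (rot A t)) a b.
    rewrite actE !mulmxDr mulmx1 -!scalemxAr A3.
    move: (A2 *m A2) => B; rewrite !mxE; ring.
  exact: is_derive_trig_shift.
(* The rotation is orthogonal and commutes with J, so it drops out of [omega] and leaves [h k] at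
   the point [z], which was nonzero. *)
have := isot (row_mx (const_mx 1) 0) (row_mx 0 (delta_mx 0 k)).
rewrite Dx Dt omegaE trmx_mul tr_diag_act !mulmxA.
rewrite -(mulmxA _ _ Jmx) diag_actJ mulmxA -(mulmxA _ (diag_act _) (diag_act _)).
rewrite -diag_actM (SO_rot skA cuA t).1 diag_act1 mulmx1 -omegaE omegaC.
by move/eqP; rewrite oppr_eq0 => hk; rewrite /h hk in hz.
Qed.

End Tangency.

Section DeriveRules.
Context {R : realType} {V : normedModType R}.
Implicit Types (f g : V -> R) (x v : V).

Lemma is_derive_unique (W : normedModType R) (f : V -> W) x v d1 d2 :
  is_derive x v f d1 -> is_derive x v f d2 -> d1 = d2.
Proof. by move=> [_ <-] [_ <-]. Qed.

Lemma is_derive_add f g x v df dg : is_derive x v f df -> is_derive x v g dg ->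
  is_derive x v (fun y => f y + g y) (df + dg).
Proof. exact: is_deriveD. Qed.

Lemma is_derive_mul f g x v df dg : is_derive x v f df -> is_derive x v g dg ->
  is_derive x v (fun y => f y * g y) (df * g x + f x * dg).
Proof.
move=> hf hg; have := is_deriveM hf hg.
have -> : f x *: dg + g x *: df = df * g x + f x * dg; last by [].
by rewrite -[f x *: dg]/(f x * dg) -[g x *: df]/(g x * df); ring.
Qed.

Lemma is_derive_opp f x v df : is_derive x v f df ->
  is_derive x v (fun y => - f y) (- df).
Proof. exact: is_deriveN. Qed.

Lemma is_derive_cos_comp f x v df : is_derive x v f df ->
  is_derive x v (fun y => cos (f y)) (- sin (f x) * df).
Proof. by move=> hf; apply: (is_derive_chain hf (is_derive_cos _)). Qed.

Lemma is_derive_sin_comp f x v df : is_derive x v f df ->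
  is_derive x v (fun y => sin (f y)) (cos (f x) * df).
Proof. by move=> hf; apply: (is_derive_chain hf (is_derive_sin _)). Qed.

Lemma is_derive_pow f x v df k : is_derive x v f df ->
  is_derive x v (fun y => f y ^+ k) (k%:R * f x ^+ k.-1 * df).
Proof.
move=> hf; have := is_deriveX k hf.
have -> : f ^+ k = (fun y => f y ^+ k) by apply/funext => y; rewrite exprfctE.
by [].
Qed.

Lemma is_derive_scale_fun n (f : V -> R) (g : V -> 'rV[R]_n) x v df dg :
  is_derive x v f df -> is_derive x v g dg ->
  is_derive x v (fun y => f y *: g y) (df *: g x + f x *: dg).
Proof.
move=> hf hg; apply: is_derive_mx => i j; rewrite !mxE.
have -> : (fun y => (f y *: g y) i j) = (fun y => f y * g y i j).
  by apply/funext => y; rewrite mxE.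
by apply: is_derive_mul => //; exact: is_derive_coord.
Qed.

Lemma is_derive_row_mx m n (f : V -> 'rV[R]_m) (g : V -> 'rV[R]_n) x v df dg :
  is_derive x v f df -> is_derive x v g dg ->
  is_derive x v (fun y => row_mx (f y) (g y)) (row_mx df dg).
Proof.
move=> hf hg; apply: is_derive_mx => i j; rewrite mxE.
have -> : (fun y => row_mx (f y) (g y) i j) = match fintype.split j with
    | inl k => (fun y => f y i k) | inr k => (fun y => g y i k) end.
  by apply/funext => y; rewrite mxE; case: fintype.split.
by case: fintype.split => k; exact: is_derive_coord.
Qed.

Lemma is_derive_dot n (f g : V -> 'rV[R]_n) x v df dg :
  is_derive x v f df -> is_derive x v g dg ->
  is_derive x v (fun y => dot (f y) (g y)) (dot df (g x) + dot (f x) dg).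
Proof.
move=> hf hg.
have -> : (fun y => dot (f y) (g y)) = \sum_i (fun y => f y 0 i * g y 0 i).
  by apply/funext => y; rewrite fct_sumE.
rewrite /dot -big_split /=; apply: is_derive_sum => i.
by apply: is_derive_mul; exact: is_derive_coord.
Qed.

Lemma is_derive_near (W : normedModType R) (U : set V) (f g : V -> W) x v df :
  open U -> U x -> (forall y, U y -> f y = g y) ->
  is_derive x v f df -> is_derive x v g df.
Proof.
move=> oU Ux fg; apply: near_eq_is_derive.
by apply: filterS (open_nbhs_nbhs (conj oU Ux)) => y /fg.
Qed.

End DeriveRules.

(** * Vanishing of the moment map *)

Section Parallel.
Context {R : realType} {n : nat} (M : manifold R n).
Variables (g : riemannian_metric M) (phi : M -> 'rV[R]_(n + n)) (a : R).
Hypothesis iso : isometric_immersion g phi.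
Hypothesis lag : lagrangian phi.
Hypothesis a0 : a != 0.
Hypothesis sol : imcf_homothetic_soliton g a phi.
Hypothesis inv : SO_invariant phi.
Variable e : chart R n M.
Hypothesis ae : atlas e.
Let F := phi \o cinv e.
Let imm : smooth_immersion phi := iso.1.

Lemma gram_jacobian x : cimg e x -> gram g e x = 'J F x *m ('J F x)^T.
Proof.
move=> ex; apply/matrixP => i j.
have := iso.2 e x ae ex (delta_mx 0 i) (delta_mx 0 j).
rewrite -!rowE trmx_delta -colE => h; rewrite !mxE in h *.
by rewrite -h; apply: eq_bigr => k _; rewrite !mxE.
Qed.

Let S x (i j : 'I_n) := partial (partial F j) i x.

Lemma soliton_equation x : cimg e x ->
  let D := 'J F x in
  let H := \sum_i \sum_j invmx (D *m D^T) i j *: normal_part D (S x i j) in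
  H != 0 /\ - ((dot H H)^-1 *: H) = a *: normal_part D (F x).
Proof.
move=> ex; have := sol ae ex; rewrite /mean_curvature gram_jacobian//.
Qed.

Lemma F_derive x v : cimg e x -> is_derive x v F ('D_v F x).
Proof.
by move=> ex; apply/derivableP/diff_derivable; exact: chart_differentiable.
Qed.

Lemma F_derive2 x v w : cimg e x -> is_derive x w ('D_v F) ('D_w ('D_v F) x).
Proof.
move=> ex; apply/derivableP/diff_derivable.
by have := ((chart_smooth imm 2 ae).2 v).1 x ex.
Qed.

Lemma row_jacobian x k : cimg e x -> row k ('J F x) = 'D_(delta_mx 0 k) F x.
Proof.
by move=> ex; rewrite deriveEjacobian ?rowE//; exact: chart_differentiable.
Qed.

Lemma free_jacobian x : cimg e x -> row_free ('J F x).
Proof. by move=> ex; exact: imm.2. Qed.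

(** For the generator A of the (i, j) plane, <F, J A F> is twice the minor u_i v_j - u_j v_i. Its
    vanishing comes from [soliton_moment_zero], whose second-order hypothesis is the derivative of
    omega (d_k F, A F) = 0 along d_l. *)
Lemma soliton_parallel x (i j : 'I_n) : cimg e x ->
  lsubmx (F x) 0 i * rsubmx (F x) 0 j = lsubmx (F x) 0 j * rsubmx (F x) 0 i.
Proof.
move=> ex; have [->//|ij] := eqVneq i j.
set A : 'M[R]_n := skew_mx i j; set D := 'J F x.
have lagD : D *m Jmx *m D^T = 0 by exact: chart_lag.
have kil y : cimg e y -> F y *m diag_act A *m ('J F y *m Jmx)^T = 0.
  by move=> ey; exact: killing_tangent.
have FS l k : (F x *m diag_act A *m Jmx *m (S x l k)^T) 0 0
    = (D *m diag_act A *m (D *m Jmx)^T) l k.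
  pose h y := dot ('D_(delta_mx 0 k) F y *m Jmx) (F y *m diag_act A).
  have h0 y : cimg e y -> 0 = h y.
    move=> ey; rewrite /h dotE -omegaE -row_jacobian// -mulmx_trJ_omega kil//.
    by rewrite mxE.
  have dh := is_derive_dot
    (is_derive_mulmxr Jmx (F_derive2 (delta_mx 0 k) (delta_mx 0 l) ex))
    (is_derive_mulmxr (diag_act A) (F_derive (delta_mx 0 l) ex)).
  have dh0 : is_derive x (delta_mx 0 l) h 0.
    apply: (is_derive_near (cimg_open (c := e)) ex h0); exact: is_derive_cst.
  have := is_derive_unique dh dh0; rewrite !dotE -!omegaE => E.
  rewrite omegaC.
  have -> : (D *m diag_act A *m (D *m Jmx)^T) l k
      = (row l D *m diag_act A *m (D *m Jmx)^T) 0 k.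
    by rewrite -!row_mul [RHS]mxE.
  rewrite mulmx_trJ_omega !row_jacobian//; move/eqP: E.
  by rewrite addr_eq0 => /eqP; rewrite /S /partial => ->; rewrite opprK.
have [H0 solE] := soliton_equation ex.
have := soliton_moment_zero (free_jacobian ex) lagD (kil x ex) FS a0 H0 solE.
rewrite -{1 2}(hsubmxK (F x)); set u := lsubmx _; set v := rsubmx _.
rewrite mul_row_block !mulmx0 add0r addr0 -JmulE /Jmul row_mxKl row_mxKr.
have dA (y z : 'rV[R]_n) : dot y (z *m A) = y 0 j * z 0 i - y 0 i * z 0 j.
  rewrite /A /skew_mx mulmxBr dotDr dotNr.
  have dd k l : dot y (z *m delta_mx k l) = y 0 l * z 0 k.
    rewrite /dot (bigD1 l)//= big1 => [|q ql]; rewrite mxE.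
      rewrite addr0; congr (_ * _); rewrite (bigD1 k)//= big1 => [|q qk].
        by rewrite mxE !eqxx mulr1 addr0.
      by rewrite mxE (negPf qk) mulr0.
    by rewrite big1 ?mulr0// => q' _; rewrite mxE (negPf ql) andbF mulr0.
  by rewrite !dd.
rewrite dot_row_mx dotNr !dA; lra.
Qed.

(** At a zero of the position vector the right side of the soliton equation vanishes, and with it
    H. *)
Lemma soliton_neq0 x : cimg e x -> F x != 0.
Proof.
move=> ex; have [H0 solE] := soliton_equation ex.
apply: contraNneq H0 => F0; move: solE; rewrite F0 /normal_part !mul0mx subrr.
rewrite scaler0 => /eqP; rewrite oppr_eq0 scaler_eq0 invr_eq0 dot_eq0 orbb.
by [].
Qed.

End Parallel.

(** * Polar charts *)

Section Angles.
Context {R : realType}.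

Lemma angle_exists (a b : R) : a ^+ 2 + b ^+ 2 != 0 -> exists t : R,
  a = Num.sqrt (a ^+ 2 + b ^+ 2) * cos t /\
  b = Num.sqrt (a ^+ 2 + b ^+ 2) * sin t.
Proof.
move=> n0; set r := Num.sqrt _.
have r2 : r ^+ 2 = a ^+ 2 + b ^+ 2 by rewrite sqr_sqrtr// addr_ge0// sqr_ge0.
have r0 : 0 < r by rewrite sqrtr_gt0 lt_neqAle eq_sym n0 addr_ge0// sqr_ge0.
have ar : -1 <= a / r <= 1.
  rewrite ler_pdivlMr// ler_pdivrMr// mul1r mulN1r -ler_norml.
  rewrite -(ler_pXn2r (n := 2))// ?nnegrE ?(ltW r0)// real_normK ?num_real//.
  by rewrite r2 lerDl sqr_ge0.
have sE : Num.sqrt (1 - (a / r) ^+ 2) = `|b| / r.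
  have -> : 1 - (a / r) ^+ 2 = (`|b| / r) ^+ 2.
    rewrite !expr_div_n real_normK ?num_real//.
    apply: (mulIf (x := r ^+ 2)); first by rewrite expf_neq0// gt_eqF.
    rewrite mulrBl !divfK ?expf_neq0 ?gt_eqF// mul1r r2; ring.
  by rewrite sqrtr_sqr ger0_norm// divr_ge0// ltW.
have [b0|b0] := leP 0 b.
- exists (acos (a / r)); rewrite acosK ?inE ?in_itv//= sin_acos// sE ger0_norm//.
  by split; rewrite mulrC divfK// gt_eqF.
- exists (- acos (a / r)); rewrite cosN sinN acosK ?inE ?in_itv//= sin_acos// sE.
  rewrite ltr0_norm//; split; first by rewrite mulrC divfK// gt_eqF.
  by rewrite mulNr opprK mulrC divfK// gt_eqF.
Qed.

(** [P] and [Q] are the coordinates of (f, g) in the frame turned by [sg]. In the half plane P > 0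
    the arctangent gives the angle by a formula smooth in [f] and [g]. *)
Lemma halfplane_angle (sg f g : R) :
  let P := f * cos sg + g * sin sg in let Q := g * cos sg - f * sin sg in
  0 < P ->
  f = Num.sqrt (f ^+ 2 + g ^+ 2) * cos (sg + atan (Q / P)) /\
  g = Num.sqrt (f ^+ 2 + g ^+ 2) * sin (sg + atan (Q / P)).
Proof.
move=> P Q P0; set r := Num.sqrt (f ^+ 2 + g ^+ 2).
have c2 := cos2Dsin2 sg.
have fE : f = P * cos sg - Q * sin sg.
  transitivity (f * (cos sg ^+ 2 + sin sg ^+ 2)); first by rewrite c2 mulr1.
  rewrite /P /Q; ring.
have gE : g = P * sin sg + Q * cos sg.
  transitivity (g * (cos sg ^+ 2 + sin sg ^+ 2)); first by rewrite c2 mulr1.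
  rewrite /P /Q; ring.
have PQ : f ^+ 2 + g ^+ 2 = P ^+ 2 + Q ^+ 2.
  transitivity ((P ^+ 2 + Q ^+ 2) * (cos sg ^+ 2 + sin sg ^+ 2)).
    rewrite [in LHS]fE [in LHS]gE; ring.
  by rewrite c2 mulr1.
have P2 : 0 < P ^+ 2 by rewrite exprn_gt0.
have r0 : 0 < r by rewrite sqrtr_gt0 PQ ltr_wpDr ?sqr_ge0.
have cE : cos (atan (Q / P)) = P / r.
  rewrite cos_atan; have -> : 1 + (Q / P) ^+ 2 = (r / P) ^+ 2.
    rewrite !expr_div_n sqr_sqrtr ?addr_ge0 ?sqr_ge0// PQ.
    by rewrite mulrDl divff ?gt_eqF.
  by rewrite sqrtr_sqr ger0_norm ?invf_div// divr_ge0// ltW.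
have sE : sin (atan (Q / P)) = Q / r.
  have := atanK (Q / P); rewrite /tan cE => h.
  have : sin (atan (Q / P)) = (Q / P) * (P / r).
    by rewrite -[in RHS]h divfK// mulf_neq0 ?invr_neq0 ?gt_eqF.
  by move=> ->; rewrite mulrA divfK ?gt_eqF.
rewrite cosD sinD cE sE; split.
- rewrite {1}fE; field; exact: lt0r_neq0.
- rewrite {1}gE; field; exact: lt0r_neq0.
Qed.

(** The frame of [halfplane_angle] is turned to the angle at [x]; then P > 0 at [x] and, by
    continuity, on a ball. *)
Lemma local_angle (V : normedModType R) (U : set V) (x : V) (f g : V -> R) :
  open U -> U x -> (forall k, Ck_on k U f) -> (forall k, Ck_on k U g) ->
  f x ^+ 2 + g x ^+ 2 != 0 ->
  exists (d : R) (psi : V -> R), [/\ 0 < d, ball x d `<=` U,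
    forall k, Ck_on k (ball x d) psi & forall y, ball x d y ->
      [/\ 0 < Num.sqrt (f y ^+ 2 + g y ^+ 2),
          f y = Num.sqrt (f y ^+ 2 + g y ^+ 2) * cos (psi y) &
          g y = Num.sqrt (f y ^+ 2 + g y ^+ 2) * sin (psi y)]].
Proof.
move=> oU Ux cf cg n0; have [sg [fE gE]] := angle_exists n0.
pose P y := f y * cos sg + g y * sin sg; pose Q y := g y * cos sg - f y * sin sg.
have cst (c : R) k : Ck_on k U (fun=> c) by exact: (@Ck_on_cst _ _ R).
have cP k : Ck_on k U P.
  exact: (Ck_onD oU (Ck_onM oU (cf k) (cst _ k)) (Ck_onM oU (cg k) (cst _ k))).
have cQ k : Ck_on k U Q.
  exact: (Ck_onB oU (Ck_onM oU (cg k) (cst _ k)) (Ck_onM oU (cf k) (cst _ k))).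
have Px : 0 < P x.
  have -> : P x = Num.sqrt (f x ^+ 2 + g x ^+ 2).
    rewrite /P [in X in X * _]fE [in X in _ + X * _]gE.
    set r := Num.sqrt _.
    transitivity (r * (cos sg ^+ 2 + sin sg ^+ 2)); first by ring.
    by rewrite cos2Dsin2 mulr1.
  by rewrite sqrtr_gt0 lt_neqAle eq_sym n0 addr_ge0// sqr_ge0.
have [d /= d0 Hd] : exists2 d : R, 0 < d & forall y, ball x d y -> U y /\ 0 < P y.
  have n1 : nbhs x U by exact: open_nbhs_nbhs.
  have n2 : \forall y \near x, 0 < P y.
    by have := (cP 0%N) x Ux; move/cvgr_gt => /(_ _ Px).
  have n3 : nbhs x (U `&` [set y | 0 < P y]) by exact: filterI n1 n2.
  by have /nbhs_ballP[d /= d0 Hd] := n3; exists d => // y /Hd.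
have BU : ball x d `<=` U by move=> y /Hd[].
have oB : open (ball x d) := ball_open x d.
exists d, (fun y => sg + atan (Q y / P y)); split=> //.
- move=> k; apply: (Ck_onD oB); first exact: (@Ck_on_cst _ _ R).
  apply: (Ck_on_atan oB); apply: (Ck_onM oB); first exact: Ck_on_sub (cQ k).
  apply: (Ck_onV oB); last exact: Ck_on_sub (cP k).
  by move=> y /Hd[_ /lt0r_neq0].
- move=> y /Hd[Uy Py]; have [h1 h2] := halfplane_angle Py; split=> //.
  rewrite sqrtr_gt0 lt_neqAle eq_sym addr_ge0 ?sqr_ge0// andbT.
  apply: contraTneq Py => /eqP; rewrite paddr_eq0 ?sqr_ge0// !sqrf_eq0.
  by move=> /andP[/eqP fy /eqP gy]; rewrite /P fy gy !mul0r addr0 ltxx.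
Qed.

End Angles.

(* r e^(i psi) xi is the position and e^(i (theta - (n - 1) psi)) xi a tangent
   vector; theta is the angle of the tangent of the curve (r e^(i psi))^n. *)
Record polar_data (R : realType) (n : nat) (a : R)
    (F : 'rV[R]_n -> 'rV[R]_(n + n)) (B : set 'rV[R]_n)
    (r psi theta : 'rV[R]_n -> R) (xi : 'rV[R]_n -> 'rV[R]_n) : Prop := PolarData {
  polar_r_smooth : forall k, Ck_on k B r;
  polar_psi_smooth : forall k, Ck_on k B psi;
  polar_theta_smooth : forall k, Ck_on k B theta;
  polar_xi_smooth : forall k, Ck_on k B xi;
  polar_r_gt0 : forall x, B x -> 0 < r x;
  polar_xi_unit : forall x, B x -> dot (xi x) (xi x) = 1;
  polar_eq : forall x, B x ->
    F x = row_mx ((r x * cos (psi x)) *: xi x) ((r x * sin (psi x)) *: xi x);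
  polar_tangent : forall x, B x -> exists v, v *m 'J F x =
    row_mx (cos (theta x - (n%:R - 1) * psi x) *: xi x)
           (sin (theta x - (n%:R - 1) * psi x) *: xi x);
  polar_dr : forall x v, B x -> 'D_v r x =
    a * r x * sin (theta x - n%:R * psi x) * cos (theta x - n%:R * psi x)
      * 'D_v theta x;
  polar_dpsi : forall x v, B x -> 'D_v psi x =
    a * sin (theta x - n%:R * psi x) ^+ 2 * 'D_v theta x;
  polar_dtheta : forall x, B x -> exists v, 'D_v theta x != 0
}.

Section PolarForm.
Context {R : realType} {n : nat} (F : 'rV[R]_n -> 'rV[R]_(n + n)) (U : set 'rV[R]_n).
Hypothesis oU : open U.
Hypothesis cF : forall k, Ck_on k U F.
Hypothesis Fpar : forall x i j, U x ->
  lsubmx (F x) 0 i * rsubmx (F x) 0 j = lsubmx (F x) 0 j * rsubmx (F x) 0 i.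
Hypothesis F0 : forall x, U x -> F x != 0.

(** Real and imaginary parts are parallel, so the angle psi of one nonzero complex coordinate serves
    all of them, and e^(-i psi) F / r is a real unit vector. *)
Lemma polar_form x : U x ->
  exists (d : R) (r psi : 'rV[R]_n -> R) (xi : 'rV[R]_n -> 'rV[R]_n),
  [/\ 0 < d, ball x d `<=` U,
    [/\ forall k, Ck_on k (ball x d) r, forall k, Ck_on k (ball x d) psi &
        forall k, Ck_on k (ball x d) xi] &
    forall y, ball x d y -> [/\ 0 < r y, dot (xi y) (xi y) = 1 &
      F y = row_mx ((r y * cos (psi y)) *: xi y) ((r y * sin (psi y)) *: xi y)]].
Proof.
move=> Ux; pose u i y := lsubmx (F y) 0 i; pose v i y := rsubmx (F y) 0 i.
have cu i k : Ck_on k U (u i).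
  have -> : u i = (fun y => F y 0 (lshift n i)).
    by apply/funext => y; rewrite /u mxE.
  exact: Ck_on_coord oU (cF k).
have cv i k : Ck_on k U (v i).
  have -> : v i = (fun y => F y 0 (rshift n i)).
    by apply/funext => y; rewrite /v mxE.
  exact: Ck_on_coord oU (cF k).
have FE y : F y = row_mx (\row_i u i y) (\row_i v i y).
  rewrite -[LHS]hsubmxK; congr row_mx; apply/rowP => i; rewrite mxE//.
have FF y : dot (F y) (F y) = \sum_i (u i y ^+ 2 + v i y ^+ 2).
  rewrite FE dot_row_mx /dot -big_split /=; apply: eq_bigr => i _.
  by rewrite !mxE !expr2.
have [k kn0] : exists k, u k x ^+ 2 + v k x ^+ 2 != 0.
  apply: contrapT => H; have : dot (F x) (F x) = 0.
    rewrite FF big1// => i _; apply/eqP; apply: contrapT => /negP h.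
    by apply: H; exists i.
  by move/eqP; rewrite dot_eq0 (negPf (F0 Ux)).
have [d [psi [d0 BU cpsi Hpsi]]] := local_angle oU Ux (cu k) (cv k) kn0.
have oB : open (ball x d) := ball_open x d.
pose r y := Num.sqrt (dot (F y) (F y)).
have FFp y : U y -> 0 < dot (F y) (F y).
  by move=> Uy; rewrite lt_neqAle eq_sym dot_eq0 F0//= dot_ge0.
have cr l : Ck_on l (ball x d) r.
  apply: (Ck_on_sqrt oB); first by move=> y /BU /FFp.
  apply: Ck_on_sub BU _.
  have -> : (fun y => dot (F y) (F y)) = (fun y => \sum_i (u i y * u i y + v i y * v i y)).
    by apply/funext => y; rewrite FF; apply: eq_bigr => i _; rewrite !expr2.
  apply: (Ck_on_sum _ oU) => i.
  exact: (Ck_onD oU (Ck_onM oU (cu i l) (cu i l)) (Ck_onM oU (cv i l) (cv i l))).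
pose w i y := (cos (psi y) * u i y + sin (psi y) * v i y) * (r y)^-1.
pose xi y := \row_i w i y.
have rp y : ball x d y -> 0 < r y by move=> /BU /FFp; rewrite sqrtr_gt0.
have uvE y : ball x d y ->
    forall i, u i y = r y * cos (psi y) * w i y /\ v i y = r y * sin (psi y) * w i y.
  move=> yB i; have [s0 ukE vkE] := Hpsi y yB.
  have rn : r y != 0 by rewrite gt_eqF// rp.
  have par : sin (psi y) * u i y = cos (psi y) * v i y.
    have := Fpar i k (BU _ yB); rewrite -/(u i y) -/(u k y) -/(v i y) -/(v k y).
    move: s0 ukE vkE; move: (Num.sqrt _) => s s0 -> -> h.
    apply: (mulfI (lt0r_neq0 s0)).
    transitivity (u i y * (s * sin (psi y))); first by ring.
    by rewrite h; ring.
  have c2 := cos2Dsin2 (psi y).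
  rewrite /w; split.
  - transitivity (cos (psi y) * (cos (psi y) * u i y + sin (psi y) * v i y)).
      transitivity (u i y * (cos (psi y) ^+ 2 + sin (psi y) ^+ 2)).
        by rewrite c2 mulr1.
      have -> : cos (psi y) * (cos (psi y) * u i y + sin (psi y) * v i y)
        = cos (psi y) ^+ 2 * u i y + sin (psi y) * (cos (psi y) * v i y) by ring.
      rewrite -par; ring.
    by field.
  - transitivity (sin (psi y) * (cos (psi y) * u i y + sin (psi y) * v i y)).
      transitivity (v i y * (cos (psi y) ^+ 2 + sin (psi y) ^+ 2)).
        by rewrite c2 mulr1.
      have -> : sin (psi y) * (cos (psi y) * u i y + sin (psi y) * v i y)
        = cos (psi y) * (sin (psi y) * u i y) + sin (psi y) ^+ 2 * v i y by ring.
      rewrite par; ring.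
    by field.
exists d, r, psi, xi; split=> //.
- split=> // l; apply: (Ck_on_mx oB) => i j.
  have -> : (fun y => xi y i j) = w j by apply/funext => y; rewrite mxE.
  have [cc cs] := Ck_on_cos_sin oB (cpsi l).
  have cu' := Ck_on_sub BU (cu j l); have cv' := Ck_on_sub BU (cv j l).
  apply: (Ck_onM oB (Ck_onD oB (Ck_onM oB cc cu') (Ck_onM oB cs cv'))).
  by apply: (Ck_onV oB) => // y /rp /lt0r_neq0.
- move=> y yB; have E := uvE y yB.
  have FE' : F y = row_mx ((r y * cos (psi y)) *: xi y) ((r y * sin (psi y)) *: xi y).
    rewrite FE; congr row_mx; apply/rowP => i; rewrite !mxE.
      exact: (E i).1.
    exact: (E i).2.
  split=> //; first exact: rp.
  have r2 : r y ^+ 2 = dot (F y) (F y) by rewrite sqr_sqrtr// ltW// FFp//; exact: BU.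
  move: r2; rewrite {1 2}FE' dot_row_mx !(dotZl, dotZr) => r2.
  apply: (mulfI (x := r y ^+ 2)); first by rewrite expf_neq0// gt_eqF// rp.
  rewrite mulr1 [RHS]r2.
  transitivity (r y ^+ 2 * dot (xi y) (xi y) * (cos (psi y) ^+ 2 + sin (psi y) ^+ 2)).
    by rewrite cos2Dsin2 mulr1.
  ring.
Qed.

End PolarForm.

Lemma Ck_on_partial (R : realType) (V W : normedModType R) k (U : set V)
    (f : V -> W) v : Ck_on k.+1 U f -> Ck_on k U ('D_v f).
Proof. by move=> [_]; apply. Qed.

Section FrameAlgebra.
Context {R : realType} {n : nat}.
Implicit Types xi xv xw xvw : 'rV[R]_n.

Lemma frame_omega xi xv xw (A B A' B' p q : R) :
  dot xi xi = 1 -> dot xv xi = 0 -> dot xw xi = 0 ->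
  omega (row_mx (A *: xi + p *: xv) (B *: xi + q *: xv))
        (row_mx (A' *: xi + p *: xw) (B' *: xi + q *: xw)) = A * B' - B * A'.
Proof.
move=> x1 v0 w0; rewrite omega_row_mx !(dotDl, dotDr, dotZl, dotZr).
by rewrite !(dotC xi) x1 v0 w0; ring.
Qed.

Lemma frame_cos_part xi xv xw xvw (mu c s h mv mw p : R) :
  (mu * c + mv * (- s * h)) *: xi + (mv * c) *: xw
    + ((mw * c) *: xv + p *: xvw)
  = (mu * c - h * mv * s) *: xi + (c * mv) *: xw + (c * mw) *: xv + p *: xvw.
Proof. by apply/rowP => l; rewrite !mxE; ring. Qed.

Lemma frame_sin_part xi xv xw xvw (mu c s h mv mw p : R) :
  (mu * s + mv * (c * h)) *: xi + (mv * s) *: xw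
    + ((mw * s) *: xv + p *: xvw)
  = (mu * s + h * mv * c) *: xi + (s * mv) *: xw + (s * mw) *: xv + p *: xvw.
Proof. by apply/rowP => l; rewrite !mxE; ring. Qed.

End FrameAlgebra.

Section PolarChart.
Context {R : realType} {n : nat} (a : R).
Variables (F : 'rV[R]_n -> 'rV[R]_(n + n)) (U : set 'rV[R]_n).
Hypothesis oU : open U.
Hypothesis cF : forall k, Ck_on k U F.
Hypothesis freeF : forall x, U x -> row_free ('J F x).
Hypothesis lagF : forall x, U x -> 'J F x *m Jmx *m ('J F x)^T = 0.
Hypothesis Fpar : forall x i j, U x ->
  lsubmx (F x) 0 i * rsubmx (F x) 0 j = lsubmx (F x) 0 j * rsubmx (F x) 0 i.
Hypothesis F0 : forall x, U x -> F x != 0.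
Hypothesis Fsol : forall x, U x ->
  let D := 'J F x in
  let H := \sum_i \sum_j invmx (D *m D^T) i j
             *: normal_part D (partial (partial F j) i x) in
  H != 0 /\ - ((dot H H)^-1 *: H) = a *: normal_part D (F x).

Lemma derive_basis (W : normedModType R) (f : 'rV[R]_n -> W) x v :
  differentiable f x -> 'D_v f x = \sum_k v 0 k *: 'D_(delta_mx 0 k) f x.
Proof.
move=> df; rewrite deriveE// {1}(row_sum_delta v) linear_sum.
by apply: eq_bigr => k _; rewrite linearZ /= -deriveE.
Qed.

Lemma partial_sym x i j : U x ->
  partial (partial F j) i x = partial (partial F i) j x.
Proof.
move=> Ux; apply/rowP => l; pose f y := F y 0 l.
have cf : Ck_on 2 U f by exact: Ck_on_coord oU (cF 2).
have E (k k' : 'I_n) : ('D_(delta_mx 0 k') ('D_(delta_mx 0 k) F) x) 0 l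
    = 'D_(delta_mx 0 k') ('D_(delta_mx 0 k) f) x.
  have h1 := is_derive_coord 0 l
    (Ck_on_derive (delta_mx 0 k') Ux (Ck_on_partial (delta_mx 0 k) (cF 2))).
  have h2 := Ck_on_derive (delta_mx 0 k') Ux (Ck_on_partial (delta_mx 0 k) cf).
  apply: (is_derive_unique (is_derive_near oU Ux _ h1) h2) => y Uy.
  have h3 := is_derive_coord 0 l (Ck_on_derive (delta_mx 0 k) Uy (cF 1)).
  have cf1 : Ck_on 1 U f by exact: Ck_on_coord oU (cF 1).
  exact: is_derive_unique h3 (Ck_on_derive (delta_mx 0 k) Uy cf1).
exact: etrans (E j i) (etrans (derive_swap _ _ oU Ux cf) (esym (E i j))).
Qed.


(** The Lagrangian condition says that dr and r dpsi are proportional covectors, so (dr, r dpsi) = m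
    (cos om, sin om) with [om] the angle from position to tangent. [soliton_polar] then determines m
    as a multiple of dtheta. *)
Lemma polar_chart x : a != 0 -> U x ->
  exists (d : R) r psi theta xi, [/\ 0 < d, ball x d `<=` U &
    polar_data a F (ball x d) r psi theta xi].
Proof.
move=> a0 Ux.
have [d1 [r [psi [xi [d10 BU1 [cr1 cpsi1 cxi1] H1]]]]] :=
  polar_form oU cF Fpar F0 Ux.
have oB1 : open (ball x d1) := ball_open x d1.
have dr1 y v (yB : ball x d1 y) := Ck_on_derive v yB (cr1 1).
have dpsi1 y v (yB : ball x d1 y) := Ck_on_derive v yB (cpsi1 1).
have dxi1 y v (yB : ball x d1 y) := Ck_on_derive v yB (cxi1 1).
have dF y v (yB : ball x d1 y) := Ck_on_derive v (BU1 _ yB) (cF 1).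
have xixi y v : ball x d1 y -> dot ('D_v xi y) (xi y) = 0.
  move=> yB; have h0 := is_derive_dot (dxi1 y v yB) (dxi1 y v yB).
  have h1 : is_derive y v (fun z => dot (xi z) (xi z)) 0.
    apply: (@is_derive_near _ _ R _ (fun=> 1) _ _ _ _ oB1 yB).
    by move=> z /H1[].
  have := is_derive_unique h0 h1; rewrite [X in _ + X]dotC; lra.
pose p y := r y * cos (psi y); pose q y := r y * sin (psi y).
have dp y v (yB : ball x d1 y) :=
  is_derive_mul (dr1 y v yB) (is_derive_cos_comp (dpsi1 y v yB)).
have dq y v (yB : ball x d1 y) :=
  is_derive_mul (dr1 y v yB) (is_derive_sin_comp (dpsi1 y v yB)).
have dF1 y v : ball x d1 y -> 'D_v F y = row_mx
   (('D_v r y * cos (psi y) - r y * 'D_v psi y * sin (psi y)) *: xi y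
       + p y *: 'D_v xi y)
   (('D_v r y * sin (psi y) + r y * 'D_v psi y * cos (psi y)) *: xi y
       + q y *: 'D_v xi y).
  move=> yB; have h := is_derive_row_mx
    (is_derive_scale_fun (dp y v yB) (dxi1 y v yB))
    (is_derive_scale_fun (dq y v yB) (dxi1 y v yB)).
  have h' : is_derive y v F _ := is_derive_near oB1 yB _ h.
  rewrite (is_derive_unique (dF y v yB) (h' _)); last first.
    by move=> z /H1[_ _ ->].
  by congr row_mx; congr (_ *: _ + _); ring.
have lag1 y v w : ball x d1 y ->
    'D_v r y * (r y * 'D_w psi y) = r y * 'D_v psi y * 'D_w r y.
  move=> yB; have [r0 x1 _] := H1 y yB.
  have : omega ('D_v F y) ('D_w F y) = 0.
    have dFy : differentiable F y by exact: (cF 1).1 (BU1 _ yB).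
    rewrite !deriveEjacobian// omegaE trmx_mul !mulmxA -(mulmxA v) -(mulmxA v).
    by rewrite lagF ?mulmx0 ?mul0mx ?mxE//; exact: BU1.
  rewrite !dF1// (frame_omega _ _ _ _ _ _ x1 (xixi y v yB) (xixi y w yB)).
  move: (cos2Dsin2 (psi y)).
  move: (cos (psi y)) (sin (psi y)) ('D_v r y) ('D_w r y) ('D_v psi y) ('D_w psi y).
  move: (r y) => b c s A B C E c2 h.
  apply/eqP; rewrite -subr_eq0; apply/eqP.
  transitivity ((A * (b * E) - b * C * B) * (c ^+ 2 + s ^+ 2)).
    by rewrite c2 mulr1.
  by rewrite -[RHS]h; ring.
have rowJ y k : ball x d1 y -> row k ('J F y) = 'D_(delta_mx 0 k) F y.
  move=> yB; have dFy : differentiable F y by exact: (cF 1).1 (BU1 _ yB).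
  by rewrite deriveEjacobian// rowE.
have rowX y k : ball x d1 y -> row k ('J xi y) = 'D_(delta_mx 0 k) xi y.
  move=> yB; have dxiy : differentiable xi y by exact: (cxi1 1).1 yB.
  by rewrite deriveEjacobian// rowE.
have Xxi y k : ball x d1 y -> dot (row k ('J xi y)) (xi y) = 0.
  by move=> yB; rewrite rowX// xixi.
have xB1 : ball x d1 x by exact: ballxx.
(* If dr and dpsi both vanished, the frame would hold with m = 0 (and any unit c + i s, here 1),
   against [radial_vector]. *)
have [j jn0] : exists j : 'I_n, ('D_(delta_mx 0 j) r x) ^+ 2
    + (r x * 'D_(delta_mx 0 j) psi x) ^+ 2 != 0.
  apply: contrapT => N; have [_ x1 _] := H1 x xB1.
  have z k : 'D_(delta_mx 0 k) r x = 0 /\ r x * 'D_(delta_mx 0 k) psi x = 0.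
    have : ('D_(delta_mx 0 k) r x) ^+ 2 + (r x * 'D_(delta_mx 0 k) psi x) ^+ 2 == 0.
      by apply: contrapT => /negP h; apply: N; exists k.
    by rewrite paddr_eq0 ?sqr_ge0// !sqrf_eq0 => /andP[/eqP ? /eqP ?].
  have DE0 k : row k ('J F x) = row_mx
      (((0 : 'rV[R]_n) 0 k * 1) *: xi x + p x *: row k ('J xi x))
      (((0 : 'rV[R]_n) 0 k * 0) *: xi x + q x *: row k ('J xi x)).
    have [z1 z2] := z k; rewrite rowJ// dF1// z1 z2 rowX// !mul0r !mulr0.
    by rewrite addr0 subrr !mxE mul0r.
  have cs0 : (1 : R) ^+ 2 + 0 ^+ 2 = 1 by rewrite expr0n expr1n addr0.
  have [v _] := radial_vector (freeF Ux) x1 (fun k => Xxi x k xB1) DE0.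
  by rewrite dot0l => /eqP; rewrite eq_sym oner_eq0.
pose fj y := 'D_(delta_mx 0 j) r y; pose gj y := r y * 'D_(delta_mx 0 j) psi y.
have cfj k : Ck_on k (ball x d1) fj by exact: Ck_on_partial (cr1 k.+1).
have cgj k : Ck_on k (ball x d1) gj.
  exact: (Ck_onM oB1 (cr1 k) (Ck_on_partial _ (cpsi1 k.+1))).
have [d [om [d0 BB1 com Hom]]] := local_angle oB1 xB1 cfj cgj jn0.
have oB : open (ball x d) := ball_open x d.
pose m v y := 'D_v r y * cos (om y) + r y * 'D_v psi y * sin (om y).
have rank1 y v : ball x d y ->
    'D_v r y = m v y * cos (om y) /\ r y * 'D_v psi y = m v y * sin (om y).
  move=> yB; have [s0 fE gE] := Hom y yB; have c2 := cos2Dsin2 (om y).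
  have := lag1 y (delta_mx 0 j) v (BB1 _ yB); rewrite -/(fj y) -/(gj y).
  move: s0 fE gE; move: (Num.sqrt _) => s s0 -> -> h.
  have {}h : cos (om y) * (r y * 'D_v psi y) = sin (om y) * 'D_v r y.
    by apply: (mulfI (lt0r_neq0 s0)); rewrite !mulrA in h *.
  split.
  - transitivity ('D_v r y * (cos (om y) ^+ 2 + sin (om y) ^+ 2)).
      by rewrite c2 mulr1.
    transitivity ('D_v r y * cos (om y) ^+ 2
      + (cos (om y) * (r y * 'D_v psi y)) * sin (om y)); last by rewrite /m; ring.
    by rewrite h; ring.
  - transitivity (r y * 'D_v psi y * (cos (om y) ^+ 2 + sin (om y) ^+ 2)).
      by rewrite c2 mulr1.
    transitivity ((sin (om y) * 'D_v r y) * cos (om y)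
      + r y * 'D_v psi y * sin (om y) ^+ 2); last by rewrite /m; ring.
    by rewrite -h; ring.
(* [eta] is the tangent angle of the curve r e^(i psi). Its n-th power has derivative n (r e^(i
   psi))^(n - 1) times that of the curve, which adds (n - 1) psi. *)
pose theta y := om y + n%:R * psi y; pose eta y := om y + psi y.
have dom y v (yB : ball x d y) := Ck_on_derive v yB (com 1).
have cpsi k : Ck_on k (ball x d) psi by exact: Ck_on_sub BB1 (cpsi1 k).
have cr k : Ck_on k (ball x d) r by exact: Ck_on_sub BB1 (cr1 k).
have cxi k : Ck_on k (ball x d) xi by exact: Ck_on_sub BB1 (cxi1 k).
have deta y v (yB : ball x d y) :
    is_derive y v eta ('D_v om y + 'D_v psi y).
  exact: is_derive_add (dom y v yB) (dpsi1 y v (BB1 _ yB)).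
have dtheta y v (yB : ball x d y) :
    is_derive y v theta ('D_v om y + n%:R * 'D_v psi y).
  have h := is_derive_mul (is_derive_cst (n%:R : R) y v) (dpsi1 y v (BB1 _ yB)).
  by have := is_derive_add (dom y v yB) h; rewrite mul0r add0r.
have cm v k : Ck_on k (ball x d) (m v).
  have [cc cs] := Ck_on_cos_sin oB (com k).
  exact: (Ck_onD oB (Ck_onM oB (Ck_on_partial v (cr k.+1)) cc)
    (Ck_onM oB (Ck_onM oB (cr k) (Ck_on_partial v (cpsi k.+1))) cs)).
have dF2 y v : ball x d y -> 'D_v F y = row_mx
   ((m v y * cos (eta y)) *: xi y + p y *: 'D_v xi y)
   ((m v y * sin (eta y)) *: xi y + q y *: 'D_v xi y).
  move=> yB; rewrite (dF1 y v (BB1 _ yB)).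
  have [-> ->] := rank1 y v yB; rewrite /eta cosD sinD.
  by congr row_mx; congr (_ *: _ + _); ring.
have dp2 y v : ball x d y -> is_derive y v p (m v y * cos (eta y)).
  move=> yB; have h := dp y v (BB1 _ yB).
  have <- : 'D_v r y * cos (psi y) + r y * (- sin (psi y) * 'D_v psi y)
     = m v y * cos (eta y); last exact: h.
  have [E1 E2] := rank1 y v yB.
  transitivity ('D_v r y * cos (psi y) - (r y * 'D_v psi y) * sin (psi y)).
    by ring.
  by rewrite E1 E2 /eta cosD; ring.
have dq2 y v : ball x d y -> is_derive y v q (m v y * sin (eta y)).
  move=> yB; have h := dq y v (BB1 _ yB).
  have <- : 'D_v r y * sin (psi y) + r y * (cos (psi y) * 'D_v psi y)
     = m v y * sin (eta y); last exact: h.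
  have [E1 E2] := rank1 y v yB.
  transitivity ('D_v r y * sin (psi y) + (r y * 'D_v psi y) * cos (psi y)).
    by ring.
  by rewrite E1 E2 /eta sinD; ring.
have d2F y v w : ball x d y -> 'D_w ('D_v F) y = row_mx
   (('D_w (m v) y * cos (eta y)
       - ('D_w om y + 'D_w psi y) * m v y * sin (eta y)) *: xi y
     + (cos (eta y) * m v y) *: 'D_w xi y + (cos (eta y) * m w y) *: 'D_v xi y
     + p y *: 'D_w ('D_v xi) y)
   (('D_w (m v) y * sin (eta y)
       + ('D_w om y + 'D_w psi y) * m v y * cos (eta y)) *: xi y
     + (sin (eta y) * m v y) *: 'D_w xi y + (sin (eta y) * m w y) *: 'D_v xi y
     + q y *: 'D_w ('D_v xi) y).
  move=> yB; have dm := Ck_on_derive w yB (cm v 1).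
  have dxiy := Ck_on_derive w yB (cxi 1).
  have dxi2 := Ck_on_derive w yB (Ck_on_partial v (cxi 2)).
  have hc := is_derive_scale_fun
    (is_derive_mul dm (is_derive_cos_comp (deta y w yB))) dxiy.
  have hs := is_derive_scale_fun
    (is_derive_mul dm (is_derive_sin_comp (deta y w yB))) dxiy.
  have hp := is_derive_scale_fun (dp2 y w yB) dxi2.
  have hq := is_derive_scale_fun (dq2 y w yB) dxi2.
  have h := is_derive_row_mx (is_deriveD hc hp) (is_deriveD hs hq).
  have h' := is_derive_near oB yB _ h.
  have h2 := Ck_on_derive w (BU1 _ (BB1 _ yB)) (Ck_on_partial v (cF 2)).
  rewrite (is_derive_unique h2 (h' _ _)); last first.
    by move=> z zB; rewrite dF2.
  by congr row_mx; [exact: frame_cos_part|exact: frame_sin_part].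
have key y k : ball x d y -> m (delta_mx 0 k) y
    = a * (r y * sin (om y)) * 'D_(delta_mx 0 k) theta y.
  move=> yB; have yB1 := BB1 _ yB; have Uy := BU1 _ yB1.
  have [r0 x1 Fy] := H1 y yB1.
  pose mrow := \row_k m (delta_mx 0 k) y.
  pose erow := \row_k ('D_(delta_mx 0 k) om y + 'D_(delta_mx 0 k) psi y).
  have DE l : row l ('J F y) = row_mx
      ((mrow 0 l * cos (eta y)) *: xi y + p y *: row l ('J xi y))
      ((mrow 0 l * sin (eta y)) *: xi y + q y *: row l ('J xi y)).
    by rewrite rowJ// dF2// rowX// mxE.
  have Xi2xi i l : dot ('D_(delta_mx 0 i) ('D_(delta_mx 0 l) xi) y) (xi y)
      = - dot (row i ('J xi y)) (row l ('J xi y)).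
    have h := is_derive_dot
      (Ck_on_derive (delta_mx 0 i) yB (Ck_on_partial (delta_mx 0 l) (cxi 2)))
      (dxi1 y (delta_mx 0 i) yB1).
    have h0 : is_derive y (delta_mx 0 i)
        (fun z => dot ('D_(delta_mx 0 l) xi z) (xi z)) 0.
      apply: (@is_derive_near _ _ R _ (fun=> 0) _ _ _ _ oB yB).
      by move=> z zB; rewrite xixi//; exact: BB1.
    have := is_derive_unique h h0; rewrite !rowX// [X in _ + X]dotC => /eqP.
    by rewrite addr_eq0 => /eqP.
  have SE i l : partial (partial F l) i y = row_mx
     (('D_(delta_mx 0 i) (m (delta_mx 0 l)) y * cos (eta y)
        - erow 0 i * mrow 0 l * sin (eta y)) *: xi y
      + (cos (eta y) * mrow 0 l) *: row i ('J xi y)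
      + (cos (eta y) * mrow 0 i) *: row l ('J xi y)
      + p y *: 'D_(delta_mx 0 i) ('D_(delta_mx 0 l) xi) y)
     (('D_(delta_mx 0 i) (m (delta_mx 0 l)) y * sin (eta y)
        + erow 0 i * mrow 0 l * cos (eta y)) *: xi y
      + (sin (eta y) * mrow 0 l) *: row i ('J xi y)
      + (sin (eta y) * mrow 0 i) *: row l ('J xi y)
      + q y *: 'D_(delta_mx 0 i) ('D_(delta_mx 0 l) xi) y).
    by rewrite !mxE !rowX// -d2F.
  have [Hn0 sol] := Fsol Uy.
  have pq : p y ^+ 2 + q y ^+ 2 = r y ^+ 2.
    transitivity (r y ^+ 2 * (cos (psi y) ^+ 2 + sin (psi y) ^+ 2)).
      by rewrite /p /q; ring.
    by rewrite cos2Dsin2 mulr1.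
  have pq0 : 0 < p y ^+ 2 + q y ^+ 2 by rewrite pq exprn_gt0.
  rewrite Fy in sol.
  have SP := @soliton_polar R n ('J F y) ('J xi y) (xi y) mrow erow (cos (eta y))
    (sin (eta y)) (p y) (q y) (freeF Uy) (lagF Uy) x1 (fun i => Xxi y i yB1)
    (cos2Dsin2 (eta y)) DE
    (fun i l => 'D_(delta_mx 0 i) ('D_(delta_mx 0 l) xi) y)
    (fun i l => 'D_(delta_mx 0 i) (m (delta_mx 0 l)) y)
    (fun i l => partial (partial F l) i y) Xi2xi SE
    (fun i l => partial_sym i l Uy) a pq0 Hn0 sol k.
  have [_ E2] := rank1 y (delta_mx 0 k) yB.
  have sg : sin (eta y) * p y - cos (eta y) * q y = r y * sin (om y).
    have -> : om y = eta y - psi y by rewrite /eta addrK.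
    by rewrite sinB /p /q; ring.
  case: (dtheta y (delta_mx 0 k) yB) => _ ->.
  transitivity (mrow 0 k); first by rewrite mxE.
  (* As m sin om = r dpsi, the term with sigma / r^2 is (n - 1) dpsi, and deta + (n - 1) dpsi =
     dtheta. *)
  rewrite [LHS]SP sg pq !mxE; congr (_ * _).
  have rn : r y != 0 by rewrite gt_eqF.
  have -> : r y * sin (om y) / r y ^+ 2 * (n%:R - 1) * m (delta_mx 0 k) y
      = (m (delta_mx 0 k) y * sin (om y)) / r y * (n%:R - 1) by field.
  by rewrite -E2; field.
have omE y : om y = theta y - n%:R * psi y by rewrite /theta addrK.
have etaE y : eta y = theta y - (n%:R - 1) * psi y by rewrite /eta /theta; ring.
have mlin y v : ball x d y ->
    m v y = a * (r y * sin (om y)) * 'D_v theta y.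
  move=> yB; have yB1 := BB1 _ yB.
  have diff (f : 'rV[R]_n -> R) : Ck_on 1 (ball x d) f -> differentiable f y.
    by move=> cf; exact: cf.1 yB.
  have cth : Ck_on 1 (ball x d) theta.
    apply: (Ck_onD oB (com 1) (Ck_onM oB _ (cpsi 1))).
    exact: (@Ck_on_cst _ _ R).
  rewrite /m (derive_basis v (diff _ (cr 1))) (derive_basis v (diff _ (cpsi 1))).
  rewrite (derive_basis v (diff _ cth)) mulr_suml !mulr_sumr mulr_suml -big_split /=.
  apply: eq_bigr => k _.
  transitivity (v 0 k * m (delta_mx 0 k) y).
    rewrite /m -[_ *: 'D_(delta_mx 0 k) r y]/(_ * _).
    by rewrite -[_ *: 'D_(delta_mx 0 k) psi y]/(_ * _); ring.
  by rewrite key// -[_ *: 'D_(delta_mx 0 k) theta y]/(_ * _); ring.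
have radial y : ball x d y -> exists2 v, v *m 'J xi y = 0 &
    dot (\row_k m (delta_mx 0 k) y) v = 1 /\ v *m 'J F y =
      row_mx (cos (eta y) *: xi y) (sin (eta y) *: xi y).
  move=> yB; have yB1 := BB1 _ yB; have Uy := BU1 _ yB1.
  have [_ x1 _] := H1 y yB1.
  have DE l : row l ('J F y) = row_mx
      (((\row_k m (delta_mx 0 k) y) 0 l * cos (eta y)) *: xi y
        + p y *: row l ('J xi y))
      (((\row_k m (delta_mx 0 k) y) 0 l * sin (eta y)) *: xi y
        + q y *: row l ('J xi y)).
    by rewrite rowJ// dF2// rowX// mxE.
  have [v vX mv] := radial_vector (freeF Uy) x1 (fun i => Xxi y i yB1) DE.
  exists v => //; split=> //; rewrite (mulmx_frame DE) mv vX.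
  by rewrite !scaler0 !addr0 !mul1r.
exists d, r, psi, theta, xi; split=> //; first exact: subset_trans BB1 BU1.
split=> //.
- move=> k; apply: (Ck_onD oB (com k) (Ck_onM oB _ (cpsi k))).
  exact: (@Ck_on_cst _ _ R).
- by move=> y /BB1 /H1[].
- by move=> y /BB1 /H1[].
- by move=> y /BB1 /H1[].
- by move=> y /radial[v _ [_ vE]]; exists v; rewrite -etaE.
- move=> y v yB; rewrite -omE; have [-> _] := rank1 y v yB.
  by rewrite mlin//; ring.
- move=> y v yB; rewrite -omE; have [_ E2] := rank1 y v yB.
  have [r0 _ _] := H1 y (BB1 _ yB).
  apply: (mulfI (lt0r_neq0 r0)); rewrite E2 mlin//; ring.
(* m is a multiple of dtheta and takes the value 1 on the radial vector, so dtheta cannot vanish. *)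
- move=> y yB; apply: contrapT => N; have [v _ [mv _]] := radial y yB.
  move/eqP: mv; rewrite /dot big1 => [|k _]; first by rewrite eq_sym oner_eq0.
  rewrite mxE mlin//.
  have -> : 'D_(delta_mx 0 k) theta y = 0.
    by apply: contrapT => /eqP h; apply: N; exists (delta_mx 0 k).
  by rewrite mulr0 mul0r.
Qed.

End PolarChart.

(** * The model curve and its first integrals *)

Section Vartheta.
Context {R : realType}.

Lemma is_derive_lin (k t : R) : is_derive t (1 : R) (fun s : R => k * s) k.
Proof.
have := is_derive_mul (is_derive_cst k t (1 : R)) (is_derive_id t (1 : R)).
by rewrite mul0r add0r mulr1.
Qed.

Lemma is_derive_expR_comp (k t : R) :
  is_derive t (1 : R) (fun s : R => expR (k * s)) (k * expR (k * t)).
Proof.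
have := is_derive_chain (is_derive_lin k t) (is_derive_expR (k * t)).
by rewrite mulrC.
Qed.

Lemma is_derive_cstM (c : R) (f : R -> R) (t df : R) : is_derive t (1 : R) f df ->
  is_derive t (1 : R) (fun s => c * f s) (c * df).
Proof.
by move=> h; have := is_derive_mul (is_derive_cst c t (1 : R)) h; rewrite mul0r add0r.
Qed.

Lemma is_derive_coshM (k t : R) :
  is_derive t (1 : R) (fun s : R => cosh (k * s)) (k * sinh (k * t)).
Proof.
have h := is_derive_cstM 2^-1
  (is_derive_add (is_derive_expR_comp k t) (is_derive_expR_comp (- k) t)).
have -> : (fun s : R => cosh (k * s))
    = (fun s => 2^-1 * (expR (k * s) + expR (- k * s))).
  by apply/funext => s; rewrite /cosh (mulNr k s) mulrC.
have -> : k * sinh (k * t) = 2^-1 * (k * expR (k * t) + - k * expR (- k * t)).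
  by rewrite /sinh (mulNr k t); ring.
exact: h.
Qed.

Lemma is_derive_sinhM (k t : R) :
  is_derive t (1 : R) (fun s : R => sinh (k * s)) (k * cosh (k * t)).
Proof.
have h := is_derive_cstM 2^-1 (is_derive_add (is_derive_expR_comp k t)
  (is_derive_opp (is_derive_expR_comp (- k) t))).
have -> : (fun s : R => sinh (k * s))
    = (fun s => 2^-1 * (expR (k * s) + - expR (- k * s))).
  by apply/funext => s; rewrite /sinh (mulNr k s) mulrC.
have -> : k * cosh (k * t) = 2^-1 * (k * expR (k * t) + - (- k * expR (- k * t))).
  by rewrite /cosh (mulNr k t); ring.
exact: h.
Qed.

(* Fundamental system of h'' = -(1 - n a) h. The last field keeps the curve
   (-h', h) in a half plane rotating continuously with t, which makes a global
   continuous argument explicit. *)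
Record fundamental_system (n : nat) (a : R) (C S dC dS : R -> R) (W : R) : Prop :=
  FundamentalSystem {
  vartheta_lin : forall c1 c2 t, vartheta n a c1 c2 t = c1 * C t + c2 * S t;
  fund_dC : forall t, is_derive t (1 : R) C (dC t);
  fund_dS : forall t, is_derive t (1 : R) S (dS t);
  fund_ddC : forall t, is_derive t (1 : R) dC (- (1 - n%:R * a) * C t);
  fund_ddS : forall t, is_derive t (1 : R) dS (- (1 - n%:R * a) * S t);
  fund_W0 : W != 0;
  fund_wronskian : forall t, C t * dS t - dC t * S t = W;
  fund_halfplane : forall c1 c2, c1 ^+ 2 + c2 ^+ 2 != 0 ->
    exists2 sg : R -> R, continuous sg & forall t,
      0 < - (c1 * dC t + c2 * dS t) * cos (sg t) + (c1 * C t + c2 * S t) * sin (sg t)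
}.

Lemma halfplane_of_constant (z1 z2 : R -> R) (d1 d2 : R) :
  (forall t, 0 < z1 t * d1 + z2 t * d2) ->
  exists2 sg : R -> R, continuous sg & forall t,
    0 < z1 t * cos (sg t) + z2 t * sin (sg t).
Proof.
move=> H; have n0 : d1 ^+ 2 + d2 ^+ 2 != 0.
  apply: contraTneq (H 0) => /eqP; rewrite paddr_eq0 ?sqr_ge0// !sqrf_eq0.
  by move=> /andP[/eqP-> /eqP->]; rewrite !mulr0 addr0 ltxx.
have [s [E1 E2]] := angle_exists n0.
exists (fun=> s); first by move=> t; exact: cst_continuous.
move=> t; have r0 := sqrtr_ge0 (d1 ^+ 2 + d2 ^+ 2).
move: E1 E2 r0; move: (Num.sqrt _) => r E1 E2 r0.
have := H t; rewrite E1 E2.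
have -> : z1 t * (r * cos s) + z2 t * (r * sin s)
    = r * (z1 t * cos s + z2 t * sin s) by ring.
move=> h; rewrite -(pmulr_rgt0 (x := r))// lt_neqAle r0 andbT eq_sym.
by apply: contraTneq h => ->; rewrite mul0r ltxx.
Qed.

Lemma fundamental_system_exists (n : nat) (a : R) : (0 < n)%N ->
  exists C S dC dS W, fundamental_system n a C S dC dS W.
Proof.
move=> n0; have N0 : 0 < n%:R :> R by rewrite ltr0n.
have aE : (a < n%:R^-1) = (0 < 1 - n%:R * a).
  by rewrite subr_gt0 -ltr_pdivlMl// mulr1.
have [an|an|an] := ltgtP a (n%:R^-1).
- have k2 : 0 < 1 - n%:R * a by rewrite -aE.
  pose k := Num.sqrt (1 - n%:R * a).
  have k0 : 0 < k by rewrite sqrtr_gt0.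
  have kk : k ^+ 2 = 1 - n%:R * a by rewrite sqr_sqrtr// ltW.
  exists (fun t => cos (k * t)), (fun t => sin (k * t)),
    (fun t => - k * sin (k * t)), (fun t => k * cos (k * t)), k.
  split.
  + by move=> c1 c2 t; rewrite /vartheta an.
  + move=> t; have := is_derive_cos_comp (is_derive_lin k t).
    by have -> : - sin (k * t) * k = - k * sin (k * t) by ring.
  + by move=> t; have := is_derive_sin_comp (is_derive_lin k t); rewrite mulrC.
  + move=> t; have := is_derive_cstM (- k) (is_derive_sin_comp (is_derive_lin k t)).
    rewrite -kk; have -> : - k * (cos (k * t) * k) = - k ^+ 2 * cos (k * t) by ring.
    by [].
  + move=> t; have := is_derive_cstM k (is_derive_cos_comp (is_derive_lin k t)).
    rewrite -kk; have -> : k * (- sin (k * t) * k) = - k ^+ 2 * sin (k * t) by ring.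
    by [].
  + by rewrite gt_eqF.
  + move=> t; transitivity (k * (cos (k * t) ^+ 2 + sin (k * t) ^+ 2)); first by ring.
    by rewrite cos2Dsin2 mulr1.
  + move=> c1 c2 c0; have [d [E1 E2]] := angle_exists c0.
    (* With (c1, c2) = r (cos d, sin d) and u = k t - d, the curve (-h', h) is r (k sin u, cos u).
       Pairing it with (sin u, cos u) gives r (k (sin u)^2 + (cos u)^2) > 0. *)
    exists (fun t => pi / 2 - (k * t - d)).
      move=> t; apply: differentiable_continuous; apply/derivable1_diffP.
      have h := is_derive_add (is_derive_cst (pi / 2 : R) t (1 : R))
        (is_derive_opp (is_derive_add (is_derive_lin k t)
          (is_derive_cst (- d) t (1 : R)))).
      by case: h.
    move=> t; rewrite (cosB (pi / 2)) (sinB (pi / 2)) cos_pihalf sin_pihalf.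
    rewrite !mul0r !mul1r add0r subr0.
    have r0 : 0 < Num.sqrt (c1 ^+ 2 + c2 ^+ 2).
      by rewrite sqrtr_gt0 lt_neqAle eq_sym c0 addr_ge0// sqr_ge0.
    move: E1 E2 r0; move: (Num.sqrt _) => r E1 E2 r0.
    rewrite cosB sinB E1 E2.
    set x := k * t; have xx := cos2Dsin2 x; have dd := cos2Dsin2 d.
    have -> : - (r * cos d * (- k * sin x) + r * sin d * (k * cos x)) *
       (sin x * cos d - cos x * sin d) + (r * cos d * cos x + r * sin d * sin x) *
       (cos x * cos d + sin x * sin d)
     = r * (k * (sin x * cos d - cos x * sin d) ^+ 2
        + (cos x * cos d + sin x * sin d) ^+ 2) by ring.
    rewrite mulr_gt0//.
    have [z|z] := eqVneq (cos x * cos d + sin x * sin d) 0; last first.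
      apply: ltr_wpDl; last by rewrite exprn_even_gt0.
      by rewrite mulr_ge0 ?sqr_ge0// ltW.
    have -> : (sin x * cos d - cos x * sin d) ^+ 2 = 1.
      have <- : (cos x ^+ 2 + sin x ^+ 2) * (cos d ^+ 2 + sin d ^+ 2)
        - (cos x * cos d + sin x * sin d) ^+ 2 = 1.
        by rewrite xx dd z mul1r expr0n subr0.
      ring.
    by rewrite z expr0n addr0 mulr1.
- have k2 : 0 < n%:R * a - 1.
    by move: an; rewrite subr_gt0 -ltr_pdivrMl// mulr1.
  pose k := Num.sqrt (n%:R * a - 1).
  have k0 : 0 < k by rewrite sqrtr_gt0.
  have kk : k ^+ 2 = - (1 - n%:R * a) by rewrite sqr_sqrtr ?(ltW k2)// opprB.
  exists (fun t => cosh (k * t)), (fun t => sinh (k * t)),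
    (fun t => k * sinh (k * t)), (fun t => k * cosh (k * t)), k.
  split.
  + by move=> c1 c2 t; rewrite /vartheta ltNge (ltW an)/= gt_eqF.
  + by move=> t; exact: is_derive_coshM.
  + by move=> t; exact: is_derive_sinhM.
  + move=> t; have := is_derive_cstM k (is_derive_sinhM k t).
    by rewrite mulrA -expr2 kk.
  + move=> t; have := is_derive_cstM k (is_derive_coshM k t).
    by rewrite mulrA -expr2 kk.
  + by rewrite gt_eqF.
  + move=> t; rewrite /cosh /sinh.
    have := expRN (k * t); have := expR_gt0 (k * t).
    by move: (expR (k * t)) => x x0 ->; field; rewrite gt_eqF.
  (* These are the coefficients of e^(k t) and e^(- k t) in h. The constant direction below is
     chosen so that the mixed terms A B cancel and only squares remain. *)
  + move=> c1 c2 c0; pose A := (c1 + c2) / 2; pose B := (c1 - c2) / 2.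
    apply: (@halfplane_of_constant _ _ ((B - A) / (2 * k)) ((A + B) / 2)) => t.
    have -> : - (c1 * (k * sinh (k * t)) + c2 * (k * cosh (k * t)))
        * ((B - A) / (2 * k)) + (c1 * cosh (k * t) + c2 * sinh (k * t)) * ((A + B) / 2)
        = A ^+ 2 * expR (k * t) + B ^+ 2 * expR (- (k * t)).
      rewrite /A /B /cosh /sinh; field; exact: lt0r_neq0.
    have e1 := expR_gt0 (k * t); have e2 := expR_gt0 (- (k * t)).
    have [A0|A0] := eqVneq A 0; last first.
      apply: ltr_pwDl; first by rewrite mulr_gt0// exprn_even_gt0.
      by rewrite mulr_ge0 ?sqr_ge0// ltW.
    have B0 : B != 0.
      apply: contraNneq c0 => B0.
      have -> : c1 = A + B by rewrite /A /B; field.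
      have -> : c2 = A - B by rewrite /A /B; field.
      by rewrite A0 B0 subr0 addr0 expr0n addr0.
    by rewrite A0 expr0n mul0r add0r mulr_gt0// exprn_even_gt0.
- have na : 1 - n%:R * a = 0 by rewrite an mulfV ?subrr// gt_eqF.
  exists (fun=> 1), (fun t => t), (fun=> 0), (fun=> 1), 1.
  split.
  + by move=> c1 c2 t; rewrite /vartheta an ltxx eqxx mulr1.
  + by move=> t; exact: (is_derive_cst (1 : R)).
  + by move=> t; exact: is_derive_id.
  + by move=> t; rewrite na oppr0 mul0r; exact: (is_derive_cst (0 : R)).
  + by move=> t; rewrite na oppr0 mul0r; exact: (is_derive_cst (1 : R)).
  + exact: oner_neq0.
  + by move=> t; rewrite mulr1 mul0r subr0.
  (* Here (-h', h) = (- c2, c1 + c2 t) is a vertical line, in the half plane of (- c2, 0), unless it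
     degenerates to the point (0, c1). *)
  + move=> c1 c2 c0; have [c20|c20] := eqVneq c2 0.
      apply: (@halfplane_of_constant _ _ 0 c1) => t.
      rewrite c20 mulr0 mulr1 mul0r !addr0 add0r -expr2 exprn_even_gt0//.
      by apply: contraNneq c0 => ->; rewrite c20 expr0n addr0.
    apply: (@halfplane_of_constant _ _ (- c2) 0) => t.
    by rewrite !mulr0 add0r addr0 mulr1 mulrNN -expr2 exprn_even_gt0.
Qed.

End Vartheta.

Lemma is_derive0_ball_cst (R : realType) (V : normedModType R) (f : V -> R)
    (c : V) (e : R) :
  (forall x v, ball c e x -> is_derive x v f 0) ->
  forall x y, ball c e x -> ball c e y -> f x = f y.
Proof.
move=> f0 x y cx cy; have yE : y = (y - x) + x by rewrite subrK.
pose g (t : R) := f (t *: (y - x) + x).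
have gd (t : R) : 0 <= t <= 1 -> is_derive t 1 g 0.
  move=> t01; apply: (is_derive_line f x (y - x) t 0).1; apply: f0.
  by apply: ball_segment => //; rewrite -yE.
have gi (t : R) : t \in `]0, 1[ -> is_derive t 1 g 0.
  by rewrite in_itv /= => /andP[t0 t1]; apply: gd; rewrite !ltW.
have gc : {within `[0, 1], continuous g}.
  apply: derivable_within_continuous => t; rewrite in_itv /= => /gd.
  by case.
have [t _] := MVT ltr01 gi gc.
rewrite /g scale1r scale0r add0r -yE mul0r => /eqP.
by rewrite subr_eq0 => /eqP.
Qed.

Section Alpha.
Context {R : realType}.
Variables (n : nat) (a : R) (C S dC dS : R -> R) (W : R).
Hypothesis FS : fundamental_system n a C S dC dS W.

Lemma derive1_vartheta c1 c2 t :
  derive1 (vartheta n a c1 c2) t = c1 * dC t + c2 * dS t.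
Proof.
have h := is_derive_add (is_derive_cstM c1 (fund_dC FS t))
  (is_derive_cstM c2 (fund_dS FS t)).
rewrite derive1E; have -> : vartheta n a c1 c2 = (fun s => c1 * C s + c2 * S s).
  by apply/funext => s; rewrite (vartheta_lin FS).
by case: h.
Qed.

Lemma alphaE c1 c2 t : alpha n a c1 c2 t =
  (- (c1 * dC t + c2 * dS t) * cos t - (c1 * C t + c2 * S t) * sin t,
   - (c1 * dC t + c2 * dS t) * sin t + (c1 * C t + c2 * S t) * cos t).
Proof. by rewrite /alpha derive1_vartheta (vartheta_lin FS). Qed.

Lemma cmod_polar (r t : R) : 0 <= r -> cmod (r * cos t, r * sin t) = r.
Proof.
move=> r0; rewrite /cmod /=; have -> : (r * cos t) ^+ 2 + (r * sin t) ^+ 2 = r ^+ 2.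
  by rewrite !exprMn -mulrDr cos2Dsin2 mulr1.
by rewrite sqrtr_sqr ger0_norm.
Qed.

Lemma is_derive_continuous (f : R -> R) t df : is_derive t (1 : R) f df ->
  {for t, continuous f}.
Proof.
by move=> [h _]; apply: differentiable_continuous; apply/derivable1_diffP.
Qed.

(** [alpha] is (-h' + i h) e^(i t), so t plus the half-plane angle of (-h', h) is a continuous
    argument on the whole line. It is then shifted by a constant to take the prescribed value at
    [t0]. *)
Lemma alpha_arg c1 c2 t0 s0 : c1 ^+ 2 + c2 ^+ 2 != 0 ->
  0 < cmod (alpha n a c1 c2 t0) ->
  alpha n a c1 c2 t0 = (cmod (alpha n a c1 c2 t0) * cos s0,
                        cmod (alpha n a c1 c2 t0) * sin s0) ->
  exists2 arg, continuous_arg (alpha n a c1 c2) arg & arg t0 = s0.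
Proof.
move=> c0 al0 al0E; have [sg csg Hsg] := fund_halfplane FS c0.
pose z1 t := - (c1 * dC t + c2 * dS t); pose z2 t := c1 * C t + c2 * S t.
pose P t := z1 t * cos (sg t) + z2 t * sin (sg t).
pose Q t := z2 t * cos (sg t) - z1 t * sin (sg t).
have P0 t : 0 < P t by exact: Hsg.
pose b t := t + (sg t + atan (Q t / P t)).
have cz1 : continuous z1.
  move=> t; have h := is_derive_opp (is_derive_add (is_derive_cstM c1 (fund_ddC FS t))
    (is_derive_cstM c2 (fund_ddS FS t))).
  exact: is_derive_continuous h.
have cz2 : continuous z2.
  move=> t; have h := is_derive_add (is_derive_cstM c1 (fund_dC FS t))
    (is_derive_cstM c2 (fund_dS FS t)).
  exact: is_derive_continuous h.
have ccos : continuous (fun t => cos (sg t)).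
  by move=> t; apply: continuous_comp (csg t) (@continuous_cos R (sg t)).
have csin : continuous (fun t => sin (sg t)).
  by move=> t; apply: continuous_comp (csg t) (@continuous_sin R (sg t)).
have cP : continuous P.
  move=> t; apply: (@continuousD R R R (fun t => z1 t * cos (sg t))
    (fun t => z2 t * sin (sg t))).
    by apply: (@continuousM R R z1 (fun t => cos (sg t))); [exact: cz1|exact: ccos].
  by apply: (@continuousM R R z2 (fun t => sin (sg t))); [exact: cz2|exact: csin].
have cQ : continuous Q.
  move=> t; apply: (@continuousB R R R (fun t => z2 t * cos (sg t))
    (fun t => z1 t * sin (sg t))).
    by apply: (@continuousM R R z2 (fun t => cos (sg t))); [exact: cz2|exact: ccos].
  by apply: (@continuousM R R z1 (fun t => sin (sg t))); [exact: cz1|exact: csin].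
have cb : continuous b.
  move=> t; apply: (@continuousD R R R id (fun t => sg t + atan (Q t / P t))).
    exact: cvg_id.
  apply: (@continuousD R R R sg (fun t => atan (Q t / P t))); first exact: csg.
  apply: (@continuous_comp R R R (fun t => Q t / P t) (@atan R)).
    apply: (@continuousM R R Q (fun t => (P t)^-1)); first exact: cQ.
    by apply: (@continuousV R R P); [exact: lt0r_neq0|exact: cP].
  exact: continuous_atan.
have bE t : alpha n a c1 c2 t = (cmod (alpha n a c1 c2 t) * cos (b t),
                                 cmod (alpha n a c1 c2 t) * sin (b t)).
  have [r r0 [E1 E2]] : exists2 r, 0 <= r &
      z1 t = r * cos (sg t + atan (Q t / P t)) /\
      z2 t = r * sin (sg t + atan (Q t / P t)).
    exists (Num.sqrt (z1 t ^+ 2 + z2 t ^+ 2)); first exact: sqrtr_ge0.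
    exact: halfplane_angle (P0 t).
  have E : alpha n a c1 c2 t = (r * cos (b t), r * sin (b t)).
    rewrite alphaE -/(z1 t) -/(z2 t) /b [cos (t + _)]cosD [sin (t + _)]sinD.
    by rewrite E1 E2; congr pair; ring.
  by rewrite E cmod_polar.
(* The shift is a whole number of turns, since both angles represent the nonzero [alpha] at [t0]. *)
have [cs1 sn0] : cos (s0 - b t0) = 1 /\ sin (s0 - b t0) = 0.
  have := bE t0; rewrite {1}al0E => -[].
  move=> /(mulfI (lt0r_neq0 al0)) c_eq /(mulfI (lt0r_neq0 al0)) s_eq.
  rewrite cosB sinB c_eq s_eq; split; last by rewrite mulrC subrr.
  by rewrite -!expr2 cos2Dsin2.
exists (fun t => b t + (s0 - b t0)); last by rewrite addrC subrK.
split.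
  move=> t; apply: (@continuousD R R R b (fun=> s0 - b t0)); first exact: cb.
  exact: cst_continuous.
move=> t /=; rewrite (cosD (b t)) (sinD (b t)) cs1 sn0 !mulr0 !mulr1 subr0 addr0.
exact: bE.
Qed.

End Alpha.

(** * Conservation of [c1] and [c2] along a polar chart *)

Section FirstIntegral.
Context {R : realType} {n : nat} (a : R).
Hypothesis n0 : (0 < n)%N.
Variables (C S dC dS : R -> R) (W : R).
Hypothesis FS : fundamental_system n a C S dC dS W.
Variables (F : 'rV[R]_n -> 'rV[R]_(n + n)) (x0 : 'rV[R]_n) (d : R).
Variables (r psi theta : 'rV[R]_n -> R) (xi : 'rV[R]_n -> 'rV[R]_n).
Let B := ball x0 d.
Hypothesis PD : polar_data a F B r psi theta xi.

(* Support function of the curve (r e^(i psi))^n with respect to the tangent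
   direction e^(i theta), and its derivative with respect to theta. *)
Definition support x := - (r x ^+ n * sin (theta x - n%:R * psi x)).
Definition dsupport x := - (r x ^+ n * cos (theta x - n%:R * psi x)).

(** In the first derivative the contributions of dr and dpsi cancel. In the second they add up to n
    a by (cos om)^2 + (sin om)^2 = 1. *)
Lemma is_derive_polar x v : B x -> let D := 'D_v theta x in
  is_derive x v support (dsupport x * D) /\
  is_derive x v dsupport (- (1 - n%:R * a) * support x * D).
Proof.
move=> xB D; set om := theta x - n%:R * psi x.
have hr := Ck_on_derive v xB (polar_r_smooth PD 1).
have hp := Ck_on_derive v xB (polar_psi_smooth PD 1).
have ht := Ck_on_derive v xB (polar_theta_smooth PD 1).
have hn := is_derive_mul (is_derive_cst (n%:R : R) x v) hp.
have ho := is_derive_add ht (is_derive_opp hn).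
have hrn := is_derive_pow n hr.
have h1 := is_derive_opp (is_derive_mul hrn (is_derive_sin_comp ho)).
have h2 := is_derive_opp (is_derive_mul hrn (is_derive_cos_comp ho)).
have rE : n%:R * r x ^+ n.-1 * 'D_v r x
    = n%:R * a * r x ^+ n * sin om * cos om * D.
  rewrite (polar_dr PD)// -/om -/D.
  have -> : r x ^+ n = r x * r x ^+ n.-1 by rewrite -exprS prednK.
  ring.
have pE : 'D_v psi x = a * sin om ^+ 2 * D by rewrite (polar_dpsi PD).
split.
- have <- : - ((n%:R * r x ^+ n.-1 * 'D_v r x) * sin om + r x ^+ n *
      (cos om * ('D_v theta x + - (0 * psi x + n%:R * 'D_v psi x))))
      = dsupport x * D; last exact: h1.
  rewrite rE pE -/D /dsupport -/om.
  have -> : sin om ^+ 2 = sin om * sin om by rewrite expr2.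
  ring.
- have <- : - ((n%:R * r x ^+ n.-1 * 'D_v r x) * cos om + r x ^+ n *
      (- sin om * ('D_v theta x + - (0 * psi x + n%:R * 'D_v psi x))))
      = - (1 - n%:R * a) * support x * D; last exact: h2.
  rewrite rE pE -/D /support -/om.
  transitivity (r x ^+ n * sin om * D
    * (1 - n%:R * a * (cos om ^+ 2 + sin om ^+ 2))); first by ring.
  by rewrite cos2Dsin2; ring.
Qed.

(** [K1] and [K2] are the numerators of Cramer's rule for c1 and c2, that is, Wronskians of the
    support function with S and C. Both have zero differential, so they are constant on the ball. *)
Lemma first_integral c1 c2 y x : B y -> B x ->
  support y = c1 * C (theta y) + c2 * S (theta y) ->
  dsupport y = c1 * dC (theta y) + c2 * dS (theta y) ->
  support x = c1 * C (theta x) + c2 * S (theta x) /\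
  dsupport x = c1 * dC (theta x) + c2 * dS (theta x).
Proof.
move=> yB xB Ey Edy.
pose K1 z := support z * dS (theta z) - dsupport z * S (theta z).
pose K2 z := C (theta z) * dsupport z - dC (theta z) * support z.
have dK z v : B z -> is_derive z v K1 0 /\ is_derive z v K2 0.
  move=> zB; have [hs hd] := is_derive_polar v zB.
  have ht := Ck_on_derive v zB (polar_theta_smooth PD 1).
  have hC := is_derive_chain ht (fund_dC FS (theta z)).
  have hS := is_derive_chain ht (fund_dS FS (theta z)).
  have hdC := is_derive_chain ht (fund_ddC FS (theta z)).
  have hdS := is_derive_chain ht (fund_ddS FS (theta z)).
  have h1 := is_derive_add (is_derive_mul hs hdS) (is_derive_opp (is_derive_mul hd hS)).
  have h2 := is_derive_add (is_derive_mul hC hd) (is_derive_opp (is_derive_mul hdC hs)).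
  split; [move: h1|move: h2]; set e := (X in is_derive _ _ _ X) => h;
    (have <- : e = 0 by rewrite /e /=; ring); exact: h.
have E1 : K1 x = K1 y.
  by apply: (is_derive0_ball_cst _ xB yB) => z v zB; case: (dK z v zB).
have E2 : K2 x = K2 y.
  by apply: (is_derive0_ball_cst _ xB yB) => z v zB; case: (dK z v zB).
have {}E1 : K1 x = c1 * W.
  rewrite E1 -(fund_wronskian FS (theta y)) /K1 Ey Edy; ring.
have {}E2 : K2 x = c2 * W.
  rewrite E2 -(fund_wronskian FS (theta y)) /K2 Ey Edy; ring.
have W0 := fund_W0 FS; have Wx := fund_wronskian FS (theta x).
split; apply: (mulIf W0).
- transitivity (K1 x * C (theta x) + K2 x * S (theta x)).
    by rewrite /K1 /K2 -{1}Wx; ring.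
  by rewrite E1 E2; ring.
- transitivity (K1 x * dC (theta x) + K2 x * dS (theta x)).
    by rewrite /K1 /K2 -{1}Wx; ring.
  by rewrite E1 E2; ring.
Qed.

End FirstIntegral.

(** * From local to global *)

Section SphereTransitivity.
Context {R : realType} {n : nat}.
Implicit Types x y : 'rV[R]_n.

Lemma mul_dyad x y z : z *m (x^T *m y) = dot z x *: y.
Proof. by rewrite mulmxA [z *m x^T]mx11_scalar mul_scalar_mx -dotE. Qed.

(** A rotation in the plane of [x] and a unit vector [y] orthogonal to it, with [x'] in that plane.
    Its generator x^T y - y^T x satisfies A^3 = - A, so [rot] applies. *)
Lemma SO_transitive x x' : (2 <= n)%N -> dot x x = 1 -> dot x' x' = 1 ->
  exists2 A : 'M[R]_n, SO A & x *m A = x'.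
Proof.
move=> n2 x1 x1'.
have [y [al [be [y1 xy xE ab]]]] : exists y (al be : R),
    [/\ dot y y = 1, dot x y = 0, x' = al *: x + be *: y & al ^+ 2 + be ^+ 2 = 1].
  pose w := x' - dot x x' *: x.
  have wx : dot x w = 0 by rewrite dotDr dotNr dotZr x1 mulr1 subrr.
  have unit (v : 'rV[R]_n) : v != 0 -> exists2 c, 0 < c & dot (c^-1 *: v) (c^-1 *: v) = 1.
    move=> v0; exists (Num.sqrt (dot v v)).
      by rewrite sqrtr_gt0 lt_neqAle eq_sym dot_eq0 v0 dot_ge0.
    rewrite dotZl dotZr mulrA -invfM -expr2 sqr_sqrtr ?dot_ge0// mulVf//.
    by rewrite dot_eq0.
  have norm1 (y : 'rV[R]_n) (al be : R) : dot y y = 1 -> dot x y = 0 ->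
      x' = al *: x + be *: y -> al ^+ 2 + be ^+ 2 = 1.
    move=> y1 xy E; rewrite -x1' E !(dotDl, dotDr, dotZl, dotZr) x1 y1 (dotC y) xy.
    ring.
  (* If [x'] is a multiple of [x], the plane is not determined. Any [y] orthogonal to [x] will do,
     and 2 <= n provides one. *)
  have [w0|w0] := eqVneq w 0.
  - have [y y0 xy] : exists2 y, y != 0 & dot x y = 0.
      have kn0 : kermx x^T != 0.
        rewrite -mxrank_eq0 mxrank_ker subn_eq0 -ltnNge.
        by apply: leq_ltn_trans (rank_leq_col _) _.
      have [i ri] : exists i, row i (kermx x^T) != 0.
        apply: contrapT => N; move/negP: kn0; apply; apply/eqP/row_matrixP => i.
        by rewrite row0; apply: contrapT => /eqP h; apply: N; exists i.
      exists (row i (kermx x^T)) => //.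
      by rewrite dotC dotE -row_mul mulmx_ker row0 mxE.
    have [c c0 y1] := unit y y0.
    have xy' : dot x (c^-1 *: y) = 0 by rewrite dotZr xy mulr0.
    have E : x' = dot x x' *: x + 0 *: (c^-1 *: y).
      by rewrite scale0r addr0; apply/eqP; rewrite -subr_eq0 -/w w0.
    by exists (c^-1 *: y), (dot x x'), 0; split=> //; exact: norm1 E.
  - have [c c0 y1] := unit w w0.
    have xy' : dot x (c^-1 *: w) = 0 by rewrite dotZr wx mulr0.
    have E : x' = dot x x' *: x + c *: (c^-1 *: w).
      by rewrite scalerA mulfV ?gt_eqF// scale1r /w addrC subrK.
    by exists (c^-1 *: w), (dot x x'), c; split=> //; exact: norm1 E.
have [|s [cE sE]] := @angle_exists R al be; first by rewrite ab oner_neq0.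
rewrite ab sqrtr1 !mul1r in cE sE.
pose A := x^T *m y - y^T *m x.
have zA z : z *m A = dot z x *: y - dot z y *: x by rewrite mulmxBr !mul_dyad.
have xA : x *m A = y by rewrite zA x1 xy scale1r scale0r subr0.
have yA : y *m A = - x by rewrite zA y1 (dotC y) xy scale0r scale1r add0r.
have skA : A^T = - A by rewrite /A linearB /= !trmx_mul !trmxK opprB.
have cuA : A *m A *m A = - A.
  have -> : A *m A *m A = x^T *m (y *m A *m A) - y^T *m (x *m A *m A).
    by rewrite {1}/A !mulmxBl !mulmxA.
  by rewrite xA yA mulNmx xA !mulmxN opprK /A opprB addrC.
clearbody A; exists (rot A s); first exact: SO_rot.
rewrite /rot !mulmxDr mulmx1 -!scalemxAr (mulmxA x A A) xA yA xE cE sE.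
by apply/rowP => l; rewrite !mxE; ring.
Qed.

End SphereTransitivity.

Section AngleShift.
Context {R : realType}.

Lemma sin_natmul0 (k : nat) (t : R) : sin t = 0 -> sin (k%:R * t) = 0.
Proof.
move=> t0; elim: k => [|k IH]; first by rewrite mul0r sin0.
by rewrite -natr1 mulrDl mul1r sinD t0 IH mul0r mulr0 addr0.
Qed.

Lemma cos_sqr_of_sin0 (t : R) : sin t = 0 -> cos t * cos t = 1.
Proof. by move=> t0; have := cos2Dsin2 t; rewrite t0 expr0n addr0. Qed.

Lemma sin0B (s t : R) : sin s = 0 -> sin t = 0 -> sin (s - t) = 0.
Proof. by move=> s0 t0; rewrite sinB s0 t0 mul0r mulr0 subr0. Qed.

(** Values with cosine 1 are multiples of 2 pi, hence isolated: leaving 0, [f] would take a value in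
    (0, pi], where the cosine is below 1. *)
Lemma cos1_ball0 (V : normedModType R) (c : V) (e : R) (f : V -> R) x y :
  (forall z, ball c e z -> {for z, continuous f}) ->
  (forall z, ball c e z -> cos (f z) = 1) ->
  ball c e x -> ball c e y -> f x = 0 -> f y = 0.
Proof.
have pos (g : V -> R) : (forall z, ball c e z -> {for z, continuous g}) ->
    (forall z, ball c e z -> cos (g z) = 1) ->
    ball c e x -> ball c e y -> g x = 0 -> g y <= 0.
  move=> cg g1 xB yB gx; rewrite leNgt; apply/negP => gy.
  (* The cap 1 keeps the intermediate value within [0, pi], where the cosine is injective. *)
  pose m := Num.min (g y) 1.
  have m0 : 0 < m by rewrite lt_min gy ltr01.
  have [|z zB zm] := IVT_ball (z := m) cg xB yB.
    by rewrite gx ltW//= ge_min lexx.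
  have m1 : m <= pi by rewrite (le_trans _ (pi_ge2 R))// ge_min [1 <= 2]ler1n orbT.
  have : m = 0.
    apply: cos_inj; rewrite ?in_itv/= ?lexx ?pi_ge0 ?m1 ?ltW//.
    by rewrite -zm g1// cos0.
  by move/eqP; rewrite gt_eqF.
move=> cf f1 xB yB fx; apply/eqP; rewrite eq_le pos//=.
rewrite -oppr_le0; apply: (pos (fun z => - f z)) => //.
- by move=> z zB; apply: continuousN; exact: cf.
- by move=> z zB; rewrite cosN f1.
- by rewrite fx oppr0.
Qed.

End AngleShift.

Section PolarShift.
Context {R : realType} {n : nat} (a : R).
Variables (F : 'rV[R]_n -> 'rV[R]_(n + n)) (B : set 'rV[R]_n).
Variables (r psi theta : 'rV[R]_n -> R) (xi : 'rV[R]_n -> 'rV[R]_n).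
Hypothesis oB : open B.

(** A vanishing sine encodes a multiple of pi, and cos d is the sign by which [xi] changes. The
    equations for dr and dpsi are quadratic in the sine and cosine of om, so signs square away. *)
Lemma polar_data_shift (d e : R) : sin d = 0 -> sin e = 0 ->
  polar_data a F B r psi theta xi ->
  polar_data a F B r (fun x => psi x + d) (fun x => theta x + e)
    (fun x => cos d *: xi x).
Proof.
move=> d0 e0 PD; have cd := cos_sqr_of_sin0 d0.
have sh c : sin (e - c%:R * d) = 0 by apply: sin0B => //; exact: sin_natmul0.
have omE x : theta x + e - n%:R * (psi x + d)
    = (theta x - n%:R * psi x) + (e - n%:R * d) by ring.
have cst (c : R) k : Ck_on k B (fun=> c) by exact: (@Ck_on_cst _ _ R).
have dpsi x v : B x -> 'D_v (fun x => psi x + d) x = 'D_v psi x.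
  move=> xB; have h := Ck_on_derive v xB (polar_psi_smooth PD 1).
  by have := is_derive_add h (is_derive_cst d x v); rewrite addr0 => -[].
have dth x v : B x -> 'D_v (fun x => theta x + e) x = 'D_v theta x.
  move=> xB; have h := Ck_on_derive v xB (polar_theta_smooth PD 1).
  by have := is_derive_add h (is_derive_cst e x v); rewrite addr0 => -[].
split.
- exact: polar_r_smooth PD.
- by move=> k; exact: (Ck_onD oB (polar_psi_smooth PD k) (cst d k)).
- by move=> k; exact: (Ck_onD oB (polar_theta_smooth PD k) (cst e k)).
- move=> k; apply: (Ck_on_mx oB) => i j.
  have -> : (fun x => (cos d *: xi x) i j) = (fun x => cos d * xi x i j).
    by apply/funext => x; rewrite mxE.
  exact: (Ck_onM oB (cst _ k) (Ck_on_coord i j oB (polar_xi_smooth PD k))).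
- exact: polar_r_gt0 PD.
- by move=> x xB; rewrite dotZl dotZr mulrA cd mul1r (polar_xi_unit PD).
- move=> x xB; rewrite (polar_eq PD xB) cosD sinD d0 !scalerA.
  by congr (row_mx (_ *: _) (_ *: _)); rewrite mulr0 ?subr0 ?addr0 -[LHS]mulr1 -cd; ring.
- move=> x xB; have [v vE] := polar_tangent PD xB.
  have sh' : sin (e - (n%:R - 1) * d) = 0.
    have -> : e - (n%:R - 1) * d = (e - n%:R * d) - (- d) by ring.
    by apply: sin0B => //; rewrite sinN d0 oppr0.
  exists ((cos (e - (n%:R - 1) * d) * cos d) *: v).
  rewrite -scalemxAl vE scale_row_mx !scalerA.
  have -> : theta x + e - (n%:R - 1) * (psi x + d)
    = (theta x - (n%:R - 1) * psi x) + (e - (n%:R - 1) * d) by ring.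
  rewrite [cos (_ + (e - _))]cosD [sin (_ + (e - _))]sinD sh' !mulr0 subr0 addr0.
  by congr (row_mx (_ *: _) (_ *: _)); ring.
- move=> x v xB; rewrite dth// (polar_dr PD)// omE.
  rewrite [cos (_ + (e - _))]cosD [sin (_ + (e - _))]sinD sh !mulr0 subr0 addr0.
  have := cos_sqr_of_sin0 (sh n); set u := cos (e - _) => uu.
  set s := sin _; set c := cos _.
  transitivity (a * r x * s * c * 'D_v theta x * (u * u)); last by ring.
  by rewrite uu mulr1.
- move=> x v xB; rewrite dth// dpsi// (polar_dpsi PD)// omE.
  rewrite [sin (_ + (e - _))]sinD sh !mulr0 addr0.
  have := cos_sqr_of_sin0 (sh n); set u := cos (e - _) => uu.
  set s := sin _.
  transitivity (a * s ^+ 2 * 'D_v theta x * (u * u)); last by ring.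
  by rewrite uu mulr1.
- by move=> x xB; have [v hv] := polar_dtheta PD xB; exists v; rewrite dth.
Qed.

End PolarShift.

Section OpenImage.
Context {R : realType} {V : normedModType R}.

(** Otherwise [f] restricted to the line through [x] along [v] would have an interior maximum at
    [x]. *)
Lemma derive_neq0_increase (c : V) (e : R) (f : V -> R) x v :
  (forall z, ball c e z -> differentiable f z) -> ball c e x ->
  'D_v f x != 0 -> exists2 y, ball c e y & f x < f y.
Proof.
move=> df xB Dv; apply: contrapT => N.
have fm y : ball c e y -> f y <= f x.
  by move=> yB; rewrite leNgt; apply/negP => h; apply: N; exists y.
pose g (s : R) := f (s *: v + x).
have cl : {for (0 : R), continuous (fun s : R => s *: v + x)}.
  apply: continuousD; last exact: cst_continuous.
  exact: scalel_continuous.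
have nB : nbhs x (ball c e) by apply: open_nbhs_nbhs; split=> //; exact: ball_open.
have [d /= d0 Hd] : exists2 d : R, 0 < d &
    forall s : R, ball (0 : R) d s -> ball c e (s *: v + x).
  have n0 : nbhs (0 : R) ((fun s : R => s *: v + x) @^-1` ball c e).
    by apply: cl; rewrite scale0r add0r.
  by have /nbhs_ballP[d /= d0 Hd] := n0; exists d => // s /Hd.
have dB (s : R) : s \in `](- d), d[ -> ball c e (s *: v + x).
  rewrite in_itv /= -ltr_norml => sd; apply: Hd.
  by rewrite -ball_normE /= sub0r normrN.
have gd (s : R) : s \in `](- d), d[ -> derivable g s 1.
  move=> /dB sB; have := (is_derive_line f x v s ('D_v f (s *: v + x))).1.
  by case=> //; apply/derivableP/diff_derivable/df.
have c0 : (0 : R) \in `](- d), d[ by rewrite in_itv /= oppr_lt0 d0.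
have dd : - d <= d by rewrite ge0_cp// ltW.
have hm : is_derive (0 : R) (1 : R) g 0.
  apply: derive1_at_max dd gd c0 _ => s /dB /fm.
  by rewrite /g scale0r add0r.
have h : is_derive (0 : R) (1 : R) g ('D_v f x).
  apply: (is_derive_line f x v 0 _).1; rewrite scale0r add0r.
  by apply/derivableP/diff_derivable/df.
by rewrite (is_derive_unique h hm) eqxx in Dv.
Qed.

(** [f] takes values above and, by the same argument for [- f], below f x on the ball; the
    intermediate value theorem fills the gap. *)
Lemma derive_neq0_nbhs_image (c : V) (e : R) (f : V -> R) x v :
  (forall z, ball c e z -> differentiable f z) -> ball c e x ->
  'D_v f x != 0 -> nbhs (f x) (f @` ball c e).
Proof.
move=> df xB Dv.
have [y yB fy] := derive_neq0_increase df xB Dv.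
have dfN z : ball c e z -> differentiable (- f) z.
  by move=> /df; exact: differentiableN.
have DvN : 'D_v (- f) x != 0.
  by rewrite deriveN ?oppr_eq0//; apply/diff_derivable/df.
have [w wB fw] := derive_neq0_increase dfN xB DvN.
have {}fw : f w < f x by rewrite -ltrN2.
have nI : nbhs (f x) `]f w, f y[%classic by apply: near_in_itvoo; rewrite in_itv/= fw.
apply: filterS nI => z; rewrite /= in_itv /= => /andP[z1 z2].
have cf u : ball c e u -> {for u, continuous f}.
  by move=> /df; exact: differentiable_continuous.
have fz : f w <= z <= f y by rewrite !ltW.
have [u uB fu] := IVT_ball cf wB yB fz.
by exists u.
Qed.

End OpenImage.

Lemma jacobian_comp (R : realType) n m p (F : 'rV[R]_n -> 'rV[R]_p)
    (f : 'rV[R]_n -> 'rV[R]_m) (G : 'rV[R]_m -> 'rV[R]_p) x :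
  differentiable F x -> differentiable f x -> differentiable G (f x) ->
  (\near x, F x = (G \o f) x) -> 'J F x = 'J f x *m 'J G (f x).
Proof.
move=> dF df dG FG; apply/row_matrixP => i; rewrite row_mul !rowE.
have J k l (h : 'rV[R]_k -> 'rV[R]_l) y v : v *m 'J h y = 'd h y v.
  exact: mul_rV_lin1.
rewrite !J -(deriveE _ dF) (near_eq_derive _ FG).
have dc : differentiable (G \o f) x by exact: differentiable_comp.
by rewrite (deriveE _ dc) (diff_comp df dG).
Qed.

(** * Smoothness and tangent spaces under change of chart *)

Section Charts.
Context {R : realType} {n : nat} (M : manifold R n).
Implicit Types e : chart R n M.

Lemma open_chart_preimage e (B : set 'rV[R]_n) : open B ->
  open (cdom e `&` cmap e @^-1` B).
Proof.
move=> oB; rewrite openE => p [ep Bp]; apply: filterI.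
  by apply: open_nbhs_nbhs; split=> //; exact: cdom_open.
by apply: (cmap_continuous ep); exact: open_nbhs_nbhs.
Qed.

Lemma open_chart_image e (U : set M) : open U ->
  open (cimg e `&` cinv e @^-1` U).
Proof.
move=> oU; rewrite openE => x [ex Ux]; apply: filterI.
  by apply: open_nbhs_nbhs; split=> //; exact: cimg_open.
by apply: (cinv_continuous ex); exact: open_nbhs_nbhs.
Qed.

Lemma smooth_map_of_chart e (B : set 'rV[R]_n) m (h : 'rV[R]_n -> 'rV[R]_m) :
  atlas e -> open B -> (forall k, Ck_on k B h) ->
  smooth_map (cdom e `&` cmap e @^-1` B) (h \o cmap e).
Proof.
move=> ae oB ch e1 ae1 k.
have oO := @open_chart_image e1 _ (@open_chart_preimage e _ oB).
apply: (Ck_on_mx oO) => i j.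
have UB x : (cimg e1 `&` cinv e1 @^-1` (cdom e `&` cmap e @^-1` B)) x ->
    B (transition e1 e x) by move=> [_ []].
apply: (@Ck_on_comp _ _ _ _ _ B (transition e1 e) (fun x => h x i j) oO oB UB).
  by apply: Ck_on_sub (atlas_smooth ae1 ae k) => x [ex [dx _]].
exact: Ck_on_coord.
Qed.

Lemma smooth_map_of_chart_fun e (B : set 'rV[R]_n) (h : 'rV[R]_n -> R) :
  atlas e -> open B -> (forall k, Ck_on k B h) ->
  smooth_map (cdom e `&` cmap e @^-1` B) (h \o cmap e).
Proof.
move=> ae oB ch e1 ae1 k.
have oO := @open_chart_image e1 _ (@open_chart_preimage e _ oB).
have UB x : (cimg e1 `&` cinv e1 @^-1` (cdom e `&` cmap e @^-1` B)) x ->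
    B (transition e1 e x) by move=> [_ []].
apply: (@Ck_on_comp _ _ _ _ _ B (transition e1 e) h oO oB UB) => //.
by apply: Ck_on_sub (atlas_smooth ae1 ae k) => x [ex [dx _]].
Qed.

Lemma jacobian_transition m (phi : M -> 'rV[R]_m) e e1 p :
  atlas e -> atlas e1 -> cdom e p -> cdom e1 p ->
  differentiable (phi \o cinv e) (cmap e p) ->
  differentiable (phi \o cinv e1) (cmap e1 p) ->
  exists K, 'J (phi \o cinv e) (cmap e p) = K *m 'J (phi \o cinv e1) (cmap e1 p).
Proof.
move=> ae ae1 ep e1p d d1; set x := cmap e p.
have ex : cimg e x by exact: cmap_img.
have xp : cinv e x = p by exact: cmapK.
have ox : overlap e e1 x by split=> //=; rewrite xp.
have oO : open (overlap e e1) by apply: open_chart_image; exact: cdom_open.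
have dt : differentiable (transition e e1) x.
  by apply: (atlas_smooth ae ae1 1%N).1.
have tx : transition e e1 x = cmap e1 p by rewrite /transition /= xp.
exists ('J (transition e e1) x); rewrite -tx in d1 *.
apply: jacobian_comp => //; apply: filterS (open_nbhs_nbhs (conj oO ox)).
by move=> y [ey e1y]; rewrite /transition /= cmapK.
Qed.

End Charts.

Section Propagation.
Context {R : realType} {n : nat} (M : manifold R n).
Variables (g : riemannian_metric M) (phi : M -> 'rV[R]_(n + n)) (a : R).
Hypothesis n2 : (2 <= n)%N.
Hypothesis iso : isometric_immersion g phi.
Hypothesis lag : lagrangian phi.
Hypothesis a0 : a != 0.
Hypothesis sol : imcf_homothetic_soliton g a phi.
Hypothesis inv : SO_invariant phi.
Variables (C S dC dS : R -> R) (W : R).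
Hypothesis FS : fundamental_system n a C S dC dS W.

Lemma soliton_polar_data (e : chart R n M) x : atlas e -> cimg e x ->
  exists (d : R) r psi theta xi, [/\ 0 < d, ball x d `<=` cimg e &
    polar_data a (phi \o cinv e) (ball x d) r psi theta xi].
Proof.
move=> ae ex; apply: polar_chart => //.
- exact: cimg_open.
- by move=> k; exact: (chart_smooth iso.1).
- by move=> y ey; exact: iso.1.2.
- by move=> y ey; exact: chart_lag.
- by move=> y i j ey; exact: (soliton_parallel iso lag a0 sol inv ae).
- by move=> y ey; exact: (soliton_neq0 iso sol ae).
- by move=> y ey; exact: (soliton_equation iso sol ae).
Qed.

Variables (c1 c2 : R) (arg : R -> R).
Let al := alpha n a c1 c2.
Hypothesis argP : continuous_arg al arg.

(* Besides lying on the model, q has the tangent direction that the model has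
   at parameter t, which pins down t up to multiples of pi. *)
Definition on_model (q : M) (t : R) (x : 'rV[R]_n) : Prop :=
  [/\ dot x x = 1, phi q = model al arg t x &
    forall e, atlas e -> cdom e q -> exists v : 'rV[R]_n,
      v *m 'J (phi \o cinv e) (cmap e q) =
      row_mx (cos (t - (n%:R - 1) * (arg t / n%:R)) *: x)
             (sin (t - (n%:R - 1) * (arg t / n%:R)) *: x)].

Lemma jacobian_in_chart (e e1 : chart R n M) q (w : 'rV[R]_(n + n)) :
  atlas e -> atlas e1 -> cdom e q -> cdom e1 q ->
  (exists v : 'rV[R]_n, v *m 'J (phi \o cinv e) (cmap e q) = w) ->
  exists v : 'rV[R]_n, v *m 'J (phi \o cinv e1) (cmap e1 q) = w.
Proof.
move=> ae ae1 eq e1q [v <-].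
have [K ->] := jacobian_transition ae ae1 eq e1q
  (chart_differentiable iso.1 ae (cmap_img eq))
  (chart_differentiable iso.1 ae1 (cmap_img e1q)).
by exists (v *m K); rewrite mulmxA.
Qed.

(** Solves alpha = (-h' + i h) e^(i t) for h and h'. The result has the shape of [support] and
    [dsupport], with r^n = |alpha| and n psi = arg. *)
Lemma alpha_support t : let z := al t in
  c1 * C t + c2 * S t = - (cmod z * sin (t - arg t)) /\
  c1 * dC t + c2 * dS t = - (cmod z * cos (t - arg t)).
Proof.
move=> z; have := argP.2 t; rewrite -/z {1}/z /al (alphaE FS) => -[E1 E2].
have c2s := cos2Dsin2 t; set h := c1 * C t + c2 * S t in E1 E2 *.
set dh := c1 * dC t + c2 * dS t in E1 E2 *; rewrite sinB cosB.
split.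
- transitivity (h * (cos t ^+ 2 + sin t ^+ 2)); first by rewrite c2s mulr1.
  transitivity ((- dh * sin t + h * cos t) * cos t - (- dh * cos t - h * sin t) * sin t).
    by ring.
  by rewrite E1 E2; ring.
- transitivity (dh * (cos t ^+ 2 + sin t ^+ 2)); first by rewrite c2s mulr1.
  transitivity (- ((- dh * cos t - h * sin t) * cos t + (- dh * sin t + h * cos t) * sin t)).
    by ring.
  by rewrite E1 E2; ring.
Qed.

Lemma powR_root (r : R) : 0 <= r -> (r ^+ n) `^ n%:R^-1 = r.
Proof.
move=> r0; rewrite -powR_mulrn// -powRrM mulfV ?powRr1//.
by rewrite pnatr_eq0 -lt0n (leq_trans _ n2).
Qed.

Lemma root_powR (r : R) : 0 <= r -> (r `^ n%:R^-1) ^+ n = r.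
Proof.
move=> r0; rewrite -powR_mulrn ?powR_ge0// -powRrM mulVf ?powRr1//.
by rewrite pnatr_eq0 -lt0n (leq_trans _ n2).
Qed.


(* The first integrals propagate the support function, hence
   alpha o theta = (r e^(i psi))^n, and continuity selects the n-th root. *)
Lemma polar_data_model (F : 'rV[R]_n -> 'rV[R]_(n + n)) (x0 : 'rV[R]_n) (d : R)
    r psi theta xi y z :
  polar_data a F (ball x0 d) r psi theta xi ->
  ball x0 d y -> ball x0 d z ->
  r y = cmod (al (theta y)) `^ n%:R^-1 -> psi y = arg (theta y) / n%:R ->
  r z = cmod (al (theta z)) `^ n%:R^-1 /\ psi z = arg (theta z) / n%:R.
Proof.
move=> PD yB zB ry py.
have N0 : n%:R != 0 :> R by rewrite pnatr_eq0 -lt0n (leq_trans _ n2).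
have n0 : (0 < n)%N by rewrite (leq_trans _ n2).
have npy : n%:R * psi y = arg (theta y) by rewrite py mulrC divfK.
have rny : r y ^+ n = cmod (al (theta y)) by rewrite ry root_powR// sqrtr_ge0.
have [Sy dSy] := alpha_support (theta y).
have alE w : ball x0 d w -> al (theta w) =
    (r w ^+ n * cos (n%:R * psi w), r w ^+ n * sin (n%:R * psi w)).
  move=> wB.
  have [Ew dEw] : support r psi theta w = c1 * C (theta w) + c2 * S (theta w) /\
      dsupport r psi theta w = c1 * dC (theta w) + c2 * dS (theta w).
    apply: (first_integral n0 FS PD yB wB).
    + by rewrite Sy -rny -npy.
    + by rewrite dSy -rny -npy.
  rewrite /al (alphaE FS) -Ew -dEw /support /dsupport.
  set t := theta w; set s := n%:R * psi w.
  have -> : cos s = cos t * cos (t - s) + sin t * sin (t - s).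
    by rewrite -cosB subKr.
  have -> : sin s = sin t * cos (t - s) - cos t * sin (t - s).
    by rewrite -sinB subKr.
  by congr pair; ring.
have r0 w : ball x0 d w -> 0 < r w by move=> wB; exact: (polar_r_gt0 PD wB).
have cmodE w : ball x0 d w -> cmod (al (theta w)) = r w ^+ n.
  by move=> wB; rewrite alE// cmod_polar// exprn_ge0// ltW// r0.
split; first by rewrite cmodE// powR_root// ltW// r0.
(* Both terms are arguments of the same nonzero number, so [f] takes values in 2 pi Z; it is
   continuous and vanishes at [y]. *)
pose f w := arg (theta w) - n%:R * psi w.
suff : f z = 0.
  move/eqP; rewrite subr_eq0 => /eqP E.
  by rewrite E mulrC mulKf.
apply: (cos1_ball0 (f := f) _ _ yB zB); last by rewrite /f npy subrr.
- move=> w wB; apply: (@continuousB _ R _ (fun w => arg (theta w))).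
    apply: (@continuous_comp _ _ _ theta arg); last exact: argP.1.
    exact: (polar_theta_smooth PD 0) wB.
  apply: (@continuousM _ _ (fun=> n%:R) psi); first exact: cst_continuous.
  exact: (polar_psi_smooth PD 0) wB.
- move=> w wB; have := argP.2 (theta w); rewrite {1}alE// cmodE//.
  have rn : r w ^+ n != 0 by rewrite expf_neq0// gt_eqF// r0.
  move=> [/(mulfI rn) E1 /(mulfI rn) E2].
  by rewrite /f cosB -E1 -E2 -!expr2 cos2Dsin2.
Qed.

(** Two polar descriptions of one position and one tangent line have the same r, while psi and theta
    differ by multiples of pi and [xi] by a sign. [polar_data_shift] removes the difference. *)
Lemma polar_align (F : 'rV[R]_n -> 'rV[R]_(n + n)) (x0 : 'rV[R]_n) (d : R)
    r psi theta xi y t x (v : 'rV[R]_n) :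
  polar_data a F (ball x0 d) r psi theta xi -> ball x0 d y ->
  'J F y *m Jmx *m ('J F y)^T = 0 ->
  dot x x = 1 -> F y = model al arg t x ->
  v *m 'J F y = row_mx (cos (t - (n%:R - 1) * (arg t / n%:R)) *: x)
                       (sin (t - (n%:R - 1) * (arg t / n%:R)) *: x) ->
  exists psi' theta' xi', [/\ polar_data a F (ball x0 d) r psi' theta' xi',
    theta' y = t, xi' y = x, r y = cmod (al t) `^ n%:R^-1 &
    psi' y = arg t / n%:R].
Proof.
move=> PD yB lagF x1 Fy vE; have xi1 := polar_xi_unit PD yB.
have r0 := polar_r_gt0 PD yB; have FE := polar_eq PD yB.
pose rho := cmod (al t) `^ n%:R^-1; pose P := arg t / n%:R.
have rho0 : 0 <= rho by exact: powR_ge0.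
have FM : F y = row_mx ((rho * cos P) *: x) ((rho * sin P) *: x) by [].
have nrm (s q : R) (z : 'rV[R]_n) : dot z z = 1 ->
    dot (row_mx ((s * cos q) *: z) ((s * sin q) *: z))
        (row_mx ((s * cos q) *: z) ((s * sin q) *: z)) = s ^+ 2.
  move=> z1; rewrite dot_row_mx !(dotZl, dotZr) z1.
  transitivity (s ^+ 2 * (cos q ^+ 2 + sin q ^+ 2)); first by ring.
  by rewrite cos2Dsin2 mulr1.
have rE : r y = rho.
  have := nrm (r y) (psi y) (xi y) xi1; rewrite -FE FM nrm// => /eqP.
  by rewrite eqrXn2 ?(ltW r0)// => /eqP.
have [Ec Es] : cos (psi y) *: xi y = cos P *: x /\ sin (psi y) *: xi y = sin P *: x.
  have : F y = F y by []; rewrite {1}FE FM -rE => /eq_row_mx[].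
  rewrite -!scalerA => E1 E2; split; apply: (scalerI (lt0r_neq0 r0));
    [exact: E1|exact: E2].
pose dl := P - psi y.
have xiE : xi y = cos dl *: x.
  rewrite -[LHS]scale1r -(cos2Dsin2 (psi y)) scalerDl !expr2 -!scalerA Ec Es.
  by rewrite !scalerA -scalerDl /dl cosB; congr (_ *: _); ring.
have dl0 : sin dl = 0.
  have : (cos (psi y) * sin P - sin (psi y) * cos P) *: x = 0.
    rewrite scalerBl -!scalerA -Ec -Es !scalerA [X in _ - X *: _]mulrC.
    by rewrite subrr.
  move/(congr1 (fun z => dot z x)); rewrite dotZl x1 mulr1 dot0l => h.
  by rewrite /dl sinB -h; ring.
have [v0 v0E] := polar_tangent PD yB.
pose ep := t - theta y.
(* Both tangent vectors lie in one Lagrangian space, and their [omega] is the sine of the difference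
   of their angles, up to the sign cos dl. *)
have ep0 : sin ep = 0.
  set e0 := theta y - (n%:R - 1) * psi y in v0E.
  set e1 := t - (n%:R - 1) * (arg t / n%:R) in vE.
  have : omega (v0 *m 'J F y) (v *m 'J F y) = 0.
    by rewrite omegaE trmx_mul !mulmxA -(mulmxA v0) -(mulmxA v0) lagF
      mulmx0 mul0mx mxE.
  rewrite v0E vE omega_row_mx !(dotZl, dotZr) xiE dotZl x1 => h.
  have h' : cos dl * sin (e1 - e0) = 0 by rewrite sinB -[RHS]h; ring.
  have : sin (e1 - e0) = 0.
    rewrite -[LHS]mul1r -(cos_sqr_of_sin0 dl0) -mulrA h' mulr0.
    by [].
  have nd : sin ((n%:R - 1) * dl) = 0.
    have -> : (n%:R - 1) * dl = n%:R * dl - dl by ring.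
    by apply: sin0B => //; exact: sin_natmul0.
  move=> h2; have -> : ep = (e1 - e0) - (- ((n%:R - 1) * dl)).
    by rewrite /ep /e1 /e0 /dl /P; ring.
  by apply: sin0B => //; rewrite sinN nd oppr0.
have oB : open (ball x0 d) := ball_open x0 d.
exists (fun z => psi z + dl), (fun z => theta z + ep), (fun z => cos dl *: xi z).
split.
- exact: polar_data_shift.
- by rewrite /ep addrC subrK.
- by rewrite xiE scalerA cos_sqr_of_sin0// scale1r.
- exact: rE.
- by rewrite /dl addrC subrK.
Qed.

End Propagation.

(** * The connectedness argument for model parameters *)

Section Globalization.
Context {R : realType} {n : nat} (M : manifold R n).
Variables (g : riemannian_metric M) (phi : M -> 'rV[R]_(n + n)) (a : R).
Hypothesis n2 : (2 <= n)%N.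
Hypothesis conM : connected [set: M].
Hypothesis iso : isometric_immersion g phi.
Hypothesis lag : lagrangian phi.
Hypothesis a0 : a != 0.
Hypothesis sol : imcf_homothetic_soliton g a phi.
Hypothesis inv : SO_invariant phi.
Variables (C S dC dS : R -> R) (W : R).
Hypothesis FS : fundamental_system n a C S dC dS W.
Variables (c1 c2 : R) (arg : R -> R).
Let al := alpha n a c1 c2.
Hypothesis argP : continuous_arg al arg.
Let onM := on_model phi a c1 c2 arg.

Lemma on_model_propagates (p : M) : exists U : set M, [/\ open U, U p &
  forall q t x, U q -> onM q t x ->
  exists (theta : M -> R) (xi : M -> 'rV[R]_n),
    [/\ smooth_map U theta, smooth_map U xi, theta q = t /\ is_interval (theta @` U),
        forall q', U q' -> onM q' (theta q') (xi q') &
        forall q', U q' -> nbhs (theta q') (theta @` U)]].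
Proof.
have [e ae ep] := atlas_cover p.
have ex := cmap_img ep.
have [d [r [psi0 [theta0 [xi0 [d0 Be PD0]]]]]] :=
  soliton_polar_data iso lag a0 sol inv ae ex.
set B := ball (cmap e p) d in Be PD0 *.
have oB : open B := ball_open _ _.
exists (cdom e `&` cmap e @^-1` B); split.
- exact: open_chart_preimage.
- by split=> //; exact: ballxx.
move=> q t x [eq qB] [x1 qE qT].
have [v vE] := qT e ae eq.
have Fq : (phi \o cinv e) (cmap e q) = model al arg t x by rewrite /= cmapK.
have [psi [theta [xi [PD ty xy ry py]]]] :=
  polar_align PD0 qB (chart_lag lag ae (cmap_img eq)) x1 Fq vE.
have ry' : r (cmap e q) = cmod (al (theta (cmap e q))) `^ n%:R^-1 by rewrite ty.
have py' : psi (cmap e q) = arg (theta (cmap e q)) / n%:R by rewrite ty.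
have agree z (zB : B z) := polar_data_model n2 FS argP PD qB zB ry' py'.
have imE : (theta \o cmap e) @` (cdom e `&` cmap e @^-1` B) = theta @` B.
  apply/seteqP; split => [s [q' [_ q'B] <-]|s [z zB <-]].
    by exists (cmap e q').
  have ez := Be _ zB; exists (cinv e z); last by rewrite /= cinvK.
  by split; [exact: cinv_dom|rewrite /= cinvK].
have ct z : B z -> {for z, continuous theta}.
  by move=> zB; exact: (polar_theta_smooth PD 0) zB.
have dt z : B z -> differentiable theta z.
  by move=> zB; exact: (polar_theta_smooth PD 1).1 zB.
exists (theta \o cmap e), (xi \o cmap e); split.
- exact: (smooth_map_of_chart_fun ae oB (polar_theta_smooth PD)).
- exact: (smooth_map_of_chart ae oB (polar_xi_smooth PD)).
- split; first exact: ty.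
  rewrite imE => s1 s2 [z1 z1B <-] [z2 z2B <-] s s12.
  by have [z zB zs] := IVT_ball ct z1B z2B s12; exists z.
- move=> q' [eq' q'B]; have [rE pE] := agree _ q'B.
  split; first exact: (polar_xi_unit PD q'B).
  + have := polar_eq PD q'B; rewrite /= cmapK// => ->.
    by rewrite /model -rE -pE.
  + move=> e1 ae1 e1q'; apply: (jacobian_in_chart iso ae ae1 eq' e1q').
    by have := polar_tangent PD q'B; rewrite pE.
- move=> q' [eq' q'B]; rewrite imE.
  have [w Dw] := polar_dtheta PD q'B.
  exact: derive_neq0_nbhs_image dt q'B Dw.
Qed.

Lemma model_SO_act t x (A : 'M[R]_n) :
  SO_act A (model al arg t x) = model al arg t (x *m A).
Proof. by rewrite /SO_act /model row_mxKl row_mxKr -!scalemxAl. Qed.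

(** The parameters reached by propagation from [p0] must form one interval, though a point may have
    several of them. So the clopen subset of [M] is defined by having some parameter in a fixed
    interval [I]. *)
Lemma parametrized_by_model (p0 : M) t0 x0 : onM p0 t0 x0 ->
  parametrized_by phi (fun t x => 1 *: model al arg t x).
Proof.
move=> p0M; pose T t := exists q x, onM q t x.
(* The connected component of [t0] in the set of all attained parameters. *)
pose I : set R := [set t | forall s, Num.min t0 t <= s <= Num.max t0 t -> T s].
have It0 : I t0.
  move=> s; rewrite minxx maxxx => h; have -> : s = t0 by apply/eqP; rewrite eq_le andbC.
  by exists p0, x0.
have IT t : I t -> T t by apply; rewrite ge_min le_max lexx !orbT.
have intI : is_interval I.
  move=> s1 s2 I1 I2 s /andP[h1 h2] u.
  have [st|st] := leP s t0.
    move=> /andP[u1 u2]; apply: I1.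
    by rewrite ge_min (le_trans h1 u1) orbT/= le_max u2.
  move=> /andP[u1 u2]; apply: I2.
  by rewrite ge_min u1/= le_max (le_trans u2 h2) orbT.
(* An interval of attained parameters that meets the component lies in it; applied to the images of
   the local theta. *)
have absorb (J : set R) t : is_interval J -> J `<=` T -> J t -> I t -> J `<=` I.
  move=> intJ JT Jt It t' Jt' s; have [Is|nIs] := pselect (I s).
    by move=> _; exact: IT.
  rewrite ge_min le_max => /andP[lo hi]; apply: JT.
  have lo' : (t <= s) || (t' <= s).
    rewrite -implyNb -ltNge; apply/implyP => st; rewrite leNgt; apply/negP => st'.
    apply: nIs; apply: (intI t0 t) => //; rewrite (ltW st) andbT.
    by case/orP: lo => //; rewrite leNgt st'.
  have hi' : (s <= t) || (s <= t').
    rewrite -implyNb -ltNge; apply/implyP => st; rewrite leNgt; apply/negP => st'.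
    apply: nIs; apply: (intI t t0) => //; rewrite (ltW st) /=.
    by case/orP: hi => //; rewrite leNgt st'.
  case/orP: lo' => l; case/orP: hi' => h.
  - by have -> : s = t by apply/eqP; rewrite eq_le h l.
  - by apply: (intJ t t') => //; rewrite l h.
  - by apply: (intJ t' t) => //; rewrite l h.
  - by have -> : s = t' by apply/eqP; rewrite eq_le h l.
pose A : set M := [set q | exists t x, I t /\ onM q t x].
have inU U q t x : (forall q t x, U q -> onM q t x ->
   exists (theta : M -> R) (xi : M -> 'rV[R]_n),
    [/\ smooth_map U theta, smooth_map U xi, theta q = t /\ is_interval (theta @` U),
        forall q', U q' -> onM q' (theta q') (xi q') &
        forall q', U q' -> nbhs (theta q') (theta @` U)]) ->
   U q -> I t -> onM q t x ->
   exists (theta : M -> R) (xi : M -> 'rV[R]_n),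
    [/\ smooth_map U theta, smooth_map U xi, theta q = t /\ theta @` U `<=` I,
        forall q', U q' -> onM q' (theta q') (xi q') &
        forall q', U q' -> nbhs (theta q') (theta @` U)].
  move=> HU Uq It qM; have [theta [xi [s1 s2 [tq intU] onU nU]]] := HU q t x Uq qM.
  exists theta, xi; split=> //; split=> //.
  apply: (absorb _ t) => //.
    by move=> s [q' Uq' <-]; exists q', (xi q'); exact: onU.
  by exists q.
have AT : A = [set: M].
  apply: conM; first by exists p0, t0, x0.
  - exists A; last by rewrite setTI.
    rewrite openE => q [t [x [It qM]]].
    have [U [oU Uq HU]] := on_model_propagates q.
    have [theta [xi [_ _ [tq UI] onU _]]] := inU U q t x HU Uq It qM.
    apply: filterS (open_nbhs_nbhs (conj oU Uq)) => q' Uq'.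
    by exists (theta q'), (xi q'); split; [apply: UI; exists q'|exact: onU].
  - exists A; last by rewrite setTI.
    rewrite -[A]setCK; apply: open_closedC; rewrite openE => p nAp.
    have [U [oU Up HU]] := on_model_propagates p.
    apply: filterS (open_nbhs_nbhs (conj oU Up)) => q Uq [t [x [It qM]]].
    apply: nAp; have [theta [xi [_ _ [tq UI] onU _]]] := inU U q t x HU Uq It qM.
    by exists (theta p), (xi p); split; [apply: UI; exists p|exact: onU].
exists I; split=> //.
- rewrite openE => t It; have [q [x qM]] := IT t It.
  have [U [oU Uq HU]] := on_model_propagates q.
  have [theta [xi [_ _ [tq UI] _ nU]]] := inU U q t x HU Uq It qM.
  by have := nU q Uq; rewrite tq; apply: filterS.
- apply/seteqP; split => [z [p _ <-]|z [t [x [It x1 ->]]]].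
    have : A p by rewrite AT.
    move=> [t [x [It [x1 pE _]]]]; exists t, x; split=> //.
    by rewrite scale1r.
  (* An attained [t] yields one point of its sphere in the image; invariance of the image and
     transitivity on the sphere yield the others. *)
  rewrite scale1r; have [q [y [y1 qE _]]] := IT t It.
  have [B SB yB] := SO_transitive n2 y1 x1.
  rewrite -(inv SB); exists (phi q); first by exists q.
  by rewrite qE model_SO_act yB.
- move=> p; have : A p by rewrite AT.
  move=> [t [x [It pM]]]; have [U [oU Up HU]] := on_model_propagates p.
  have [theta [xi [s1 s2 [tq UI] onU _]]] := inU U p t x HU Up It pM.
  exists U, theta, xi; split=> // q Uq; have [x1 qE _] := onU q Uq.
  by split=> //; [apply: UI; exists q|rewrite scale1r].
Qed.

End Globalization.

Lemma alpha00 (R : realType) n a C S dC dS W t :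
  @fundamental_system R n a C S dC dS W -> alpha n a 0 0 t = (0, 0).
Proof.
by move=> FS; rewrite (alphaE FS) !mul0r !addr0 oppr0 !mul0r subr0 addr0.
Qed.

Unset Implicit Arguments.

Theorem corollary4p1 (R : realType) (n : nat) (M : manifold R n)
  (g : riemannian_metric M) (phi : M -> 'rV[R]_(n + n)) (a : R) :
  (2 <= n)%N ->
  connected [set: M] ->
  isometric_immersion g phi ->
  lagrangian phi ->
  a != 0 ->
  imcf_homothetic_soliton g a phi ->
  SO_invariant phi ->
  exists (rho c1 c2 : R) (arg : R -> R),
    [/\ 0 < rho,
        continuous_arg (alpha n a c1 c2) arg &
        parametrized_by phi
          (fun t x => rho *: model (alpha n a c1 c2) arg t x)].
Proof.
move=> n2 conM iso lag a0 sol inv.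
have n0 : (0 < n)%N by rewrite (leq_trans _ n2).
have [C [S [dC [dS [W FS]]]]] := fundamental_system_exists a n0.
(* [connected] admits the empty manifold, which is parametrized by the empty interval. *)
have [[p0]|empty] := pselect (inhabited M); last first.
  exists 1, 0, 0, (fun=> 0); split=> //.
  - split=> [t|t]; first exact: cst_continuous.
    rewrite (alpha00 _ FS) /cmod /= expr0n /= addr0 sqrtr0 !mul0r.
    by [].
  - exists set0; split=> //.
    + by apply/seteqP; split=> [z [p]|z [t [x []]]] => //; case: empty.
    + by move=> p; case: empty.
have [e ae ep] := atlas_cover p0; have ex := cmap_img ep.
have [d [r [psi [theta [xi [d0 Be PD]]]]]] :=
  soliton_polar_data iso lag a0 sol inv ae ex.
set x := cmap e p0 in ex Be PD *; have xB : ball x d x by exact: ballxx.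
have r0 := polar_r_gt0 PD xB.
set t0 := theta x; set om := t0 - n%:R * psi x.
pose h := - (r x ^+ n * sin om); pose dh := - (r x ^+ n * cos om).
have W0 := fund_W0 FS; have Wt := fund_wronskian FS t0.
(* Cramer's rule: these constants give the model the support function and derivative that [phi] has
   at [p0]. *)
pose c1 := (h * dS t0 - dh * S t0) / W; pose c2 := (C t0 * dh - dC t0 * h) / W.
have hE : c1 * C t0 + c2 * S t0 = h.
  apply: (mulIf W0); transitivity (h * (C t0 * dS t0 - dC t0 * S t0)).
    by rewrite /c1 /c2; field.
  by rewrite Wt.
have dhE : c1 * dC t0 + c2 * dS t0 = dh.
  apply: (mulIf W0); transitivity (dh * (C t0 * dS t0 - dC t0 * S t0)).
    by rewrite /c1 /c2; field.
  by rewrite Wt.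
have alE : alpha n a c1 c2 t0
    = (r x ^+ n * cos (n%:R * psi x), r x ^+ n * sin (n%:R * psi x)).
  rewrite (alphaE FS) hE dhE /h /dh.
  have -> : n%:R * psi x = t0 - om by rewrite subKr.
  by rewrite cosB sinB; congr pair; ring.
have rn0 : 0 < r x ^+ n by rewrite exprn_gt0.
have cmE : cmod (alpha n a c1 c2 t0) = r x ^+ n by rewrite alE cmod_polar// ltW.
(* With both constants zero [alpha] would vanish, while its modulus at [t0] is r^n > 0. *)
have cn0 : c1 ^+ 2 + c2 ^+ 2 != 0.
  apply: contraTneq rn0 => /eqP; rewrite paddr_eq0 ?sqr_ge0// !sqrf_eq0.
  move=> /andP[/eqP z1 /eqP z2]; rewrite -cmE z1 z2 (alpha00 _ FS) /cmod /=.
  by rewrite expr0n /= addr0 sqrtr0 ltxx.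
have [|| arg argP argt] := @alpha_arg _ _ _ _ _ _ _ _ FS c1 c2 t0 (n%:R * psi x) cn0.
- by rewrite cmE.
- by rewrite cmE alE.
(* A dilation by rho multiplies [alpha] by rho^n, and [alpha] is linear in (c1, c2): the constants
   chosen already carry the scale, so rho = 1. *)
exists 1, c1, c2, arg; split=> //.
apply: (parametrized_by_model n2 conM iso lag a0 sol inv FS argP (p0 := p0)
  (t0 := t0) (x0 := xi x)).
have N0 : n%:R != 0 :> R by rewrite pnatr_eq0 -lt0n.
have pE : arg t0 / n%:R = psi x by rewrite argt mulrC mulKf.
split; first exact: (polar_xi_unit PD xB).
- have := polar_eq PD xB; rewrite /= cmapK// => ->.
  by rewrite /model cmE powR_root ?ltW// pE.
- move=> e1 ae1 e1p; apply: (jacobian_in_chart iso ae ae1 ep e1p).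
  by rewrite pE; exact: (polar_tangent PD xB).
Qed.
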